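(* Let $0<p_1\le p_2\le 1$, $p_1<1$, and $x\in\mathbb R^d$ be such that $(p_1,x)\in\overline{\mathcal C}\cup\mathcal C'$ (equivalently, $p_1<c(x)$). Let $(\Gamma^{1,*},\Gamma^{2,*})\in\mathcal A^2$ be the pair of processes constructed from $(p_1,p_2,x)$ in the context. Then the strategy pair $(\tau^*,\gamma^* )\in\mathcal T^R_1\times\mathcal T^R_2$ generated by $(\Gamma^{1,*},\Gamma^{2,*})$, i.e. $\tau^*=\inf\{t\ge 0:\Gamma^{1,*}_t>U_1\}$ and $\gamma^*=\inf\{t\ge 0:\Gamma^{2,*}_t>U_2\}$, is a Nash equilibrium. Moreover, the equilibrium payoff of both players is $(1-p_1)V(x)$, i.e. $\mathcal J_1(\tau^*,\gamma^*;p_1,x)=\mathcal J_2(\tau^*,\gamma^*;p_2,x)=(1-p_1)V(x)$.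
   Context: **Probabilistic set-up.** A probability space $(\Omega,\mathcal F,\mathbb P)$ carries a continuous, $\mathbb R^d$-valued, strong Markov process $X$ which is regular (from any initial point it reaches any non-empty open set in finite time with positive probability), two Bernoulli random variables $\theta_1,\theta_2$ with $\mathbb P(\theta_i=1)=1-\mathbb P(\theta_i=0)=p_i$, and two Uniform$(0,1)$ random variables $U_1,U_2$; $X,\theta_1,\theta_2,U_1,U_2$ are mutually independent. $\mathcal F^X=\{\mathcal F^X_t\}_{0\le t<\infty}$ is the right-continuous augmentation of the filtration generated by $X$, $\mathcal T$ is the set of $\mathcal F^X$-stopping times, $\mathbb P_x(\cdot)=\mathbb P(\cdot\mid X_0=x)$, and $\mathbb E_x$ is the corresponding expectation. **Payoff function and single-player problem.** $r\ge 0$ is a constant and $g:\mathbb R^d\to[0,\infty)$ is continuous with $\sup_{x}g(x)>0$. Define $$V(x):=\sup_{\tau\in\mathcal T}\mathbb E_x[e^{-r\tau}g(X_\tau)1_{\{\tau<\infty\}}],\qquad \tau^*_V:=\inf\{t\ge0:V(X_t)=g(X_t)\}.$$ Standing assumption: $\mathbb E_x[\sup_{t\ge0}e^{-rt}g(X_t)]<\infty$ for all $x\in\mathbb R^d$; $V:\mathbb R^d\to[0,\infty)$ is continuous; and $\limsup_{t\to\infty}e^{-rt}V(X_t)1_{\{\tau^*_V=+\infty\}}=0$, $\mathbb P_x$-a.s. for every $x$. **Randomised stopping times.** $\mathcal A$ is the set of right-continuous, non-decreasing, $\mathcal F^X$-adapted processes $\Gamma=\{\Gamma_t;\,0-\le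 t<\infty\}$ with $\Gamma_{0-}=0$ and $\Gamma_t\le1$ for all $t\ge0$. For $i=1,2$, $\mathcal T^R_i$ is the set of random times of the form $\inf\{t\ge0:\Gamma_t>U_i\}$ with $\Gamma\in\mathcal A$ (with $\inf\emptyset=\infty$); such a random time is said to be generated by $\Gamma$. **Game.** Player 1 chooses $\tau\in\mathcal T^R_1$, Player 2 chooses $\gamma\in\mathcal T^R_2$. Put $\hat\gamma:=\gamma1_{\{\theta_1=1\}}+\infty1_{\{\theta_1=0\}}$ and $\hat\tau:=\tau1_{\{\theta_2=1\}}+\infty1_{\{\theta_2=0\}}$, and $$R_1(\tau,\gamma):=\big(g(X_\tau)1_{\{\tau<\hat\gamma\}}+\tfrac12g(X_\tau)1_{\{\tau=\hat\gamma\}}\big)1_{\{\tau<\infty\}},\qquad R_2(\tau,\gamma):=\big(g(X_\gamma)1_{\{\gamma<\hat\tau\}}+\tfrac12g(X_\gamma)1_{\{\gamma=\hat\tau\}}\big)1_{\{\gamma<\infty\}},$$ $$\mathcal J_1(\tau,\gamma;p_1,x):=\mathbb E_x[e^{-r\tau}R_1(\tau,\gamma)],\qquad \mathcal J_2(\tau,\gamma;p_2,x):=\mathbb E_x[e^{-r\gamma}R_2(\tau,\gamma)].$$ A pair $(\tau^*,\gamma^* )\in\mathcal T^R_1\times\mathcal T^R_2$ is a Nash equilibrium (for given $x,p_1,p_2$) if $\mathcal J_1(\tau,\gamma^*;p_1,x)\le\mathcal J_1(\tau^*,\gamma^*;p_1,x)$ and $\mathcal J_2(\tau^*,\gamma;p_2,x)\le\mathcal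 J_2(\tau^*,\gamma^*;p_2,x)$ for all $(\tau,\gamma)\in\mathcal T^R_1\times\mathcal T^R_2$. The equilibrium payoffs are $\mathcal J_i(\tau^*,\gamma^*;p_i,x)$, $i=1,2$. **Regions and boundaries.** $$\overline{\mathcal C}:=\{(p,x)\in(0,1)\times\mathbb R^d:(1-p)V(x)\ge g(x)\},$$ $$\mathcal C':=\{(p,x)\in(0,1)\times\mathbb R^d:(1-p/2)g(x)<(1-p)V(x)<g(x)\},$$ $$b(x):=\inf\{p\in[0,1]:(1-p)V(x)\le g(x)\},\qquad c(x):=\inf\{p\in[0,1]:(1-p)V(x)\le(1-p/2)g(x)\}.$$ **Construction of the strategies.** For $(p,x)\in\overline{\mathcal C}$ and $X_0=x$ set $$Z^{p,x}_t:=p\wedge\inf_{0\le s\le t}b(X_s),\qquad \Gamma^{p,x}_t:=\frac{p-Z^{p,x}_t}{p(1-Z^{p,x}_t)},\quad t\ge0.$$ For $(p_1,x)\in\overline{\mathcal C}\cup\mathcal C'$ set $$\Gamma^*_0:=\frac{2}{p_1}\Big(1-\frac{(1-p_1)V(x)}{g(x)}\Big)^+\ (\text{with }\Gamma^*_0:=0\text{ if }g(x)=0),\qquad q_1:=\frac{p_1(1-\Gamma^*_0)}{1-p_1\Gamma^*_0}.$$ (One has $0<q_1\le b(x)$ and $q_1<1$, so $(q_1,x)\in\overline{\mathcal C}$.) For $t\ge0$ define $$\Gamma^{2,*}_t:=\Gamma^*_0+(1-\Gamma^*_0)\Gamma^{q_1,x}_t,\qquad \Gamma^{1,*}_t:=\tfrac{p_1}{p_2}\Gamma^{2,*}_t1_{\{t<\tau^*_V\}}+1_{\{t\ge\tau^*_V\}},$$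 with $\Gamma^{1,*}_{0-}=\Gamma^{2,*}_{0-}=0$. *)

(* Defs.v *)
From HB Require Import structures.
From mathcomp Require Import all_boot all_order all_algebra.
From mathcomp Require Import all_classical all_reals all_analysis.
From mathcomp Require Import measurable_realfun.

Set Implicit Arguments.
Unset Strict Implicit.
Unset Printing Implicit Defensive.

Import Order.TTheory GRing.Theory Num.Theory.
Import numFieldNormedType.Exports.

Local Open Scope classical_set_scope.
Local Open Scope ring_scope.

(* R^d as row vectors, with its Borel sigma-algebra. *)
Definition borelRV (R : realType) (d : nat) :=
  g_sigma_algebraType (@open 'rV[R]_d).

(* Conventions: time is t : R restricted to 0 <= t (values of processes at
   negative times are irrelevant), and random times take values in [0, +oo],
   as functions Omega -> \bar R. *)

Section MarkovFamily.
Context {R : realType} {d : nat} {disp : measure_display}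
        {Omega : measurableType disp}.
(* P x plays the role of P( . | X_0 = x). *)
Variable P : 'rV[R]_d -> probability Omega R.
Variable X : R -> Omega -> 'rV[R]_d.

Definition path_events (J : set R) : set (set Omega) :=
  [set A | exists s B,
    [/\ J s, measurable (B : set (borelRV R d)) & A = X s @^-1` B]].

Definition sigmaX : set (set Omega) := <<s path_events `[0, +oo[ >>.

Definition null_sets : set (set Omega) :=
  [set N | measurable N /\ forall x, P x N = 0%E].

(* Augmented, right-continuous filtration F^X. The null events are those that
   are null under every P x, so that the filtration does not depend on x. *)
Definition filtrationX (t : R) : set (set Omega) :=
  \bigcap_(s in `]t, +oo[) <<s path_events `[0, s] `|` null_sets >>.

Definition stopping_time (tau : Omega -> \bar R) : Prop :=
  (forall w, (0 <= tau w)%E) /\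
  (forall t : R, 0 <= t -> filtrationX t [set w | (tau w <= t%:E)%E]).

Definition sigma_past (tau : Omega -> \bar R) : set (set Omega) :=
  [set A | measurable A /\
    forall t : R, 0 <= t -> filtrationX t (A `&` [set w | (tau w <= t%:E)%E])].

Record strong_markov_process : Prop := {
  smp_measurable : forall t : R, 0 <= t ->
    measurable_fun setT (X t : Omega -> borelRV R d) ;
  smp_continuous : forall w, {within `[0, +oo[, continuous (X ^~ w)} ;
  smp_start : forall x, P x [set w | X 0 w = x] = 1%E ;
  smp_kernel : forall (t : R) (B : set (borelRV R d)), 0 <= t -> measurable B ->
    measurable_fun (setT : set (borelRV R d))
      (fun x : borelRV R d => P x (X t @^-1` B)) ;
  (* P_x(X_{tau + s} \in B | F^X_tau) = P_{X_tau}(X_s \in B)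
     on {tau < oo}, integrated over A in F^X_tau *)
  smp_markov : forall x tau (A : set Omega) (s : R) (B : set (borelRV R d)),
    stopping_time tau -> sigma_past tau A -> 0 <= s -> measurable B ->
    P x (A `&` [set w | (tau w < +oo)%E /\ B (X (fine (tau w) + s) w)]) =
    (\int[P x]_(w in A `&` [set w | (tau w < +oo)%E])
        P (X (fine (tau w)) w) (X s @^-1` B))%E
}.

Definition regular_process : Prop :=
  forall x (O : set 'rV[R]_d), open O -> O !=set0 ->
    (0 < P x [set w | exists2 t : R, (0 <= t)%R & O (X t w)])%E.

(* The Bernoulli(p_i) variables theta_i (true encodes 1) and the Uniform(0,1)
   variables U_i. The product rule over the five sigma-algebras contains that
   over any subfamily, since each of them contains the whole space. *)
Record independent_randomisation (theta1 theta2 : Omega -> bool)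
    (U1 U2 : Omega -> R) (p1 p2 : R) : Prop := {
  ir_theta1_measurable : measurable_fun setT theta1 ;
  ir_theta2_measurable : measurable_fun setT theta2 ;
  ir_U1_measurable : measurable_fun setT U1 ;
  ir_U2_measurable : measurable_fun setT U2 ;
  ir_theta1_law : forall x (D : set bool),
    P x (theta1 @^-1` D) = bernoulli_prob p1 D ;
  ir_theta2_law : forall x (D : set bool),
    P x (theta2 @^-1` D) = bernoulli_prob p2 D ;
  ir_U1_law : forall x (C : set R), measurable C ->
    P x (U1 @^-1` C) = uniform_prob (@ltr01 R) C ;
  ir_U2_law : forall x (C : set R), measurable C ->
    P x (U2 @^-1` C) = uniform_prob (@ltr01 R) C ;
  ir_independent : forall x (A : set Omega) (D1 D2 : set bool) (C1 C2 : set R),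
    sigmaX A -> measurable C1 -> measurable C2 ->
    P x (A `&` (theta1 @^-1` D1) `&` (theta2 @^-1` D2)
           `&` (U1 @^-1` C1) `&` (U2 @^-1` C2)) =
    (P x A * P x (theta1 @^-1` D1) * P x (theta2 @^-1` D2)
           * P x (U1 @^-1` C1) * P x (U2 @^-1` C2))%E
}.

Section Stopping.
Variables (r : R) (g : 'rV[R]_d -> R).

Definition stopped_payoff (tau : Omega -> \bar R) (w : Omega) : R :=
  if tau w is t%:E then expR (- (r * t)) * g (X t w) else 0.

(* [fine] is harmless: under [standing_assumption] the supremum is finite. *)
Definition V (x : 'rV[R]_d) : R :=
  fine (ereal_sup
    [set ('E_(P x)[stopped_payoff tau])%E | tau in stopping_time]).

Definition tauV (w : Omega) : \bar R :=
  ereal_inf [set t%:E | t in [set t : R | 0 <= t /\ V (X t w) = g (X t w)]].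

Record payoff_function : Prop := {
  pf_rate : 0 <= r ;
  pf_continuous : continuous g ;
  pf_ge0 : forall x, 0 <= g x ;
  pf_sup : (0 < ereal_sup [set (g x)%:E | x in setT])%E
}.

Record standing_assumption : Prop := {
  sa_integrable : forall x,
    (\int[P x]_w ereal_sup
       [set (expR (- (r * t)) * g (X t w))%R%:E | t in `[0%R, +oo[ ] < +oo)%E ;
  sa_continuous : continuous V ;
  sa_limsup : forall x, {ae P x, forall w,
    limf_esup (fun t => (expR (- (r * t)) * V (X t w)
                         * \1_[set w' | tauV w' = +oo%E] w)%:E)
      (pinfty_nbhs R) = 0%E}
}.

(* The class A. The process is only recorded for t >= 0: given
   Gamma_{0-} = 0, monotonicity on [0-, oo) is monotonicity on [0, oo)
   together with 0 <= Gamma_0. *)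
Record generating_process (Gamma : R -> Omega -> R) : Prop := {
  gp_adapted : forall (t : R) (C : set R), 0 <= t -> measurable C ->
    filtrationX t (Gamma t @^-1` C) ;
  gp_right_continuous : forall w (t : R), 0 <= t ->
    (Gamma ^~ w) u @[u --> t^'+] --> Gamma t w ;
  gp_jump0 : forall w, 0 <= Gamma 0 w ;
  gp_nondecreasing : forall w (s t : R), 0 <= s -> s <= t -> Gamma s w <= Gamma t w ;
  gp_le1 : forall w (t : R), 0 <= t -> Gamma t w <= 1
}.

Definition generated_time (Gamma : R -> Omega -> R) (U : Omega -> R)
    (w : Omega) : \bar R :=
  ereal_inf [set t%:E | t in [set t : R | 0 <= t /\ U w < Gamma t w]].

Definition randomised_times (U : Omega -> R) : set (Omega -> \bar R) :=
  [set generated_time Gamma U | Gamma in generating_process].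

Section Game.
Variables (theta1 theta2 : Omega -> bool) (U1 U2 : Omega -> R).

Definition hat (theta : Omega -> bool) (rho : Omega -> \bar R)
    (w : Omega) : \bar R :=
  if theta w then rho w else +oo%E.

(* e^{-r tau} (g(X_tau) 1_{tau < rho} + 1/2 g(X_tau) 1_{tau = rho})
   1_{tau < oo} *)
Definition discounted_reward (tau rho : Omega -> \bar R) (w : Omega) : R :=
  if tau w is t%:E then
    expR (- (r * t)) * (g (X t w) * (t%:E < rho w)%E%:R
                        + 2^-1 * g (X t w) * (t%:E == rho w)%:R)
  else 0.

Definition J1 (tau gamma : Omega -> \bar R) (x : 'rV[R]_d) : \bar R :=
  ('E_(P x)[discounted_reward tau (hat theta1 gamma)])%E.

Definition J2 (tau gamma : Omega -> \bar R) (x : 'rV[R]_d) : \bar R :=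
  ('E_(P x)[discounted_reward gamma (hat theta2 tau)])%E.

Record nash_equilibrium (x : 'rV[R]_d) (tau' gamma' : Omega -> \bar R) :
    Prop := {
  ne_tau : randomised_times U1 tau' ;
  ne_gamma : randomised_times U2 gamma' ;
  ne_J1 : forall tau, randomised_times U1 tau ->
    (J1 tau gamma' x <= J1 tau' gamma' x)%E ;
  ne_J2 : forall gamma, randomised_times U2 gamma ->
    (J2 tau' gamma x <= J2 tau' gamma' x)%E
}.
End Game.

Definition Cbar : set (R * 'rV[R]_d) :=
  [set px | 0 < px.1 < 1 /\ g px.2 <= (1 - px.1) * V px.2].

Definition Cprime : set (R * 'rV[R]_d) :=
  [set px | 0 < px.1 < 1 /\
            (1 - px.1 / 2) * g px.2 < (1 - px.1) * V px.2 < g px.2].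

Definition b (x : 'rV[R]_d) : R :=
  inf [set p : R | 0 <= p <= 1 /\ (1 - p) * V x <= g x].

Definition c (x : 'rV[R]_d) : R :=
  inf [set p : R | 0 <= p <= 1 /\ (1 - p) * V x <= (1 - p / 2) * g x].

Definition Z (p t : R) (w : Omega) : R :=
  Num.min p (inf [set b (X s w) | s in `[0, t] ]).

Definition Gamma_px (p t : R) (w : Omega) : R :=
  (p - Z p t w) / (p * (1 - Z p t w)).

Definition Gamma_star0 (p1 : R) (x : 'rV[R]_d) : R :=
  if g x == 0 then 0
  else 2 / p1 * Num.max 0 (1 - (1 - p1) * V x / g x).

Definition q1 (p1 : R) (x : 'rV[R]_d) : R :=
  p1 * (1 - Gamma_star0 p1 x) / (1 - p1 * Gamma_star0 p1 x).

Definition Gamma2_star (p1 : R) (x : 'rV[R]_d) (t : R) (w : Omega) : R :=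
  Gamma_star0 p1 x + (1 - Gamma_star0 p1 x) * Gamma_px (q1 p1 x) t w.

Definition Gamma1_star (p1 p2 : R) (x : 'rV[R]_d) (t : R) (w : Omega) : R :=
  if (t%:E < tauV w)%E then p1 / p2 * Gamma2_star p1 x t w else 1.

End Stopping.
End MarkovFamily.

(* Main.v *)
Require Import Defs.
From HB Require Import structures.
From mathcomp Require Import all_boot all_order all_algebra.
From mathcomp Require Import all_classical all_reals all_analysis.
From mathcomp Require Import finmap measurable_realfun ring lra.
Set Implicit Arguments.
Unset Strict Implicit.
Unset Printing Implicit Defensive.
Import Order.TTheory GRing.Theory Num.Theory.
Import numFieldNormedType.Exports.
Local Open Scope classical_set_scope.
Local Open Scope ring_scope.

(** Why the pair is an equilibrium.

    Condition on the path of X and on the own randomisation level. A player who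
    stops at t shares g(X_t) with an opponent who is present with probability p
    and has spread the mass Gamma' over time; on average the player keeps the
    fraction 1 - p (Gamma'_{t-} + Gamma'_t) / 2 of it ([mean_shareE]).
    Independence turns both payoffs into integrals, over the path and the own
    level, of the discounted g(X_t) times this fraction ([reward_randomised]).

    The strategies make the fraction fair. Let Z be the belief of Player 1 that a
    competitor is present, the running minimum of b(X) started from q1. Bayes'
    rule reads 1 - p1 Gamma2_t = (1 - p1) / (1 - Z_t) ([Gamma2_compl]). As
    g = (1 - b) V and Z <= b, stopping at t > 0 is worth at most (1 - p1) V(X_t),
    and exactly this when Z_t = b(X_t), which holds whenever Gamma2 increases; the
    initial mass is chosen so that a tie at time 0 is worth (1 - p1) V(x) as well
    ([tie_at_0], [share_upper], [share_tight]). Player 2 faces a competitor with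
    probability p2, but p2 Gamma1 = p1 Gamma2 before tauV and
    p2 Gamma1 >= p1 Gamma2 always, so the same comparison applies.

    The game is thereby reduced to the stopping problem of a lone player. Every
    strategy against the equilibrium one earns at most
    (1 - p1) E_x[e^{-r tau} V(X_tau)] <= (1 - p1) V(x), because the discounted
    value process is a supermartingale ([V_supermartingale], [payoff_le]). The
    equilibrium strategies only stop at fair times and not after tauV
    ([gen_tight], [gen_le_tauV]), and until tauV the value process is a martingale
    ([V_martingale_until_tauV]), so they earn (1 - p1) V(x) ([payoffE]).

    Both facts about the value process come from the strong Markov property. The
    limit of dynamic programming on dyadic steps is superharmonic for these steps;
    it is below the value because its stages are realised by stopping times
    ([dp_realised]) and above it by optional sampling on ever finer grids
    ([optional_sampling]), so it is the value. Rounding times up and Fatou's lemma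
    then give the supermartingale property. For the martingale property take
    stopping times sigma_n that are optimal up to 2^-n. The expected difference of
    value and payoff at sigma_n is at most 2^-n, so the difference tends to 0
    almost surely; this forces sigma_n to come close to a time tau <= tauV or
    later, and the payoff at sigma_n to vanish where tau is infinite. Replacing sigma_n by tau
    where tau comes first costs nothing by optional sampling, and dominated
    convergence yields E_x[e^{-r tau} V(X_tau)] >= V(x). *)

(** * Measure-theoretic tools *)

Section MeasureTools.
Import HBNNSimple.
Local Open Scope ereal_scope.
Context {dT : measure_display} {T : measurableType dT} {R : realType}.

(** The monotone class argument by which the strong Markov property passes from
    indicators to functions of the future, and then to weights known at the
    stopping time. *)
Lemma nonneg_measurable_ind (C : (T -> \bar R) -> Prop) :
  (forall A, measurable A -> C (fun x => (\1_A x)%:E)) ->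
  (forall f (k : R), (0 <= k)%R -> measurable_fun setT f ->
     (forall x, 0 <= f x) -> C f -> C (fun x => k%:E * f x)) ->
  (forall f h, measurable_fun setT f -> (forall x, 0 <= f x) ->
     measurable_fun setT h -> (forall x, 0 <= h x) ->
     C f -> C h -> C (fun x => f x + h x)) ->
  (forall f_ : nat -> T -> \bar R, (forall n, measurable_fun setT (f_ n)) ->
     (forall n x, 0 <= f_ n x) ->
     (forall x, {homo f_^~ x : n m / (n <= m)%N >-> n <= m}) ->
     (forall n, C (f_ n)) -> C (fun x => limn (f_^~ x))) ->
  forall f, measurable_fun setT f -> (forall x, 0 <= f x) -> C f.
Proof.
move=> Cindic Cscale Cadd Clim f mf f0.
have fE : f = fun x => limn (fun n => (nnsfun_approx measurableT mf n x)%:E).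
  by apply/funext => x; apply/esym/cvg_lim => //; exact: cvg_nnsfun_approx.
rewrite fE; apply: Clim => //.
- by move=> n; exact/measurable_EFinP.
- by move=> n x; rewrite lee_fin.
- by move=> x a b ab; rewrite lee_fin; exact/lefP/nd_nnsfun_approx.
move=> n; set h := nnsfun_approx _ _ _.
have h0 x : (0 <= h x)%R by [].
suff: C (fun x => \sum_(y <- fset_set (range h)) y%:E * (\1_(h @^-1` [set y]) x)%:E).
  congr C; apply/funext => x; rewrite [in RHS](fimfunE h) fsbig_finite//= sumEFin.
  by congr EFin; apply: eq_bigr => i _; rewrite EFinM.
have : {in (fset_set (range h) : seq R), forall y : R, (0 <= y)%R}.
  by move=> y /=; rewrite in_fset_set// => /set_mem [x _ <-]; exact: h0.
elim: (enum_fset _) => [|y s ih] ys.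
  under eq_fun do rewrite big_nil.
  have -> : (fun=> 0) = fun x : T => (\1_set0 x : R)%:E.
    by apply/funext => x; rewrite indic0.
  exact: Cindic.
have y0 : (0 <= y)%R by apply: ys; exact: mem_head.
under eq_fun do rewrite big_cons.
have mh z : measurable_fun setT (fun x => (\1_(h @^-1` [set z]) x)%:E : \bar R).
  by apply/measurable_EFinP; exact: measurable_indic.
apply: Cadd.
- exact: measurable_funeM.
- by move=> x; rewrite mule_ge0.
- by apply: emeasurable_sum => z; exact: measurable_funeM.
- move=> x; rewrite big_seq; apply: sume_ge0 => z zs.
  by rewrite mule_ge0// lee_fin ys// inE zs orbT.
- by apply: Cscale => //; exact: Cindic.
- by apply: ih => z zs; apply: ys; rewrite inE zs orbT.
Qed.

Lemma dominated_limit (mu : {measure set T -> \bar R}) (f_ : nat -> T -> \bar R)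
    (f h : T -> \bar R) :
  (forall n, measurable_fun setT (f_ n)) -> measurable_fun setT f ->
  measurable_fun setT h -> (forall n x, 0 <= f_ n x) ->
  (forall n x, f_ n x <= h x) -> \int[mu]_x h x < +oo ->
  {ae mu, forall x, f_ n x @[n --> \oo] --> f x} ->
  \int[mu]_x f_ n x @[n --> \oo] --> \int[mu]_x f x.
Proof.
move=> mf_ mf mh f0 fh ih cf.
have [] // := @dominated_convergence _ _ _ mu setT measurableT f_ f h mf_ mf.
- by apply: filterS cf => x ? _.
- apply/integrableP; split => //.
  rewrite (eq_integral h)// => x _; rewrite gee0_abs//.
  exact: le_trans (f0 0%N x) (fh 0%N x).
- by apply: aeW => x n _; rewrite gee0_abs.
Qed.

(** Borel-Cantelli for integrals: a series of summable integrals converges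
    almost everywhere, so its terms vanish. *)
Lemma ae_cvg0_geometric (mu : {measure set T -> \bar R}) (f_ : nat -> T -> \bar R) :
  (forall n, measurable_fun setT (f_ n)) -> (forall n x, 0 <= f_ n x) ->
  (forall n, \int[mu]_x f_ n x <= (2^-1 ^+ n)%:E) ->
  {ae mu, forall x, f_ n x @[n --> \oo] --> 0}.
Proof.
move=> mf f0 fle.
have sum2 n : \sum_(0 <= i < n) ((2^-1 ^+ i)%:E : \bar R) <= 2%:E.
  rewrite sumEFin lee_fin (_ : \sum_(0 <= i < n) 2^-1 ^+ i = 2 - 2 * 2^-1 ^+ n :> R)%R.
    by have : (0 <= 2^-1 ^+ n :> R)%R by []; lra.
  elim: n => [|n ih]; first by rewrite big_geq// expr0; ring.
  by rewrite big_nat_recr//= ih exprS; field.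
have mS : measurable_fun setT (fun x => \sum_(0 <= n <oo) f_ n x).
  apply: (emeasurable_fun_cvg (fun n x => \sum_(0 <= i < n) f_ i x)).
    by move=> n; exact: emeasurable_sum.
  by move=> x _; apply: is_cvg_nneseries => n _ _.
have : mu.-integrable setT (fun x => \sum_(0 <= n <oo) f_ n x).
  apply/integrableP; split => //.
  under eq_integral do rewrite gee0_abs ?nneseries_ge0//.
  rewrite integral_nneseries//; apply: (@le_lt_trans _ _ 2%:E); last by rewrite ltry.
  apply: lime_le; first by apply: is_cvg_nneseries => n _ _; exact: integral_ge0.
  by apply: nearW => n; apply: le_trans (sum2 n); exact: lee_sum.
move/(integrable_ae measurableT); apply: filterS => x /(_ I) fin.
have S0 : \sum_(0 <= n <oo) f_ n x < +oo by rewrite -ge0_fin_numE ?nneseries_ge0.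
apply: (@squeeze_cvge _ _ _ _ (cst 0) _ (fun N => \sum_(N <= n <oo) f_ n x)).
- apply: nearW => n; rewrite f0/=.
  have := @nneseries_lim_ge R (f_^~ x) xpredT n n.+1 (fun i _ _ => f0 i x).
  by rewrite big_nat1.
- exact: cvg_cst.
- exact: nneseries_tail_cvg.
Qed.

End MeasureTools.

Lemma measurable_fun_le_rays {dT : measure_display} {T : measurableType dT} {R : realType}
    (f : T -> \bar R) :
  (forall r : R, measurable [set x | (f x <= r%:E)%E]) -> measurable_fun setT f.
Proof.
move=> mf; apply: (@measurability _ _ T (\bar R) _ _ _ (ErealGenOInfty.measurableE R)).
move=> _ [_ [r ->] <-]; rewrite setTI -[X in measurable X]setCK preimage_setC.
apply: measurableC; rewrite (_ : _ @^-1` _ = [set x | (f x <= r%:E)%E])//.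
by apply/seteqP; split => x /=; rewrite in_itv/= andbT leNgt => /negP.
Qed.

Lemma small_invSn {R : archiRealFieldType} (e : R) : 0 < e -> exists n : nat, n.+1%:R^-1 < e.
Proof.
move=> e0; exists (Num.truncn e^-1); rewrite invf_plt ?posrE//; exact: truncnS_gt.
Qed.

Lemma floor_grid_cvg {R : realType} (t : R) : 0 <= t ->
  (Num.truncn (t * n.+1%:R))%:R / n.+1%:R @[n --> \oo] --> t.
Proof.
move=> t0; apply/cvgrPdist_le => /= e e0; have [N Ne] := small_invSn e0; exists N => // n /= Nn.
have n0 : 0 < n.+1%:R :> R by [].
have /Num.Theory.truncn_itv/andP[k1 k2] : 0 <= t * n.+1%:R by rewrite mulr_ge0.
have ne : n.+1%:R^-1 <= e.
  by apply: le_trans (ltW Ne); rewrite lef_pV2 ?posrE// ler_nat.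
have {1}-> : t = t * n.+1%:R / n.+1%:R by rewrite mulfK.
rewrite -mulrBl normrM ger0_norm ?subr_ge0// ger0_norm ?invr_ge0//.
by apply: le_trans ne; rewrite ler_piMl ?invr_ge0// lerBlDr addrC natr1 ltW.
Qed.

(** The factor may be infinite: if the limit is 0, so are all the terms. *)
Lemma limn_nondecreasing_mule {R : realType} (v : nat -> \bar R) (u : \bar R) :
  (forall n, 0 <= v n)%E -> {homo v : n m / (n <= m)%N >-> (n <= m)%E} -> (0 <= u)%E ->
  (limn v * u = limn (fun n => v n * u))%E.
Proof.
move=> v0 nd u0; apply/esym/cvg_lim => //.
have cv : cvgn v by exact: ereal_nondecreasing_is_cvgn.
case: u u0 => [u u0| _|//]; first exact: cvgeZr.
have vlim n : (v n <= limn v)%E.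
  by rewrite (cvg_lim _ (ereal_nondecreasing_cvgn nd))//; apply: ereal_sup_ubound; exists n.
have [l0|l0] := eqVneq (limn v) 0%E.
  rewrite l0 mul0e (_ : (fun _ => _) = cst 0%E); first exact: cvg_cst.
  apply/funext => n; apply/eqP; rewrite mule_eq0; apply/orP; left.
  by rewrite eq_le v0 andbT -l0.
apply: cvgeM => //; last exact: cvg_cst.
by apply: neq0_mule_def; rewrite mule_eq0 negb_or l0.
Qed.

Section BorelVectors.
Context {R : realType} {d : nat}.
Notation rV := 'rV[R]_d.

Lemma measurable_fun_borel {dT : measure_display} {T : measurableType dT} (D : set T) (f : T -> rV) :
  (forall O : set rV, open O -> measurable (D `&` f @^-1` O)) ->
  measurable_fun D (f : T -> borelRV R d).
Proof.
move=> fO.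
apply: (@measurability _ _ _ (borelRV R d) D f (@open 'rV[R]_d)).
  by [].
by move=> _ [B oB <-]; exact: fO.
Qed.

Lemma continuous_borel_measurable (f : rV -> R) : continuous f ->
  measurable_fun setT (f : borelRV R d -> R).
Proof.
move=> /continuousP cf.
apply: (@measurability _ _ (borelRV R d) R _ _ _ (RGenOInfty.measurableE R)).
move=> _ [_ [a ->] <-]; rewrite setTI; apply: sub_sigma_algebra.
rewrite set_itvoy; exact/cf/open_gt.
Qed.

(** Whether the limit lies in an open set O is decided by the approximations:
    they must eventually stay at a fixed distance from the complement of O. *)
Lemma measurable_borel_limit {dT : measure_display} {T : measurableType dT}
    (f_ : nat -> T -> rV) (f : T -> rV) :
  (forall n, measurable_fun setT (f_ n : T -> borelRV R d)) ->
  (forall x, f_ n x @[n --> \oo] --> f x) ->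
  measurable_fun setT (f : T -> borelRV R d).
Proof.
move=> mf cf; apply: measurable_fun_borel => O oO; rewrite setTI.
pose W k := \bigcup_(z in ~` O) ball z (k.+1%:R^-1 : R).
have oW k : open (W k) by apply: bigcup_open => z _; exact: ball_open.
have -> : f @^-1` O =
    \bigcup_k \bigcup_N \bigcap_n (f_ (N + n)%N @^-1` (~` W k)).
  apply/seteqP; split => w /=.
    move=> Ofw; have /nbhs_ballP[e /= e0 eO] : nbhs (f w) O by exact: open_nbhs_nbhs.
    have [k ke] : exists k, (k.+1%:R^-1 < e / 2 :> R).
      by apply: small_invSn; lra.
    have [N _ HN] : \forall n \near \oo, ball (f w) (e / 2) (f_ n w).
      by apply: (cf w); apply: nbhsx_ballx; lra.
    exists k => //; exists N => // n _ /= [z Oz zb]; apply: Oz.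
    apply: eO; rewrite [e]splitr; apply: (ball_triangle (HN (N + n)%N _)).
      by rewrite /= leq_addr.
    by apply: ball_sym; apply: le_ball zb; exact: ltW.
  move=> [k _ [N _ H]]; apply: contrapT => NO.
  have [M _ HM] : \forall n \near \oo, ball (f w) (k.+1%:R^-1) (f_ n w).
    by apply: (cf w); apply: nbhsx_ballx; rewrite invr_gt0.
  apply: (H M I) => /=; exists (f w) => //; apply: HM => /=; exact: leq_addl.
apply: bigcup_measurable => k _; apply: bigcup_measurable => N _.
apply: bigcapT_measurable => n; rewrite -[X in measurable X]setTI.
apply: mf => //; apply: measurableC; exact: sub_sigma_algebra.
Qed.

End BorelVectors.

(** * Stopping times *)

Section ProcessAtRandomTime.
Context {dT : measure_display} {T : measurableType dT} {R : realType} {d : nat}.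
Variable X : R -> T -> 'rV[R]_d.
Hypothesis mX : forall t, 0 <= t -> measurable_fun setT (X t : T -> borelRV R d).
Hypothesis cX : forall w, {within `[0, +oo[, continuous (X ^~ w)}.

Lemma path_cvg (w : T) (u_ : nat -> R) (u : R) : (forall n, 0 <= u_ n) -> 0 <= u ->
  u_ n @[n --> \oo] --> u -> X (u_ n) w @[n --> \oo] --> X u w.
Proof.
move=> u_0 u0 cu.
have /subspace_continuousP/(_ u) := @cX w; rewrite /= in_itv/= u0 => /(_ isT) H.
apply: (cvg_comp u_ (X^~ w) _ H).
move=> A [e /= e0 eA]; have [N _ HN] := cu _ (nbhsx_ballx u e e0).
exists N => // n Nn; apply: eA; first exact: HN.
by rewrite /= in_itv/= u_0.
Qed.

(** Rounding the random time down to multiples of 1/(n+1) leaves countably many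
    times to consider, and continuity of the paths removes the rounding. *)
Lemma measurable_at_random_time (s : T -> R) : measurable_fun setT s ->
  (forall w, 0 <= s w) ->
  measurable_fun setT ((fun w => X (s w) w) : T -> borelRV R d).
Proof.
move=> ms s0.
pose k n w := Num.truncn (s w * n.+1%:R).
pose s_ n w : R := (k n w)%:R / n.+1%:R.
apply: (@measurable_borel_limit _ _ _ _ (fun n w => X (s_ n w) w)); last first.
  by move=> w; apply: path_cvg => // [n|]; [rewrite divr_ge0|exact: floor_grid_cvg].
move=> n; apply: measurable_fun_borel => B oB; rewrite setTI.
have -> : (fun w => X (s_ n w) w) @^-1` B = \bigcup_i
    ((k n @^-1` [set i]) `&` (X (i%:R / n.+1%:R) @^-1` B)).
  apply/seteqP; split => w /=; first by move=> H; exists (k n w).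
  by move=> [i _ [/= <-]].
apply: bigcup_measurable => i _; apply: measurableI; last first.
  rewrite -[X in measurable X]setTI; apply: mX => //; exact: sub_sigma_algebra.
have -> : k n @^-1` [set i] = (fun w => s w * n.+1%:R) @^-1` `[i%:R, i.+1%:R[.
  apply/seteqP; split => w /=; rewrite in_itv/=.
    by move=> <-; apply: Num.Theory.truncn_itv; rewrite mulr_ge0.
  by move=> /Num.Theory.truncn_def.
rewrite -[X in measurable X]setTI; apply: measurable_funM => //.
Qed.

End ProcessAtRandomTime.

Section Filtration.
Context {R : realType} {d : nat} {disp : measure_display} {Omega : measurableType disp}.
Variables (P : 'rV[R]_d -> probability Omega R) (X : R -> Omega -> 'rV[R]_d).
Hypothesis mX : forall t, 0 <= t -> measurable_fun setT (X t : Omega -> borelRV R d).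

Notation F := (filtrationX P X).
(* The sample space with the sigma-algebra F_t. *)
Notation FT t := (g_sigma_algebraType (F t)).

Lemma filtration_sigma_algebra t : sigma_algebra setT (F t).
Proof. by apply: sigma_algebra_bigcap => s _; exact: smallest_sigma_algebra. Qed.

Lemma FTE t (A : set Omega) : measurable (A : set (FT t)) = F t A.
Proof. by rewrite measurable_g_measurableTypeE//; exact: filtration_sigma_algebra. Qed.

Lemma filtration_mono s t : s <= t -> F s `<=` F t.
Proof.
move=> st A FA u /=; rewrite in_itv/= andbT => tu; apply: FA.
by rewrite /= in_itv/= andbT (le_lt_trans st).
Qed.

Lemma filtration_past_measurable t A : F t A -> measurable A.
Proof.
move=> /(_ (t + 1)); rewrite /= in_itv/= andbT ltrDl => /(_ ltr01).
apply: smallest_sub; first exact: sigma_algebra_measurable.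
move=> B [[s [C [s0 mC ->]]]|[]//].
rewrite -[X in measurable X]setTI; apply: mX => //.
by move: s0; rewrite /= in_itv/= => /andP[].
Qed.

Lemma filtration_X s t (B : set (borelRV R d)) : 0 <= s -> s <= t -> measurable B ->
  F t (X s @^-1` B).
Proof.
move=> s0 st mB u /=; rewrite in_itv/= andbT => tu.
apply: sub_sigma_algebra; left; exists s, B; split => //.
by rewrite /= in_itv/= s0 (le_trans st)// ltW.
Qed.

Lemma measurable_FT_X s t : 0 <= s -> s <= t ->
  measurable_fun setT (X s : FT t -> borelRV R d).
Proof. by move=> s0 st _ B mB; rewrite setTI FTE; exact: filtration_X. Qed.

Lemma filtration_right t A :
  (forall e, 0 < e -> F (t + e) A) -> F t A.
Proof.
move=> FA s /=; rewrite in_itv/= andbT => ts.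
apply: (FA ((s - t) / 2)); first lra.
by rewrite /= in_itv/= andbT; lra.
Qed.

Section StoppingTimes.
Local Open Scope ereal_scope.
Implicit Types tau sigma : Omega -> \bar R.
Notation st := (stopping_time P X).

Lemma stopping_le tau (s t : R) : st tau -> (s <= t)%R ->
  F t [set w | tau w <= s%:E].
Proof.
move=> [t0 tm] stt; have [s0|s0] := leP 0%R s; first exact: filtration_mono (tm _ _).
rewrite (_ : [set w | _] = set0) -?FTE//.
apply/seteqP; split => w //= /(le_trans (t0 w)); rewrite lee_fin leNgt s0//.
Qed.

Lemma measurable_FT_min tau (t : R) : st tau ->
  measurable_fun setT ((fun w => mine (tau w) t%:E) : FT t -> \bar R).
Proof.
move=> stau; apply: measurable_fun_le_rays => r.
have [tr|rt] := leP t r.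
  rewrite (_ : [set x | _] = setT)//; apply/seteqP; split => // w _ /=.
  by rewrite ge_min !lee_fin tr orbT.
rewrite (_ : [set x | _] = [set w | tau w <= r%:E]).
  by rewrite FTE; apply: stopping_le => //; exact: ltW.
by apply/seteqP; split => w /=; rewrite ge_min !lee_fin (leNgt t) rt orbF.
Qed.

Lemma stopping_lt tau (s t : R) : st tau -> (s <= t)%R ->
  F t [set w | tau w < s%:E].
Proof.
move=> stau le_st; have := @measurable_FT_min tau t stau.
move/(emeasurable_fun_infty_o (measurableT : measurable (setT : set (FT t)))).
move=> /(_ s%:E); rewrite setTI FTE; congr (F t _).
by apply/seteqP; split => w /=; rewrite gt_min lte_fin [(t < s)%R]ltNge le_st orbF.
Qed.

Lemma stopping_measurable tau : st tau -> measurable_fun setT tau.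
Proof.
move=> stau; apply: measurable_fun_le_rays => r.
by apply: (@filtration_past_measurable r); apply: stopping_le.
Qed.

Lemma stopping_cst (t : R) : (0 <= t)%R -> st (fun=> t%:E).
Proof.
move=> t0; split => [w|s s0]; first by rewrite lee_fin.
have [ts|st] := leP t s; rewrite -FTE.
  by rewrite (_ : [set w | _] = setT)//; apply/seteqP; split => // w _ /=; rewrite lee_fin.
rewrite (_ : [set w | _] = set0)//; apply/seteqP; split => // w /=.
by rewrite lee_fin leNgt st.
Qed.

Lemma stopping_add tau (h : R) : st tau -> (0 <= h)%R ->
  st (fun w => tau w + h%:E).
Proof.
move=> stau h0; split => [w|t t0]; first by rewrite adde_ge0 ?lee_fin//; apply stau.
rewrite (_ : [set w | _] = [set w | tau w <= (t - h)%:E]).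
  by apply: stopping_le => //; lra.
apply/seteqP; split => w /=; case: (tau w) => [r||]//=;
  rewrite -?EFinD ?lee_fin ?leye_eq ?leNye//; lra.
Qed.

Lemma stopping_min tau sigma : st tau -> st sigma ->
  st (fun w => mine (tau w) (sigma w)).
Proof.
move=> stau ssigma; split => [w|t t0].
  by rewrite le_min; apply/andP; split; [apply stau|apply ssigma].
rewrite (_ : [set w | _] = [set w | tau w <= t%:E] `|` [set w | sigma w <= t%:E]).
  by rewrite -FTE; apply: measurableU; rewrite FTE; exact: stopping_le.
by apply/seteqP; split => w /=; rewrite ge_min => /orP.
Qed.

(** With this time, the payoff collected on an event known at [tau] becomes the
    payoff of a stopping time. *)
Definition restrict_time (A : set Omega) tau (w : Omega) : \bar R :=
  if w \in A then tau w else +oo.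

Lemma stopping_restrict A tau : st tau -> sigma_past P X tau A ->
  st (restrict_time A tau).
Proof.
move=> stau [mA sA]; split => [w|t t0].
  by rewrite /restrict_time; case: ifP => // _; apply stau.
rewrite (_ : [set w | _] = A `&` [set w | tau w <= t%:E]); first exact: sA.
apply/seteqP; rewrite /restrict_time; split => w /=.
  by case: ifPn => [/set_mem|] Aw; rewrite ?leye_eq.
by move=> [Aw tw]; rewrite mem_set.
Qed.

Lemma sigma_pastT tau : st tau -> sigma_past P X tau setT.
Proof. by move=> stau; split => // t t0; rewrite setTI; exact: stopping_le. Qed.

Lemma sigma_pastC tau A : st tau -> sigma_past P X tau A -> sigma_past P X tau (~` A).
Proof.
move=> stau [mA sA]; split => [|t t0]; first exact: measurableC.
rewrite (_ : _ `&` _ = [set w | tau w <= t%:E] `\` (A `&` [set w | tau w <= t%:E])).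
  rewrite -FTE; apply: measurableD; rewrite FTE; last exact: sA.
  exact: stopping_le.
apply/seteqP; split => w /=; first by move=> [nA tw]; split => // -[].
by move=> [tw nA]; split => // Aw; exact: nA.
Qed.

Lemma sigma_past_lt tau sigma : st tau -> st sigma ->
  sigma_past P X tau [set w | tau w < sigma w].
Proof.
move=> stau ssigma; split => [|t t0].
  rewrite -[X in measurable X]setTI; apply: measurable_lte => //;
    exact: stopping_measurable.
(* tau < sigma with tau <= t: either sigma is still to come at time t, or the
   times stopped at t are already ordered *)
rewrite (_ : _ `&` _ =
   ([set w | tau w <= t%:E] `\` [set w | sigma w <= t%:E]) `|`
   [set w | mine (tau w) t%:E < mine (sigma w) t%:E]); last first.
  apply/seteqP; split => w /=.
    move=> [ts tt]; have [st|st] := leP (sigma w) t%:E; last by left; split => //; exact/negP.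
    by right; rewrite !min_l.
  move=> [[tt /negP]|]; first by rewrite -ltNge => st; split => //; exact: le_lt_trans st.
  rewrite lt_min => /andP[H1]; rewrite gt_min ltxx orbF => tt.
  split; last exact: ltW.
  by move: H1; rewrite gt_min => /orP[//|/(lt_trans tt)].
rewrite -FTE; apply: measurableU.
  by apply: measurableD; rewrite FTE; exact: stopping_le.
rewrite -[X in measurable X]setTI; apply: measurable_lte => //;
  exact: measurable_FT_min.
Qed.

(** For such times X_tau is measurable for the past of tau without any
    progressive measurability. *)
Definition countably_valued tau :=
  exists T_ : nat -> R, forall w, tau w = +oo \/ exists k, tau w = (T_ k)%:E.

Lemma sigma_past_X tau (B : set (borelRV R d)) : st tau -> countably_valued tau ->
  measurable B -> sigma_past P X tau [set w | tau w < +oo /\ B (X (fine (tau w)) w)].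
Proof.
move=> stau [T_ tauT] mB.
set A := [set w | _].
have AE t : A `&` [set w | tau w <= t%:E] =
    \bigcup_(k in [set k | (0 <= T_ k <= t)%R])
      (([set w | tau w <= (T_ k)%:E] `\` [set w | tau w < (T_ k)%:E]) `&`
        (X (T_ k) @^-1` B)).
  apply/seteqP; split => w /=.
    move=> [[too BX] tt]; have [tE|[k tE]] := tauT w; first by rewrite tE in too.
    exists k => /=.
      have := stau.1 w; move: tt; rewrite tE !lee_fin => -> ->//.
    by move: BX; rewrite tE/= lexx ltxx.
  move=> [k /= /andP[T0 Tt] [[tT /negP]]]; rewrite -leNgt => Tt'.
  have tE : tau w = (T_ k)%:E by apply/eqP; rewrite eq_le tT.
  by rewrite /A /= tE ltry lee_fin.
have FA t : F t (A `&` [set w | tau w <= t%:E]).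
  rewrite AE -FTE; apply: bigcup_measurable => k /= /andP[T0 Tt].
  apply: measurableI; rewrite ?FTE; last exact: filtration_X.
  rewrite -FTE; apply: measurableD; rewrite FTE; first exact: stopping_le.
  exact: stopping_lt.
split => //.
rewrite (_ : A = \bigcup_n (A `&` [set w | tau w <= n%:R%:E])).
  by apply: bigcup_measurable => n _; exact: filtration_past_measurable (FA _).
apply/seteqP; split => w /=; last by move=> [n _ []].
move=> [too BX]; case tE : (tau w) too BX (stau.1 w) => [t| |]//= too BX t0.
exists (Num.truncn t).+1 => //=; rewrite tE; split; last first.
  by rewrite lee_fin ltW// truncnS_gt.
by rewrite /A /= tE.
Qed.

End StoppingTimes.
End Filtration.

(** * The strong Markov property for discounted payoffs *)

Section Discounting.
Local Open Scope ereal_scope.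
Context {dT : measure_display} {T : measurableType dT} {R : realType} {d : nat}.
Variables (X : R -> T -> 'rV[R]_d) (r : R).

(** Values in the extended reals let this cover the payoff, the value function
    and the dynamic programming approximations of the latter, which are not
    known to be finite when they are introduced. *)
Definition discounted (f : 'rV[R]_d -> \bar R) (tau : T -> \bar R) (w : T) : \bar R :=
  if tau w is t%:E then (expR (- (r * t)))%:E * f (X t w) else 0.

Lemma discounted_fine f tau w : 0 <= tau w ->
  discounted f tau w = if tau w < +oo then
    (expR (- (r * fine (tau w))))%:E * f (X (fine (tau w)) w) else 0.
Proof. by rewrite /discounted; case: (tau w) => [t||]//=; rewrite ltry. Qed.

Lemma discounted_never f tau w : tau w = +oo -> discounted f tau w = 0.
Proof. by rewrite /discounted => ->. Qed.

Lemma discounted_congr f tau tau' w : tau w = tau' w ->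
  discounted f tau w = discounted f tau' w.
Proof. by rewrite /discounted => ->. Qed.

Lemma discounted_ge0 f tau w : (forall x, 0 <= f x) -> 0 <= discounted f tau w.
Proof.
move=> f0; rewrite /discounted; case: (tau w) => [t||]//.
by rewrite mule_ge0// lee_fin expR_ge0.
Qed.

Lemma le_discounted f h tau w : (forall x, f x <= h x) ->
  discounted f tau w <= discounted h tau w.
Proof.
move=> fh; rewrite /discounted; case: (tau w) => [t||]//.
by rewrite lee_pmul2l// lte_fin expR_gt0.
Qed.

Hypothesis mX : forall t, (0 <= t)%R -> measurable_fun setT (X t : T -> borelRV R d).
Hypothesis cX : forall w, {within `[0%R, +oo[, continuous (X ^~ w)}.

Lemma measurable_discounted (f : 'rV[R]_d -> \bar R) tau :
  measurable_fun setT (f : borelRV R d -> \bar R) ->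
  measurable_fun setT tau -> (forall w, 0 <= tau w) ->
  measurable_fun setT (discounted f tau).
Proof.
move=> mf mtau tau0.
apply: (eq_measurable_fun (fun w => if tau w < +oo then
    (expR (- (r * fine (tau w))))%:E * f (X (fine (tau w)) w) else 0)).
  by move=> w _; rewrite discounted_fine.
have mft : measurable_fun setT (fun w => fine (tau w)).
  by apply: (measurableT_comp (fine_measurable measurableT)).
apply: measurable_fun_ifT => //.
  by apply: measurable_fun_lte => //; exact: measurable_cst.
apply: emeasurable_funM.
  apply/measurable_EFinP; apply: (measurableT_comp (@measurable_expR R)).
  by apply: measurable_funN; exact: measurable_funM.
apply: (@measurableT_comp _ _ _ _ (borelRV R d) _ f) => //.
by apply: measurable_at_random_time => // w; rewrite fine_ge0.
Qed.

End Discounting.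

Section StrongMarkov.
Local Open Scope ereal_scope.
Context {R : realType} {d : nat} {disp : measure_display} {Omega : measurableType disp}.
Variables (P : 'rV[R]_d -> probability Omega R) (X : R -> Omega -> 'rV[R]_d).
Hypothesis hX : strong_markov_process P X.
Variable r : R.

Notation st := (stopping_time P X).
Notation disc := (discounted X r).

Let mX t (t0 : (0 <= t)%R) := smp_measurable hX t0.
Let cX w := @smp_continuous _ _ _ _ _ _ hX w.

(** The transition semigroup of the process. *)
Definition transition (s : R) (f : 'rV[R]_d -> \bar R) (y : 'rV[R]_d) : \bar R :=
  \int[P y]_w f (X s w).

Lemma transition_ge0 s f y : (forall x, 0 <= f x) -> 0 <= transition s f y.
Proof. by move=> f0; apply: integral_ge0 => w _. Qed.

Lemma measurable_transition s (f : 'rV[R]_d -> \bar R) : (0 <= s)%R ->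
  measurable_fun setT (f : borelRV R d -> \bar R) -> (forall x, 0 <= f x) ->
  measurable_fun setT (transition s f : borelRV R d -> \bar R).
Proof.
move=> s0 mf f0.
pose l (y : borelRV R d) : {measure set (borelRV R d) -> \bar R} :=
  pushforward (P y) (X s : Omega -> borelRV R d).
have ml (U : set (borelRV R d)) : measurable U -> measurable_fun setT (l (mX s0) ^~ U).
  by move=> mU; exact: smp_kernel.
have := measurable_fun_integral_kernel ml f0 mf.
apply: eq_measurable_fun => y _.
by rewrite /l ge0_integral_pushforward//; exact: mX.
Qed.

Lemma measurable_X_at tau h : st tau -> (0 <= h)%R ->
  measurable_fun setT ((fun w => X (fine (tau w) + h)%R w) : Omega -> borelRV R d).
Proof.
move=> stau h0.
apply: (measurable_at_random_time mX cX (s := fun w => fine (tau w) + h)%R).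
  apply: measurable_funD => //; apply: (measurableT_comp (fine_measurable measurableT)) => //.
  exact: (stopping_measurable mX stau).
by move=> w; rewrite addr_ge0// fine_ge0//; apply stau.
Qed.

Lemma strong_markov_fun x tau A s (f : 'rV[R]_d -> \bar R) :
  st tau -> sigma_past P X tau A -> (0 <= s)%R ->
  measurable_fun setT (f : borelRV R d -> \bar R) -> (forall x, 0 <= f x) ->
  \int[P x]_(w in A `&` [set w | tau w < +oo]) f (X (fine (tau w) + s)%R w) =
  \int[P x]_(w in A `&` [set w | tau w < +oo]) transition s f (X (fine (tau w)) w).
Proof.
move=> stau sA s0.
have mD : measurable (A `&` [set w | tau w < +oo]).
  apply: measurableI; first exact: sA.1.
  rewrite -[X in measurable X]setTI; apply: emeasurable_fun_infty_o => //.
  exact: (stopping_measurable mX stau).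
have mXs := measurable_X_at stau s0.
have mX0 : measurable_fun setT ((fun w => X (fine (tau w)) w) : Omega -> borelRV R d).
  have := measurable_X_at stau (lexx 0%R).
  by apply: eq_measurable_fun => w _; rewrite addr0.
move=> mf f_ge0; move: f mf f_ge0.
have mf0 (D : set Omega) (f : 'rV[R]_d -> \bar R) : measurable_fun setT (f : borelRV R d -> \bar R) ->
    measurable_fun D (fun w => f (X (fine (tau w)) w)).
  move=> mf; apply: measurable_funTS.
  exact: (@measurableT_comp _ _ _ _ (borelRV R d) _ f).
have mfs (D : set Omega) (f : 'rV[R]_d -> \bar R) : measurable_fun setT (f : borelRV R d -> \bar R) ->
    measurable_fun D (fun w => f (X (fine (tau w) + s)%R w)).
  move=> mf; apply: measurable_funTS.
  exact: (@measurableT_comp _ _ _ _ (borelRV R d) _ f).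
have mft (D : set Omega) (f : 'rV[R]_d -> \bar R) : measurable_fun setT (f : borelRV R d -> \bar R) ->
    measurable_fun D (fun w => f (X s w)).
  move=> mf; apply: measurable_funTS.
  by apply: (@measurableT_comp _ _ _ _ (borelRV R d) _ f) => //; exact: mX.
apply: (@nonneg_measurable_ind _ (borelRV R d) R) => [B mB|f k k0 mf f0 ih|f h mf f0 mh h0 ihf ihh|
  f_ mf_ f_0 nd ih].
- transitivity (P x (A `&` [set w | tau w < +oo /\ B (X (fine (tau w) + s)%R w)])).
    rewrite (eq_integral (fun w => (\1_((fun w => X (fine (tau w) + s)%R w) @^-1` B) w)%:E))//.
    rewrite integral_indic//; last by rewrite -[X in measurable X]setTI; exact: mXs.
    congr (P x _); apply/seteqP; split => w /=; tauto.
  rewrite (@smp_markov _ _ _ _ _ _ hX x tau A s B)//; apply: eq_integral => w _.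
  rewrite /transition.
  rewrite (eq_integral (fun w' => (\1_(X s @^-1` B) w')%:E))//.
  by rewrite integral_indic ?setIT// -[X in measurable X]setTI; exact: mX.
- rewrite (ge0_integralZl_EFin _ mD (fun w _ => f0 _) (mfs _ _ mf) k0) ih.
  rewrite -(ge0_integralZl_EFin _ mD (fun w _ => transition_ge0 _ _ f0)
    (mf0 _ _ (measurable_transition s0 mf f0)) k0).
  apply: eq_integral => w _.
  by rewrite /transition (ge0_integralZl_EFin _ measurableT (fun w _ => f0 _) (mft _ _ mf) k0).
- rewrite (ge0_integralD _ mD (fun w _ => f0 _) (mfs _ _ mf) (fun w _ => h0 _) (mfs _ _ mh)).
  rewrite ihf ihh -(ge0_integralD _ mD
    (fun w _ => transition_ge0 _ _ f0) (mf0 _ _ (measurable_transition s0 mf f0))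
    (fun w _ => transition_ge0 _ _ h0) (mf0 _ _ (measurable_transition s0 mh h0))).
  apply: eq_integral => w _.
  by rewrite /transition (ge0_integralD _ measurableT (fun w _ => f0 _) (mft _ _ mf)
    (fun w _ => h0 _) (mft _ _ mh)).
- have tE y : transition s (fun x => limn (f_^~ x)) y = limn (fun n => transition s (f_ n) y).
    by rewrite /transition monotone_convergence// => n; exact: mft.
  have := monotone_convergence (P x) mD (g' := fun n w => f_ n (X (fine (tau w) + s)%R w)).
  move=> ->; [|by move=> n; exact: mfs|by move=> n w _; exact: f_0|by move=> w _ a b ab; exact: nd].
  under eq_fun do rewrite ih.
  have := monotone_convergence (P x) mD (g' := fun n w => transition s (f_ n) (X (fine (tau w)) w)).
  move=> <-.
  + by apply: eq_integral => w _; rewrite tE.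
  + by move=> n; apply: mf0; exact: measurable_transition.
  + by move=> n w _; exact: transition_ge0.
  + move=> w _ a b ab; apply: ge0_le_integral => //; [exact: mft|exact: mft|].
    by move=> y _; exact: nd.
Qed.

Lemma sigma_past_sigma_algebra tau : st tau -> sigma_algebra setT (sigma_past P X tau).
Proof.
move=> stau; split.
- by rewrite -setCT; apply: (sigma_pastC stau); exact: sigma_pastT.
- by move=> A sA; rewrite setTD; exact: (sigma_pastC stau).
- move=> A_ sA; split; first by apply: bigcup_measurable => n _; exact: (sA n).1.
  move=> t t0; rewrite setI_bigcupl -(FTE P X); apply: bigcup_measurable => n _.
  by rewrite FTE; exact: (sA n).2.
Qed.

(** The discount factor at [tau] is known at [tau], so it can be carried
    through the strong Markov property. *)
Lemma strong_markov_discounted x tau A h (f : 'rV[R]_d -> \bar R) :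
  st tau -> sigma_past P X tau A -> (0 <= h)%R ->
  measurable_fun setT (f : borelRV R d -> \bar R) -> (forall x, 0 <= f x) ->
  \int[P x]_(w in A) disc f (fun w => tau w + h%:E) w =
  \int[P x]_(w in A) disc (fun y => (expR (- (r * h)))%:E * transition h f y) tau w.
Proof.
move=> stau sA h0 mf f0.
(* the sample space with the past of tau as sigma-algebra *)
pose Tt := g_sigma_algebraType (sigma_past P X tau).
have TtE (B : set Omega) : measurable (B : set Tt) = sigma_past P X tau B.
  by rewrite measurable_g_measurableTypeE//; exact: sigma_past_sigma_algebra.
pose D := [set w | tau w < +oo].
have mD : measurable D.
  rewrite -[X in measurable X]setTI; apply: emeasurable_fun_infty_o => //.
  exact: (stopping_measurable mX stau).
pose h1 w := f (X (fine (tau w) + h)%R w).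
pose h2 w := transition h f (X (fine (tau w)) w).
have mh1 : measurable_fun setT h1.
  by apply: (@measurableT_comp _ _ _ _ (borelRV R d) _ f) => //; exact: measurable_X_at.
have mh2 : measurable_fun setT h2.
  apply: (@measurableT_comp _ _ _ _ (borelRV R d) _ (transition h f)) => //.
    exact: measurable_transition.
  have := measurable_X_at stau (lexx 0%R).
  by apply: eq_measurable_fun => w _; rewrite addr0.
have h10 w : 0 <= h1 w by exact: f0.
have h20 w : 0 <= h2 w by exact: transition_ge0.
have key (W : Omega -> \bar R) : measurable_fun setT (W : Tt -> \bar R) ->
    (forall w, 0 <= W w) ->
    \int[P x]_(w in D) (W w * h1 w) = \int[P x]_(w in D) (W w * h2 w).
  have mW (V : Omega -> \bar R) : measurable_fun setT (V : Tt -> \bar R) ->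
      measurable_fun setT V.
    move=> mV _ B mB; have := mV measurableT B mB.
    by rewrite [X in X -> _]TtE => -[].
  move: W; apply: (@nonneg_measurable_ind _ Tt R) => [B|V k k0 mV V0 ih|V V' mV V0 mV' V'0 ih ih'|
    V_ mV_ V_0 nd ih].
  - rewrite [X in X -> _]TtE => sB.
    have indE u : \int[P x]_(w in D) ((\1_B w)%:E * u w) = \int[P x]_(w in B `&` D) u w.
      rewrite integral_mkcondl; apply: eq_integral => w _.
      by rewrite epatch_indic muleC.
    by rewrite !indE; exact: strong_markov_fun.
  - have mVh (Q : Omega -> \bar R) u : measurable_fun setT (Q : Tt -> \bar R) ->
        measurable_fun setT u -> measurable_fun D (fun w => Q w * u w).
      by move=> mQ mu; apply: measurable_funTS; apply: emeasurable_funM => //; exact: mW.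
    have Vh0 (Q : Omega -> \bar R) (u : Omega -> \bar R) : (forall w, 0 <= Q w) -> (forall w, 0 <= u w) ->
       forall w, D w -> 0 <= Q w * u w by move=> *; exact: mule_ge0.
    rewrite /=; under eq_integral do rewrite -muleA.
    under [RHS]eq_integral do rewrite -muleA.
    by rewrite (ge0_integralZl_EFin _ mD (Vh0 _ _ V0 h10) (mVh _ _ mV mh1) k0)
      (ge0_integralZl_EFin _ mD (Vh0 _ _ V0 h20) (mVh _ _ mV mh2) k0) ih.
  - have mVh (Q : Omega -> \bar R) u : measurable_fun setT (Q : Tt -> \bar R) ->
        measurable_fun setT u -> measurable_fun D (fun w => Q w * u w).
      by move=> mQ mu; apply: measurable_funTS; apply: emeasurable_funM => //; exact: mW.
    have Vh0 (Q : Omega -> \bar R) (u : Omega -> \bar R) : (forall w, 0 <= Q w) -> (forall w, 0 <= u w) ->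
       forall w, D w -> 0 <= Q w * u w by move=> *; exact: mule_ge0.
    rewrite /=; under eq_integral do rewrite ge0_muleDl//.
    under [RHS]eq_integral do rewrite ge0_muleDl//.
    by rewrite (ge0_integralD _ mD (Vh0 _ _ V0 h10) (mVh _ _ mV mh1) (Vh0 _ _ V'0 h10) (mVh _ _ mV' mh1))
      (ge0_integralD _ mD (Vh0 _ _ V0 h20) (mVh _ _ mV mh2) (Vh0 _ _ V'0 h20) (mVh _ _ mV' mh2)) ih ih'.
  - have mVh n u : measurable_fun setT u -> measurable_fun D (fun w => V_ n w * u w).
      by move=> mu; apply: measurable_funTS; apply: emeasurable_funM => //; exact: mW.
    have mc u : measurable_fun setT u -> (forall w, 0 <= u w) ->
        \int[P x]_(w in D) (limn (V_^~ w) * u w) = limn (fun n => \int[P x]_(w in D) (V_ n w * u w)).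
      move=> mu u0; under eq_integral do rewrite limn_nondecreasing_mule//.
      apply: (monotone_convergence (P x) mD (g' := fun n w => V_ n w * u w)).
      - by move=> n; exact: mVh.
      - by move=> n w _; rewrite mule_ge0.
      - by move=> w _ a b ab; apply: lee_wpmul2r => //; exact: nd.
    by rewrite !mc//; congr (limn _); apply/funext => n; exact: ih.
have mtau : measurable_fun setT (tau : Tt -> \bar R).
  apply: measurable_fun_le_rays => q; rewrite TtE; split => [|t t0].
    rewrite -[X in measurable X]setTI; apply: emeasurable_fun_infty_c => //.
    exact: (stopping_measurable mX stau).
  rewrite (_ : _ `&` _ = [set w | tau w <= (Num.min q t)%:E]).
    by apply: stopping_le => //; rewrite ge_min lexx orbT.
  apply/seteqP; split => w /=; rewrite EFin_min le_min; first by move=> [-> ->].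
  by move=> /andP[].
(* the indicator of A and the discount factor at tau + h are both known at tau *)
pose W w := (\1_A w)%:E * (expR (- (r * (fine (tau w) + h))))%:E.
have mW : measurable_fun setT (W : Tt -> \bar R).
  apply: emeasurable_funM.
    by apply/measurable_EFinP; apply: measurable_indic; rewrite TtE.
  apply/measurable_EFinP; apply: (measurableT_comp (@measurable_expR R)).
  apply: measurable_funN; apply: measurable_funM => //.
  apply: measurable_funD => //; exact: (measurableT_comp (fine_measurable measurableT)).
have W0 w : 0 <= W w by rewrite mule_ge0// lee_fin ?expR_ge0.
have := key W mW W0; rewrite (integral_mkcond D) (integral_mkcond D (fun w => W w * h2 w)).
rewrite (integral_mkcond A) (integral_mkcond A (disc _ _)).
have DE w : (w \in D) = (tau w < +oo) by apply/idP/idP => [/set_mem//|]; exact: mem_set.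
congr (_ = _); apply: eq_integral => w _; rewrite !patchE DE.
- rewrite /W indicE /discounted /h1.
  have := stau.1 w; case: (tau w) => [t||]//= _; rewrite ?ltxx ?ltry /=; last by case: ifP => //.
  by case: (w \in A); rewrite ?mul1e// !mul0e.
- rewrite /W indicE /discounted /h2.
  have := stau.1 w; case: (tau w) => [t||]//= _; rewrite ?ltxx ?ltry /=; last by case: ifP => //.
  case: (w \in A); rewrite ?mul1e// ?mul0e// muleA -EFinM -expRD.
  by congr (EFin (expR _) * _); ring.
Qed.

End StrongMarkov.

(** * The stopping problem and its dynamic programming approximation *)

Section OptimalStopping.
Local Open Scope ereal_scope.
Context {R : realType} {d : nat} {disp : measure_display} {Omega : measurableType disp}.
Variables (P : 'rV[R]_d -> probability Omega R) (X : R -> Omega -> 'rV[R]_d).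
Variables (r : R) (g : 'rV[R]_d -> R).
Hypothesis hX : strong_markov_process P X.
Hypothesis hg : payoff_function r g.

Notation st := (stopping_time P X).
Notation disc := (discounted X r).
Notation gE := (fun y : 'rV[R]_d => (g y)%:E).
Notation V := (V P X r g).
Notation borel := (borelRV R d).

Let mX t (t0 : (0 <= t)%R) := smp_measurable hX t0.
Let cX w := @smp_continuous _ _ _ _ _ _ hX w.

Lemma gE_ge0 y : 0 <= gE y. Proof. by rewrite lee_fin (pf_ge0 hg). Qed.

Lemma measurable_gE : measurable_fun setT (gE : borel -> \bar R).
Proof.
apply/measurable_EFinP; apply: continuous_borel_measurable; exact: (pf_continuous hg).
Qed.

Lemma disc_measurable (f : 'rV[R]_d -> \bar R) tau :
  measurable_fun setT (f : borel -> \bar R) -> st tau -> measurable_fun setT (disc f tau).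
Proof.
move=> mf stau; apply: (measurable_discounted r mX cX mf); last exact: stau.1.
exact: (stopping_measurable mX stau).
Qed.

Lemma stopped_payoffE tau w : (stopped_payoff X r g tau w)%:E = disc gE tau w.
Proof. by rewrite /stopped_payoff /discounted; case: (tau w) => [t||]//; rewrite EFinM. Qed.

Definition gain tau x := \int[P x]_w disc gE tau w.

(** The value before [fine] is applied: its finiteness has to be proved. *)
Definition valueE y := ereal_sup [set gain tau y | tau in st].

Lemma V_fine y : V y = fine (valueE y).
Proof.
rewrite /V /valueE; congr (fine (ereal_sup _)).
by apply/seteqP; split => _ [tau stau <-]; exists tau => //; rewrite unlock /gain;
  apply: eq_integral => w _; rewrite stopped_payoffE.
Qed.

(** The common bound of all discounted payoffs, integrable by the standing
    assumption; it feeds the dominated convergence theorem. *)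
Definition sup_payoff (w : Omega) := ereal_sup
  [set (expR (- (r * t)) * g (X t w))%R%:E | t in `[0%R, +oo[ ].

Lemma sup_payoff_ge0 w : 0 <= sup_payoff w.
Proof.
apply: le_ereal_sup_tmp; exists (expR (- (r * 0)) * g (X 0 w))%R%:E.
  by exists 0%R => //; rewrite /= in_itv/= lexx.
by rewrite lee_fin mulr_ge0 ?expR_ge0// (pf_ge0 hg).
Qed.

Lemma disc_le_sup tau w : 0 <= tau w -> disc gE tau w <= sup_payoff w.
Proof.
rewrite /discounted; have := sup_payoff_ge0 w.
case: (tau w) => [t||]// S0 t0; rewrite -EFinM; apply: ereal_sup_ubound.
by exists t => //; rewrite /= in_itv/= andbT -lee_fin.
Qed.

Lemma payoff_path_cvg (f : 'rV[R]_d -> R) (w : Omega) (u_ : nat -> R) (u : R) : continuous f ->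
  (forall n, 0 <= u_ n)%R -> (0 <= u)%R -> u_ n @[n --> \oo] --> u ->
  (expR (- (r * u_ n)) * f (X (u_ n) w))%R @[n --> \oo] --> (expR (- (r * u)) * f (X u w))%R.
Proof.
move=> cf u_0 u0 cu; apply: cvgM.
  apply: continuous_cvg; first exact: continuous_expR.
  by apply: cvgN; apply: cvgMr.
by apply: continuous_cvg; [exact: cf|exact: path_cvg].
Qed.

(** By continuity the supremum may be taken over rational times. *)
Lemma measurable_sup_payoff : measurable_fun setT sup_payoff.
Proof.
apply: measurable_fun_le_rays => q.
pose H t w := (expR (- (r * t)) * g (X t w))%R.
rewrite (_ : [set w | _] = \bigcap_k \bigcap_m [set w | (H (k%:R / m.+1%:R) w)%:E <= q%:E]).
  apply: bigcapT_measurable => k; apply: bigcapT_measurable => m.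
  rewrite -[X in measurable X]setTI; apply: emeasurable_fun_infty_c => //.
  apply/measurable_EFinP; apply: measurable_funM => //.
  apply: (@measurableT_comp _ _ _ _ borel _ g).
    by apply: continuous_borel_measurable; exact: (pf_continuous hg).
  by apply: mX; rewrite divr_ge0.
apply/seteqP; split => w /=.
  move=> Sq k _ m _ /=; apply: le_trans Sq; apply: ereal_sup_ubound.
  by exists (k%:R / m.+1%:R)%R => //; rewrite /= in_itv/= andbT divr_ge0.
move=> Hq; apply: ge_ereal_sup => y [t /=]; rewrite in_itv/= andbT => t0 <- {y}.
have cH : H ((Num.truncn (t * n.+1%:R))%:R / n.+1%:R)%R w @[n --> \oo] --> H t w.
  apply: payoff_path_cvg; [exact: (pf_continuous hg)|by move=> n; rewrite divr_ge0|by []|].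
  exact: floor_grid_cvg.
rewrite lee_fin; apply: (cvgr_to_le cH); apply: nearW => n.
by have := Hq (Num.truncn (t * n.+1%:R)) I n I; rewrite /= lee_fin.
Qed.

Lemma stopping0 : st (fun=> 0). Proof. exact: stopping_cst. Qed.

Lemma ae_start y : {ae P y, forall w, X 0 w = y}.
Proof.
have mstart : measurable [set w | X 0 w = y].
  rewrite (_ : [set w | _] = X 0 @^-1` [set y]).
    rewrite -[X in measurable X]setTI; apply: (mX (lexx _)) => //.
    rewrite -[X in measurable X]setCK; apply: measurableC; apply: sub_sigma_algebra.
    by apply: closed_openC; apply: accessible_closed_set1; apply: hausdorff_accessible;
      exact: norm_hausdorff.
  by apply/seteqP; split.
exists (~` [set w | X 0 w = y]); split => //; first exact: measurableC.
by have := probability_setC (P y) mstart; rewrite (smp_start hX) subee.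
Qed.

Lemma integral_start (f : 'rV[R]_d -> \bar R) y :
  measurable_fun setT (f : borel -> \bar R) -> (forall x, 0 <= f x) ->
  \int[P y]_w disc f (fun=> 0) w = f y.
Proof.
move=> mf f0; transitivity (\int[P y]_w (cst (f y) w)).
  apply: ge0_ae_eq_integral => //.
  - exact: (disc_measurable mf stopping0).
  - by move=> w _; apply: discounted_ge0.
  - by move=> w _; exact: f0.
  apply: filterS (ae_start y) => w <- _.
  by rewrite /discounted /= mulr0 oppr0 expR0 mul1e.
rewrite integral_cst// [X in _ * X](_ : _ = 1) ?mule1//; exact: probability_setT.
Qed.

Lemma valueE_ge y : gE y <= valueE y.
Proof.
apply: le_ereal_sup_tmp; exists (gain (fun=> 0) y); first by exists (fun=> 0) => //; exact: stopping0.
by rewrite /gain integral_start//; [exact: measurable_gE|exact: gE_ge0].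
Qed.

Section TimeRestriction.
Implicit Types tau sigma : Omega -> \bar R.

Lemma discounted_restrict f A tau w :
  disc f (restrict_time A tau) w = if w \in A then disc f tau w else 0.
Proof. by rewrite /discounted /restrict_time; case: ifP. Qed.

Lemma measurable_disc_restrict (f : 'rV[R]_d -> \bar R) A tau :
  measurable_fun setT (f : borel -> \bar R) -> st tau -> measurable A ->
  measurable_fun setT (disc f (restrict_time A tau)).
Proof.
move=> mf stau mA; apply: (eq_measurable_fun (disc f tau \_ A)).
  by move=> w _; rewrite discounted_restrict patchE.
by apply/(measurable_restrictT _ mA).1; apply: measurable_funTS; exact: disc_measurable.
Qed.

Lemma integral_disc_restrictC (f : 'rV[R]_d -> \bar R) A tau x :
  measurable_fun setT (f : borel -> \bar R) -> (forall y, 0 <= f y) ->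
  st tau -> measurable A ->
  \int[P x]_w disc f tau w = \int[P x]_w disc f (restrict_time A tau) w +
    \int[P x]_w disc f (restrict_time (~` A) tau) w.
Proof.
move=> mf f0 stau mA; rewrite -ge0_integralD//; first last.
- by apply: measurable_disc_restrict => //; exact: measurableC.
- by move=> w _; exact: discounted_ge0.
- exact: measurable_disc_restrict.
- by move=> w _; exact: discounted_ge0.
apply: eq_integral => w _; rewrite !discounted_restrict in_setC.
by case: (w \in A); rewrite ?adde0 ?add0e.
Qed.

Lemma countably_valued_restrict A tau :
  countably_valued tau -> countably_valued (restrict_time A tau).
Proof.
move=> [T_ H]; exists T_ => w; rewrite /restrict_time.
by case: ifP => _; [exact: H|left].
Qed.

Lemma countably_valued_add tau (h : R) :
  countably_valued tau -> countably_valued (fun w => tau w + h%:E).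
Proof.
move=> [T_ H]; exists (fun k => T_ k + h)%R => w.
by have [->|[k ->]] := H w; [left|right; exists k].
Qed.

Lemma strong_markov_stopping x tau h (f : 'rV[R]_d -> \bar R) :
  st tau -> (0 <= h)%R ->
  measurable_fun setT (f : borel -> \bar R) -> (forall x, 0 <= f x) ->
  \int[P x]_w disc f (fun w => tau w + h%:E) w =
  \int[P x]_w disc (fun y => (expR (- (r * h)))%:E * transition P X h f y) tau w.
Proof.
move=> stau h0 mf f0.
exact: (strong_markov_discounted hX r x stau (sigma_pastT stau) h0 mf f0).
Qed.

End TimeRestriction.

(** Dynamic programming on dyadic steps. The step at stage [n] runs through the
    powers of 1/2 so that each of them is used infinitely often. *)
Definition step (n : nat) : R := (2^-1 ^+ logn 2 n.+1)%R.

Fixpoint dp (n : nat) : 'rV[R]_d -> \bar R :=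
  if n is m.+1 then
    fun y => maxe (dp m y) ((expR (- (r * step m)))%:E * transition P X (step m) (dp m) y)
  else gE.

Definition dp_lim y := limn (dp ^~ y).

Lemma step_ge0 n : (0 <= step n)%R. Proof. by rewrite exprn_ge0. Qed.

Lemma dp_ge0 n y : 0 <= dp n y.
Proof.
by elim: n => [|n ih] /=; [rewrite lee_fin (pf_ge0 hg)|rewrite le_max ih].
Qed.

Lemma measurable_dp n : measurable_fun setT (dp n : borel -> \bar R).
Proof.
elim: n => [|n ih] /=; first exact: measurable_gE.
apply: measurable_maxe => //; apply: measurable_funeM.
by apply: (measurable_transition hX) => //; [exact: step_ge0|exact: dp_ge0].
Qed.

Lemma dp_nd y : {homo dp^~ y : n m / (n <= m)%N >-> n <= m}.
Proof. by apply/nondecreasing_seqP => n /=; rewrite le_max lexx. Qed.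

Lemma dp_le_lim n y : dp n y <= dp_lim y.
Proof.
rewrite /dp_lim (cvg_lim _ (ereal_nondecreasing_cvgn (@dp_nd y)))//.
by apply: ereal_sup_ubound; exists n.
Qed.

Lemma dp_lim_ge0 y : 0 <= dp_lim y.
Proof. exact: le_trans (dp_ge0 0 y) (dp_le_lim 0 y). Qed.

Lemma measurable_dp_lim : measurable_fun setT (dp_lim : borel -> \bar R).
Proof.
apply: (@emeasurable_fun_cvg _ borel R setT (dp : nat -> borel -> \bar R)) => [n|y _]; first exact: measurable_dp.
exact: ereal_nondecreasing_is_cvgn (@dp_nd y).
Qed.

(** Every step length recurs beyond any stage, so that one more step of this
    length does not raise the limit. *)
Lemma dp_lim_superharmonic m y :
  (expR (- (r * 2^-1 ^+ m)))%:E * transition P X (2^-1 ^+ m) dp_lim y <= dp_lim y.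
Proof.
have h0 : (0 <= 2^-1 ^+ m :> R)%R by rewrite exprn_ge0.
rewrite /transition.
have mdp n : measurable_fun setT (fun w => dp n (X (2^-1 ^+ m) w)).
  apply: (@measurableT_comp _ _ _ _ borel _ (dp n)); first exact: measurable_dp.
  exact: mX.
have := monotone_convergence (P y) measurableT (g' := fun n w => dp n (X (2^-1 ^+ m) w)).
move=> /(_ (fun n => mdp n) (fun n w _ => dp_ge0 n _) (fun w _ => @dp_nd _)) ->.
have I0 n : 0 <= \int[P y]_w dp n (X (2^-1 ^+ m) w).
  by apply: integral_ge0 => w _; exact: dp_ge0.
have Ind : {homo (fun n => \int[P y]_w dp n (X (2^-1 ^+ m) w)) : a b / (a <= b)%N >-> a <= b}.
  move=> a b ab; apply: ge0_le_integral => //.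
  + by move=> w _; exact: dp_ge0.
  + by move=> w _; exact: dp_nd.
have c0 : 0 <= (expR (- (r * 2^-1 ^+ m)))%:E by rewrite lee_fin expR_ge0.
rewrite muleC (limn_nondecreasing_mule I0 Ind c0).
have nd : {homo (fun n => \int[P y]_w dp n (X (2^-1 ^+ m) w) * (expR (- (r * 2^-1 ^+ m)))%:E)
     : a b / (a <= b)%N >-> a <= b}.
  by move=> a b ab; apply: lee_wpmul2r => //; exact: Ind.
rewrite (cvg_lim _ (ereal_nondecreasing_cvgn nd))//.
apply: ge_ereal_sup => _ [n _ <-].
(* a stage after n with step length 2^-m *)
pose N := (2 ^ m * (2 * n).+1).-1.
have NE : N.+1 = (2 ^ m * (2 * n).+1)%N by rewrite prednK// muln_gt0 expn_gt0.
have sN : step N = (2^-1 ^+ m)%R.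
  rewrite /step NE lognM ?expn_gt0// pfactorK// lognE/= dvdn2 /= mul2n odd_double addn0//.
have nN : (n <= N)%N.
  rewrite -ltnS NE; apply: (@leq_trans (2 * n).+1); first by rewrite ltnS leq_pmull.
  by rewrite leq_pmull// expn_gt0.
apply: le_trans (nd _ _ nN) _; apply: le_trans (dp_le_lim N.+1 y) => /=.
by rewrite le_max sN muleC lexx orbT.
Qed.

End OptimalStopping.

Section ValueFunction.
Local Open Scope ereal_scope.
Context {R : realType} {d : nat} {disp : measure_display} {Omega : measurableType disp}.
Variables (P : 'rV[R]_d -> probability Omega R) (X : R -> Omega -> 'rV[R]_d).
Variables (r : R) (g : 'rV[R]_d -> R).
Hypothesis hX : strong_markov_process P X.
Hypothesis hg : payoff_function r g.

Notation st := (stopping_time P X).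
Notation disc := (discounted X r).
Notation gE := (fun y : 'rV[R]_d => (g y)%:E).
Notation dp := (dp P X r g).
Notation v := (dp_lim P X r g).
Notation gain := (gain P X r g).
Notation valueE := (valueE P X r g).
Notation borel := (borelRV R d).

Let mX t (t0 : (0 <= t)%R) := smp_measurable hX t0.
Let mgE := measurable_gE hg.
Let g0 := gE_ge0 hg.
Let mdisc := disc_measurable r hX.

(** By induction on the number of stages: the state at [tau] tells whether to
    wait one more step, which the strong Markov property evaluates. *)
Lemma dp_realised n x tau : st tau -> countably_valued tau ->
  exists tau', [/\ st tau', forall w, tau w <= tau' w &
    \int[P x]_w disc (dp n) tau w <= gain tau' x].
Proof.
elim: n tau => [|n ih] tau stau ctau; first by exists tau.
set h := @step R n; have h0 : (0 <= h)%R := step_ge0 _.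
pose cont y := (expR (- (r * h)))%:E * transition P X h (dp n) y.
have mdp := @measurable_dp _ _ _ _ _ _ _ _ hX hg n.
have dp0 := @dp_ge0 _ _ _ _ P X r g hg n.
have mcont : measurable_fun setT (cont : borel -> \bar R).
  by apply: measurable_funeM; exact: (measurable_transition hX).
have cont0 y : 0 <= cont y by rewrite mule_ge0 ?lee_fin ?expR_ge0//; exact: transition_ge0.
pose B : set borel := [set y | cont y <= dp n y].
have mB : measurable B.
  by rewrite -[X in measurable X]setTI; exact: measurable_lee.
pose A := [set w | tau w < +oo /\ B (X (fine (tau w)) w)].
have sA : sigma_past P X tau A := sigma_past_X mX stau ctau mB.
have sA' := sigma_pastC stau sA.
have sta := stopping_restrict stau sA.
have stb := stopping_restrict stau sA'.
have stb' := stopping_add stb h0.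
have [ta [st_ta ta_ge ta_gain]] := ih _ sta (countably_valued_restrict A ctau).
have [tb [st_tb tb_ge tb_gain]] :=
  ih _ stb' (countably_valued_add h (countably_valued_restrict (~` A) ctau)).
have taE w : w \notin A -> ta w = +oo.
  by move=> /negPf wA; apply/eqP; have := ta_ge w; rewrite /restrict_time wA leye_eq.
have tbE w : w \in A -> tb w = +oo.
  move=> wA; apply/eqP; have := tb_ge w.
  by rewrite /restrict_time in_setC wA /= leye_eq.
exists (fun w => mine (ta w) (tb w)); split; first exact: stopping_min.
  move=> w; case: (boolP (w \in A)) => wA.
    by rewrite tbE// miney; have := ta_ge w; rewrite /restrict_time wA.
  rewrite taE// minye; apply: le_trans (tb_ge w).
  by rewrite /restrict_time in_setC wA leeDl// lee_fin.
have -> : gain (fun w => mine (ta w) (tb w)) x = gain ta x + gain tb x.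
  rewrite /gain -ge0_integralD//.
  - apply: eq_integral => w _; case: (boolP (w \in A)) => wA.
      rewrite (discounted_never _ _ _ (tbE w wA)) adde0.
      by apply: discounted_congr; rewrite tbE// miney.
    rewrite (discounted_never _ _ _ (taE w wA)) add0e.
    by apply: discounted_congr; rewrite taE// minye.
  - by move=> w _; exact: discounted_ge0.
  - exact: mdisc.
  - by move=> w _; exact: discounted_ge0.
  - exact: mdisc.
have -> : \int[P x]_w disc (dp n.+1) tau w =
    \int[P x]_w disc (dp n) (restrict_time A tau) w +
    \int[P x]_w disc cont (restrict_time (~` A) tau) w.
  rewrite -ge0_integralD//.
  - apply: eq_integral => w _; rewrite !discounted_restrict in_setC.
    case: (boolP (w \in A)) => wA /=; rewrite ?adde0 ?add0e.
      move/set_mem: wA => [_]; rewrite /B/= /discounted; case: (tau w) => [t||]//= /max_idPl.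
      by rewrite -/(cont _) maxC => ->.
    have {wA} : ~ A w by move=> Aw; move/negP: wA; apply; exact: mem_set.
    rewrite /A /B /= /discounted; case: (tau w) => [t||]//= /not_andP[|]; first by rewrite ltry.
    by move=> /negP; rewrite -ltNge => /ltW/max_idPl; rewrite -/(cont _) maxC => ->.
  - by move=> w _; exact: discounted_ge0.
  - exact: mdisc.
  - by move=> w _; exact: discounted_ge0.
  - exact: mdisc.
apply: leeD => //; apply: le_trans tb_gain.
by rewrite (strong_markov_stopping r hX x stb h0 mdp dp0).
Qed.

Lemma gain_le_value tau x : st tau -> gain tau x <= valueE x.
Proof. by move=> stau; apply: ereal_sup_ubound; exists tau. Qed.

Lemma disc_dp_lim tau w : disc v tau w = limn (fun n => disc (dp n) tau w).
Proof.
rewrite /discounted; case: (tau w) => [t||]; last 2 first.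
- by rewrite lim_cst.
- by rewrite lim_cst.
rewrite muleC limn_nondecreasing_mule//.
- by apply: congr_lim; apply/funext => n; rewrite muleC.
- by move=> n; exact: dp_ge0.
- exact: dp_nd.
Qed.

(** Monotone convergence in [dp_realised]. *)
Lemma dp_lim_supermartingale_countable x tau : st tau -> countably_valued tau ->
  \int[P x]_w disc v tau w <= valueE x.
Proof.
move=> stau ctau; under eq_integral do rewrite disc_dp_lim.
have ddp0 n w : 0 <= disc (dp n) tau w by apply: discounted_ge0 => y; exact: dp_ge0.
have mddp n : measurable_fun setT (disc (dp n) tau).
  by apply: mdisc => //; exact: (measurable_dp hX hg).
have nd w : {homo (fun n => disc (dp n) tau w) : n m / (n <= m)%N >-> n <= m}.
  by move=> a b ab; apply: le_discounted => y; exact: dp_nd.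
rewrite (monotone_convergence _ _ (g' := fun n => disc (dp n) tau))//.
apply: lime_le.
  apply: ereal_nondecreasing_is_cvgn => a b ab; apply: ge0_le_integral => //.
  by move=> w _; exact: nd.
apply: nearW => n; have [tau' [st' _ le']] := dp_realised n x stau ctau.
exact: le_trans le' (gain_le_value _ st').
Qed.

Lemma dp_lim_le_value y : v y <= valueE y.
Proof.
have := @dp_lim_supermartingale_countable y (fun=> 0) (stopping0 P X).
rewrite (integral_start r hX)//; last first.
- by move=> z; exact: dp_lim_ge0.
- exact: measurable_dp_lim.
apply; by exists (fun=> 0%R) => w; right; exists 0%N.
Qed.

End ValueFunction.

(** * Optional sampling between two stopping times *)

Section OptionalSampling.
Local Open Scope ereal_scope.
Context {R : realType} {d : nat} {disp : measure_display} {Omega : measurableType disp}.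
Variables (P : 'rV[R]_d -> probability Omega R) (X : R -> Omega -> 'rV[R]_d).
Variables (r : R) (g : 'rV[R]_d -> R).
Hypothesis hX : strong_markov_process P X.
Hypothesis hg : payoff_function r g.

Notation st := (stopping_time P X).
Notation disc := (discounted X r).
Notation gE := (fun y : 'rV[R]_d => (g y)%:E).
Notation S := (sup_payoff X r g).
Notation borel := (borelRV R d).

Let mX t (t0 : (0 <= t)%R) := smp_measurable hX t0.
Let mgE := measurable_gE hg.
Let g0 := gE_ge0 hg.
Let mdisc := disc_measurable r hX.

(** A majorant of the payoff that is superharmonic along dyadic steps. *)
Variable u : 'rV[R]_d -> \bar R.
Hypothesis mu : measurable_fun setT (u : borel -> \bar R).
Hypothesis u_ge : forall y, gE y <= u y.
Hypothesis u_super : forall m y,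
  (expR (- (r * 2^-1 ^+ m)))%:E * transition P X (2^-1 ^+ m) u y <= u y.

Let u0 y : 0 <= u y. Proof. exact: le_trans (g0 y) (u_ge y). Qed.

Variables (x : 'rV[R]_d) (tau sigma : Omega -> \bar R).
Hypotheses (stau : st tau) (ssigma : st sigma).
Hypothesis S_int : \int[P x]_w S w < +oo.

(* The walk from tau along the grid of mesh 2^-m, continued until sigma. *)
Let mesh m : R := (2^-1 ^+ m)%R.
Let grid m k w := tau w + (k%:R * mesh m)%:E.
Let later m k := [set w | grid m k w < sigma w].

Let mesh_gt0 m : (0 < mesh m)%R. Proof. by rewrite exprn_gt0. Qed.

Let grid0 m w : grid m 0 w = tau w.
Proof. by rewrite /grid mul0r -[RHS]adde0. Qed.

Let gridS m k w : grid m k.+1 w = grid m k w + (mesh m)%:E.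
Proof. by rewrite /grid -addeA -EFinD; congr (_ + _%:E); rewrite -natr1 mulrDl mul1r. Qed.

Let st_grid m k : st (grid m k).
Proof. by apply: stopping_add => //; rewrite mulr_ge0// ltW. Qed.

Let later_past m k : sigma_past P X (grid m k) (later m k).
Proof. by apply: (sigma_past_lt mX) => //; exact: st_grid. Qed.

Let laterS m k : later m k.+1 `<=` later m k.
Proof.
move=> w; rewrite /later /= gridS; apply: le_lt_trans.
by rewrite leeDl// lee_fin ltW.
Qed.

(* The payoff at the first grid point at or after sigma, if it has number k+1. *)
Let slice m k := disc gE (grid m k.+1) \_ (later m k `\` later m k.+1).

Let slice_ge0 m k w : 0 <= slice m k w.
Proof. by apply: erestrict_ge0 => w' _; exact: discounted_ge0. Qed.

Let measurable_slice m k : measurable_fun setT (slice m k).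
Proof.
apply/(measurable_restrictT _ _).1; first by apply: measurableD; apply (later_past _ _).1.
by apply: measurable_funTS; apply: mdisc => //; exact: st_grid.
Qed.

Let st_later m k : st (restrict_time (later m k) (grid m k)).
Proof. by apply: stopping_restrict; [exact: st_grid|exact: later_past]. Qed.

(** One step along the grid: either sigma has come and the payoff is below [u],
    or the walk continues; superharmonicity makes the total nonincreasing. *)
Let one_step m k :
  \int[P x]_w slice m k w + \int[P x]_w disc u (restrict_time (later m k.+1) (grid m k.+1)) w
  <= \int[P x]_w disc u (restrict_time (later m k) (grid m k)) w.
Proof.
have d0 f t w : (forall y, 0 <= f y) -> 0 <= disc f t w := @discounted_ge0 _ _ _ _ X r f t w.
have mtr : measurable_fun setT
    ((fun y => (expR (- (r * mesh m)))%:E * transition P X (mesh m) u y) : borel -> \bar R).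
  by apply: measurable_funeM; apply: (measurable_transition hX) => //; exact: ltW.
apply: (@le_trans _ _ (\int[P x]_w disc
    (fun y => (expR (- (r * mesh m)))%:E * transition P X (mesh m) u y)
    (restrict_time (later m k) (grid m k)) w)); last first.
  apply: ge0_le_integral => //.
  - by move=> w _; apply: d0 => y; rewrite mule_ge0 ?lee_fin ?expR_ge0//; exact: transition_ge0.
  - exact: mdisc.
  - exact: mdisc.
  - by move=> w _; exact: le_discounted.
rewrite -(strong_markov_stopping r hX x (st_later m k) (ltW (mesh_gt0 m)) mu u0).
have st1 : st (fun w => restrict_time (later m k) (grid m k) w + (mesh m)%:E).
  by apply: stopping_add; [exact: st_later|exact: ltW].
rewrite -ge0_integralD//; [|by move=> w _; exact: d0|exact: mdisc].
apply: ge0_le_integral => //.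
- by move=> w _; rewrite adde_ge0// d0.
- by apply: emeasurable_funD => //; exact: mdisc.
- exact: mdisc.
move=> w _; rewrite /slice patchE discounted_restrict in_setD.
have [wk|/negPf wk] := boolP (w \in later m k); last first.
  have -> : (w \in later m k.+1) = false.
    by apply/negbTE/negP => /set_mem/laterS/mem_set; rewrite wk.
  by rewrite /= adde0 d0.
have -> : disc u (fun w => restrict_time (later m k) (grid m k) w + (mesh m)%:E) w =
    disc u (grid m k.+1) w.
  by apply: discounted_congr; rewrite /restrict_time wk gridS.
by case: (w \in later m k.+1) => /=; rewrite ?add0e ?adde0 ?le_discounted.
Qed.

Let partial_sums m n :
  \sum_(k < n) \int[P x]_w slice m k w <=
  \int[P x]_w disc u (restrict_time [set w | tau w < sigma w] tau) w.
Proof.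
suff: \sum_(k < n) \int[P x]_w slice m k w +
      \int[P x]_w disc u (restrict_time (later m n) (grid m n)) w <=
    \int[P x]_w disc u (restrict_time [set w | tau w < sigma w] tau) w.
  apply: le_trans; rewrite leeDl//; apply: integral_ge0 => w _; exact: discounted_ge0.
elim: n => [|n ih].
  rewrite big_ord0 add0e le_eqVlt; apply/orP; left; apply/eqP; apply: eq_integral => w _.
  have -> : later m 0 = [set w | tau w < sigma w].
    by apply/funext => w'; rewrite /later /= grid0.
  by congr (disc u (restrict_time _ _) w); apply/funext => w'; exact: grid0.
by rewrite big_ord_recr/= -addeA; apply: le_trans ih; rewrite leeD2l.
Qed.

Let laterD m j k : (j <= k)%N -> later m k `<=` later m j.
Proof.
move=> jk; rewrite -(subnKC jk); elim: (k - j)%N => [|i ih]; first by rewrite addn0.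
by rewrite addnS; apply: subset_trans ih; exact: laterS.
Qed.

Let slice_uniq m j k w : slice m j w != 0 -> slice m k w != 0 -> j = k.
Proof.
wlog jk : j k / (j <= k)%N.
  by move=> H j0 k0; case/orP : (leq_total j k) => /H/(_ _ _); [exact|by move=> ->].
rewrite /slice !patchE; case: ifPn => [/set_mem[_ nj] _|_]; last by rewrite eqxx.
case: ifPn => [/set_mem[lk _] _|_]; last by rewrite eqxx.
apply/eqP; rewrite eqn_leq jk leqNgt; apply/negP => kj.
exact: nj (laterD kj lk).
Qed.

Let sum_slices m n k w : slice m k w != 0 -> (k < n)%N ->
  \sum_(j < n) slice m j w = slice m k w.
Proof.
move=> k0 kn; rewrite (bigD1 (Ordinal kn))//= big1 ?adde0// => j jk.
apply/eqP/negPn/negP => /slice_uniq/(_ k0) jkE.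
by move/eqP: jk; apply; exact: val_inj.
Qed.

Let sum_slices_le m n w : \sum_(j < n) slice m j w <= S w.
Proof.
have S0 : 0 <= S w := sup_payoff_ge0 X hg w.
have [[k [kn k0]]|H] := pselect (exists k, (k < n)%N /\ slice m k w != 0).
  rewrite (sum_slices k0 kn) /slice patchE; case: ifP => // _.
  by apply: disc_le_sup => //; apply (st_grid _ _).1.
rewrite big1// => j _; apply/eqP/negPn/negP => j0; by apply: H; exists j; split.
Qed.

(** The grid points just after sigma tend to sigma, and the payoff is continuous
    along the path. The grid has to reach beyond sigma, hence 4^m points of mesh
    2^-m. *)
Let sum_slices_cvg w : \sum_(k < 4 ^ m) slice m k w @[m --> \oo] -->
  disc gE (restrict_time [set w | tau w < sigma w] sigma) w.
Proof.
have later0 m k : later m k w -> tau w < sigma w.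
  by move/(laterD (leq0n k)); rewrite /later /= grid0.
have zero : (forall m k, slice m k w = 0) ->
    disc gE (restrict_time [set w | tau w < sigma w] sigma) w = 0 ->
    \sum_(k < 4 ^ m) slice m k w @[m --> \oo] -->
    disc gE (restrict_time [set w | tau w < sigma w] sigma) w.
  move=> s0 ->; rewrite (_ : (fun m => _) = cst 0); first exact: cvg_cst.
  by apply/funext => m; rewrite big1.
rewrite discounted_restrict in zero *.
have [/set_mem/= ts|ts] := boolP (w \in [set w | tau w < sigma w]); last first.
  rewrite (negPf ts) in zero *; apply: zero => // m k.
  rewrite /slice patchE; case: ifP => // /set_mem[/later0 ts' _].
  by move/negP: ts; case; exact: mem_set.
rewrite mem_set// in zero *.
case tE : (tau w) (stau.1 w) => [t| |]// t0; last by move: ts; rewrite tE ltNge leey.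
case sE : (sigma w) ts => [s| |] ts; last 2 first.
- apply: zero => [m k|]; last by rewrite discounted_never.
  rewrite /slice patchE; case: ifP => // /set_mem[_ []].
  by rewrite /later /grid /= sE tE -EFinD ltry.
- by move: ts; rewrite tE.
rewrite tE lte_fin in ts; rewrite lee_fin in t0.
pose H q := (expR (- (r * q)) * g (X q w))%R.
have step m : exists q : R, [/\ (s <= q)%R, (q <= s + mesh m)%R &
   (s - t <= 2 ^+ m)%R -> \sum_(k < 4 ^ m) slice m k w = (H q)%:E].
  have h0 := mesh_gt0 m; pose z := ((s - t) / mesh m)%R.
  have z0 : (0 < z)%R by rewrite divr_gt0// subr_gt0.
  have ex : exists k, (z <= k.+1%:R)%R by exists (Num.truncn z); rewrite ltW// truncnS_gt.
  case: (ex_minnP ex) => k zk kmin.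
  have kz : (k%:R < z)%R.
    case: k kmin {zk} => [//|k] kmin; rewrite ltNge; apply/negP => /kmin.
    by rewrite ltnn.
  have kz' : (k%:R * mesh m < s - t)%R by rewrite -ltr_pdivlMr.
  have zk' : (s - t <= k.+1%:R * mesh m)%R by rewrite -ler_pdivrMr.
  exists (t + k.+1%:R * mesh m)%R; split.
  - by rewrite -lerBlDl.
  - rewrite -natr1 mulrDl mul1r; lra.
  move=> stm.
  have sliceE : slice m k w = (H (t + k.+1%:R * mesh m)%R)%:E.
    rewrite /slice patchE mem_set; last first.
      by split; rewrite /later /grid /= sE tE -EFinD lte_fin -?leNgt; [lra|apply/negP; lra].
    by rewrite /discounted /grid tE /= -EFinM.
  have sl0 j : j != k -> slice m j w = 0.
    move=> jk; rewrite /slice patchE; case: ifP => // /set_mem[].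
    rewrite /later /grid /= sE tE -!EFinD !lte_fin => lj /negP; rewrite -leNgt => lj'.
    have jh : (j%:R < k.+1%:R :> R)%R.
      by rewrite -(ltr_pM2r h0); apply: lt_le_trans zk'; lra.
    have kh : (k%:R < j.+1%:R :> R)%R.
      by rewrite -(ltr_pM2r h0); apply: lt_le_trans kz' _; lra.
    move: jh kh; rewrite !ltr_nat !ltnS => jk' kj'.
    by move/eqP: jk; case; apply/eqP; rewrite eqn_leq jk'.
  have kn : (k < 4 ^ m)%N.
    rewrite -(ltr_nat R); apply: lt_le_trans kz _.
    rewrite /z /mesh -exprVn invrK natrX (_ : 4%:R = 2 * 2 :> R)%R ?exprMn; last by ring.
    by rewrite ler_pM2r// exprn_gt0.
  rewrite -sliceE (bigD1 (Ordinal kn))//= big1 ?adde0// => j jk.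
  by apply: sl0; apply: contra jk => /eqP jk; apply/eqP/val_inj.
have [q_ qP] := choice step.
have s0 : (0 <= s)%R by lra.
have cq : q_ m @[m --> \oo] --> s.
  apply: (@squeeze_cvgr _ _ _ _ (cst s) (fun m => s + mesh m)%R).
  - by apply: nearW => m; have [-> -> _] := qP m.
  - exact: cvg_cst.
  - rewrite -[X in _ --> X]addr0; apply: cvgD; first exact: cvg_cst.
    by apply: cvg_expr; rewrite ger0_norm; lra.
have cHr : H (q_ m) @[m --> \oo] --> H s.
  apply: (@payoff_path_cvg _ _ _ _ P X r hX g w q_ s (pf_continuous hg)) => //.
  by move=> m; have [sq _ _] := qP m; lra.
have cH : (H (q_ m))%:E @[m --> \oo] --> (H s)%:E.
  by apply: cvg_EFin; [exact: nearW|exact: cHr].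
rewrite (_ : disc gE sigma w = (H s)%:E); last by rewrite /discounted sE -EFinM.
apply: cvg_trans cH; apply: near_eq_cvg.
exists (Num.truncn (s - t)).+1 => // m /= mN.
have [_ _ ->//] := qP m.
apply: (@le_trans _ _ (m%:R)%R).
  by apply: (le_trans (ltW (truncnS_gt _))); rewrite ler_nat.
by rewrite -natrX ler_nat ltnW// ltn_expl.
Qed.

(** Continuous time is reached from the grids starting at [tau]: on each of them
    the steps telescope, and the payoffs at the grid points after [sigma] converge
    under the bound [S]. *)
Lemma optional_sampling :
  \int[P x]_w disc gE (restrict_time [set w | tau w < sigma w] sigma) w <=
  \int[P x]_w disc u (restrict_time [set w | tau w < sigma w] tau) w.
Proof.
have mD : measurable [set w | tau w < sigma w] by apply (sigma_past_lt mX stau ssigma).1.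
have mr := measurable_disc_restrict r hX mgE ssigma mD.
have cint : \int[P x]_w (\sum_(k < 4 ^ m) slice m k w) @[m --> \oo] -->
    \int[P x]_w disc gE (restrict_time [set w | tau w < sigma w] sigma) w.
  apply: (dominated_limit (h := S)) => //.
  - by move=> m; apply: emeasurable_sum => k; exact: measurable_slice.
  - exact: (measurable_sup_payoff hX hg).
  - by move=> m w; exact: sume_ge0.
  - exact: aeW.
apply: (cvge_to_le cint); apply: nearW => m.
by rewrite ge0_integral_sum.
Qed.

End OptionalSampling.

(** * The value process: supermartingale, and martingale until tauV *)

Section ValueProcess.
Local Open Scope ereal_scope.
Context {R : realType} {d : nat} {disp : measure_display} {Omega : measurableType disp}.
Variables (P : 'rV[R]_d -> probability Omega R) (X : R -> Omega -> 'rV[R]_d).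
Variables (r : R) (g : 'rV[R]_d -> R).
Hypothesis hX : strong_markov_process P X.
Hypothesis hg : payoff_function r g.
Hypothesis hV : standing_assumption P X r g.

Notation st := (stopping_time P X).
Notation disc := (discounted X r).
Notation gE := (fun y : 'rV[R]_d => (g y)%:E).
Notation V := (V P X r g).
Notation VE := (fun y : 'rV[R]_d => (V y)%:E).
Notation v := (dp_lim P X r g).
Notation gain := (gain P X r g).
Notation valueE := (valueE P X r g).
Notation S := (sup_payoff X r g).
Notation borel := (borelRV R d).
Notation tauV := (tauV P X r g).

Let mX t (t0 : (0 <= t)%R) := smp_measurable hX t0.
Let cX w := @smp_continuous _ _ _ _ _ _ hX w.
Let mgE := measurable_gE hg.
Let g0 := gE_ge0 hg.
Let mdisc := disc_measurable r hX.
Let S_int x : \int[P x]_w S w < +oo := sa_integrable hV x.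

Lemma valueE_fin y : valueE y \is a fin_num.
Proof.
rewrite ge0_fin_numE; last exact: le_trans (g0 y) (valueE_ge hX hg y).
apply: le_lt_trans (S_int y); apply: ge_ereal_sup => _ [tau stau <-].
apply: ge0_le_integral => //.
- by move=> w _; exact: discounted_ge0.
- exact: mdisc.
- exact: (measurable_sup_payoff hX hg).
- by move=> w _; apply: disc_le_sup => //; apply stau.1.
Qed.

Lemma valueEE y : valueE y = VE y.
Proof. by rewrite /= V_fine fineK// valueE_fin. Qed.

Lemma V_ge y : (g y <= V y)%R.
Proof. by rewrite -lee_fin -valueEE; exact: (valueE_ge hX hg). Qed.

Lemma V_ge0 y : (0 <= V y)%R.
Proof. exact: le_trans (pf_ge0 hg y) (V_ge y). Qed.

Lemma VE_ge0 y : 0 <= VE y. Proof. by rewrite lee_fin V_ge0. Qed.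

Lemma measurable_VE : measurable_fun setT (VE : borel -> \bar R).
Proof.
apply/measurable_EFinP; apply: continuous_borel_measurable; exact: (sa_continuous hV).
Qed.

(** Optional sampling between 0 and an arbitrary stopping time; on the event
    where that time is 0 the payoff is compared with its majorant directly. *)
Lemma value_le_dp_lim y : valueE y <= v y.
Proof.
apply: ge_ereal_sup => _ [sigma ssigma <-].
have mv : measurable_fun setT (v : borel -> \bar R) := measurable_dp_lim hX hg.
have v0 z : 0 <= v z by exact: dp_lim_ge0.
have gv z : gE z <= v z by exact: (@dp_le_lim _ _ _ _ P X r g 0 z).
have st0 := stopping0 P X.
pose A := [set w | 0 < sigma w].
have mA : measurable A by apply (sigma_past_lt mX st0 ssigma).1.
have := optional_sampling hX hg mv gv (fun m => dp_lim_superharmonic hX hg m)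
  st0 ssigma (S_int y).
rewrite -/A => samp.
have d0 f tau w : (forall z, 0 <= f z) -> 0 <= disc f tau w.
  exact: discounted_ge0.
rewrite -(integral_start r hX y mv v0).
rewrite /gain (integral_disc_restrictC r hX _ mgE g0 ssigma mA).
rewrite (integral_disc_restrictC r hX _ mv v0 st0 mA); apply: leeD => //.
apply: ge0_le_integral => //.
- by move=> w _; exact: d0.
- by apply: (measurable_disc_restrict r hX) => //; exact: measurableC.
- by apply: (measurable_disc_restrict r hX) => //; exact: measurableC.
move=> w _; rewrite !discounted_restrict in_setC.
have [//|wA] := boolP (w \in A).
have -> : disc gE sigma w = disc gE (fun=> 0) w.
  apply: discounted_congr; apply/eqP; rewrite eq_le (ssigma.1 w) andbT leNgt.
  by apply/negP => sw; move/negP: wA; apply; exact: mem_set.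
exact: le_discounted.
Qed.

(** The value inherits the superharmonicity of the dynamic programming limit. *)
Lemma dp_limE : v = VE.
Proof.
apply/funext => y; rewrite -valueEE; apply/eqP; rewrite eq_le value_le_dp_lim andbT.
exact: (dp_lim_le_value hX hg).
Qed.

Lemma V_sampling x tau sigma : st tau -> st sigma ->
  \int[P x]_w disc gE (restrict_time [set w | tau w < sigma w] sigma) w <=
  \int[P x]_w disc VE (restrict_time [set w | tau w < sigma w] tau) w.
Proof.
move=> stau ssigma; apply: optional_sampling => //.
- exact: measurable_VE.
- by move=> y; rewrite lee_fin V_ge.
- by move=> m y; have := dp_lim_superharmonic hX hg m y; rewrite dp_limE.
Qed.

(** Rounding to a strictly later multiple of 2^-n gives a stopping time: it has
    come at time t when tau < j 2^-n, for the last multiple j 2^-n up to t. *)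
Definition round_up (n : nat) (tau : Omega -> \bar R) (w : Omega) : \bar R :=
  if tau w is t%:E then ((Num.truncn (t * 2 ^+ n)).+1%:R / 2 ^+ n)%:E else +oo.

Lemma countably_valued_round_up n tau : countably_valued (round_up n tau).
Proof.
exists (fun k => k%:R / 2 ^+ n)%R => w; rewrite /round_up.
by case: (tau w) => [t||]; [right; eexists|left|left].
Qed.

Lemma stopping_round_up n tau : st tau -> st (round_up n tau).
Proof.
move=> stau; have n0 : (0 < 2 ^+ n :> R)%R by rewrite exprn_gt0.
split => [w|t t0].
  by rewrite /round_up; case: (tau w) => [t||]//; rewrite lee_fin divr_ge0// ltW.
pose j := Num.truncn (t * 2 ^+ n).
have /Num.Theory.truncn_itv/andP[j1 j2] : (0 <= t * 2 ^+ n)%R by rewrite mulr_ge0// ltW.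
rewrite (_ : [set w | _] = [set w | tau w < (j%:R / 2 ^+ n)%:E]).
  by apply: stopping_lt => //; rewrite ler_pdivrMr.
apply/seteqP; split => w /=; rewrite /round_up; have := stau.1 w;
  case: (tau w) => [s| |]//; rewrite ?lee_fin ?lte_fin => s0.
- rewrite ler_pdivrMr// ltr_pdivlMr// => H.
  have : ((Num.truncn (s * 2 ^+ n)).+1 <= j)%N.
    by rewrite Num.Theory.truncn_ge_nat ?mulr_ge0// ltW.
  by rewrite -(ler_nat R); apply: lt_le_trans; exact: truncnS_gt.
- rewrite ltr_pdivlMr// => H; rewrite ler_pdivrMr//; apply: le_trans j1.
  by rewrite ler_nat Num.Theory.truncn_lt_nat ?mulr_ge0// ltW.
Qed.

Lemma round_up_cvg (t : R) : (0 <= t)%R ->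
  ((Num.truncn (t * 2 ^+ n)).+1%:R / 2 ^+ n : R)%R @[n --> \oo] --> t.
Proof.
move=> t0; apply: (@squeeze_cvgr _ _ _ _ (cst t) (fun n => t + 2^-1 ^+ n)%R).
- apply: nearW => n /=; have n0 : (0 < 2 ^+ n :> R)%R by rewrite exprn_gt0.
  have /Num.Theory.truncn_itv/andP[j1 j2] : (0 <= t * 2 ^+ n)%R by rewrite mulr_ge0// ltW.
  rewrite ler_pdivlMr// (ltW j2)/= ler_pdivrMr// mulrDl -exprMn mulVf// expr1n.
  by rewrite -natr1 lerD2r.
- exact: cvg_cst.
- rewrite -[X in _ --> X]addr0; apply: cvgD; first exact: cvg_cst.
  by apply: cvg_expr; rewrite ger0_norm; lra.
Qed.

(** Fatou's lemma from the rounded times, which take countably many values; the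
    value is continuous along the path. *)
Lemma V_supermartingale x tau : st tau -> \int[P x]_w disc VE tau w <= VE x.
Proof.
move=> stau.
have cE w : disc VE (round_up n tau) w @[n --> \oo] --> disc VE tau w.
  have := stau.1 w; rewrite /discounted /round_up; case: (tau w) => [t||]//; last first.
    by move=> _; exact: cvg_cst.
  rewrite lee_fin => t0.
  rewrite -EFinM; under eq_fun do rewrite -EFinM.
  apply: cvg_EFin; first exact: nearW.
  apply: (@payoff_path_cvg _ _ _ _ P X r hX V w _ t (sa_continuous hV) _ t0 (round_up_cvg t0)).
  by move=> n; rewrite divr_ge0// exprn_ge0.
have d0 t w : 0 <= disc VE t w by apply: discounted_ge0 => y; exact: VE_ge0.
have -> : disc VE tau = fun w => limn_einf (fun n => disc VE (round_up n tau) w).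
  apply/funext => w; rewrite is_cvg_limn_einfE; last by apply/cvg_ex; eexists; exact: cE.
  by rewrite (cvg_lim _ (cE w)).
have st_n n := stopping_round_up n stau.
have mn n : measurable_fun setT (disc VE (round_up n tau)).
  by apply: mdisc => //; exact: measurable_VE.
apply: (le_trans (fatou (P x) measurableT mn (fun n w _ => d0 _ w))).
rewrite limn_einf_lim; apply: lime_le; first exact: is_cvg_einfs.
apply: nearW => n; apply: (@le_trans _ _ (\int[P x]_w disc VE (round_up n tau) w)).
  by apply: ereal_inf_lbound; exists n => /=.
rewrite -valueEE -[X in disc X]dp_limE.
apply: (dp_lim_supermartingale_countable hX hg) => //; exact: countably_valued_round_up.
Qed.

Lemma path_continuous (f : 'rV[R]_d -> R) w (T : R) : continuous f ->
  {within `[0%R, T], continuous (fun t => expR (- (r * t)) * f (X t w))%R}.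
Proof.
move=> cf.
have sub : `[0%R, T] `<=` `[0%R, +oo[.
  by move=> t /=; rewrite !in_itv/= andbT => /andP[].
have cXT := continuous_subspaceW sub (@cX w).
move=> t; apply: cvgM.
  have : {within `[0%R, T], continuous (fun t => expR (- (r * t)))}%R.
    apply: continuous_subspaceT => s.
    apply: continuous_comp; last exact: continuous_expR.
    by apply: cvgN; apply: cvgMr.
  exact.
apply: continuous_comp; [exact: cXT|exact: cf].
Qed.

Lemma V_gt_before_tauV w (t : R) : (0 <= t)%R -> t%:E < tauV w ->
  (g (X t w) < V (X t w))%R.
Proof.
move=> t0 tV; rewrite lt_neqAle V_ge andbT; apply/eqP => gV.
move: tV; rewrite ltNge => /negP; apply; apply: ereal_inf_lbound.
by exists t.
Qed.

Let Yp w t := (expR (- (r * t)) * V (X t w))%R.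
Let Gp w t := (expR (- (r * t)) * g (X t w))%R.
Let Dp w t := (expR (- (r * t)) * (V (X t w) - g (X t w)))%R.

Let YpE w t : Yp w t = (Gp w t + Dp w t)%R.
Proof. by rewrite /Yp /Gp /Dp; ring. Qed.

Let Gp_ge0 w t : (0 <= Gp w t)%R.
Proof. by rewrite mulr_ge0 ?expR_ge0// (pf_ge0 hg). Qed.

Let Dp_ge0 w t : (0 <= Dp w t)%R.
Proof. by rewrite mulr_ge0 ?expR_ge0// subr_ge0 V_ge. Qed.

Let Dp_gt0 w (t : R) : (0 <= t)%R -> t%:E < tauV w -> (0 < Dp w t)%R.
Proof.
by move=> t0 tV; rewrite mulr_gt0 ?expR_gt0// subr_gt0; exact: V_gt_before_tauV.
Qed.

Let cDp w T : {within `[0%R, T], continuous (Dp w)}.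
Proof.
have := @path_continuous (fun y => V y - g y)%R w T; apply => y.
by apply: continuousB; [exact: (sa_continuous hV)|exact: (pf_continuous hg)].
Qed.

(** Up to tauV the difference of value and payoff vanishes at most at the end t,
    so that where it is small the time is close to t. *)
Lemma payoff_near_value_fin w (t e : R) : (0 <= t)%R -> t%:E <= tauV w -> (0 < e)%R ->
  exists2 m, (0 < m)%R & forall s, (0 <= s <= t)%R -> (Dp w s < m)%R ->
    (`|Gp w s - Yp w t| < e)%R.
Proof.
move=> t0 tV e0.
pose chi s := Num.max (Dp w s) (e / 2 - `|Yp w s - Yp w t|)%R.
have cchi : {within `[0%R, t], continuous chi}.
  move=> s; apply: (@continuous_max R (subspace `[0%R, t])); first exact: cDp.
  apply: cvgB; first exact: cvg_cst.
  apply: cvg_norm; apply: cvgB; last exact: cvg_cst.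
  exact: (@path_continuous V w t (sa_continuous hV) s).
have [c] := EVT_min t0 cchi; rewrite in_itv/= => /andP[c0 ct] cmin.
have chic : (0 < chi c)%R.
  rewrite /chi lt_max; move: ct; rewrite le_eqVlt => /orP[/eqP ->|ct].
    by rewrite subrr normr0; apply/orP; right; lra.
  by rewrite Dp_gt0//; apply: lt_le_trans tV; rewrite lte_fin.
exists (Num.min (chi c) (e / 2))%R; first by rewrite lt_min chic; lra.
move=> s st; rewrite lt_min => /andP[Dc De].
have := cmin s; rewrite in_itv/= => /(_ st) cs.
have : (chi c <= e / 2 - `|Yp w s - Yp w t|)%R.
  by move: cs; rewrite {2}/chi le_max => /orP[|//]; rewrite leNgt Dc.
have -> : (Gp w s - Yp w t = (Yp w s - Yp w t) - Dp w s)%R by rewrite (YpE w s); ring.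
have := ler_normB (Yp w s - Yp w t)%R (Dp w s).
rewrite (ger0_norm (Dp_ge0 w s)); lra.
Qed.

(** On bounded intervals the difference of value and payoff stays away from 0;
    at late times the value itself is small, by the limsup condition. *)
Lemma payoff_near_value_infty w (e : R) : tauV w = +oo -> (0 < e)%R ->
  limf_esup (fun t => (expR (- (r * t)) * V (X t w) *
    \1_[set w' | tauV w' = +oo%E] w)%R%:E) (pinfty_nbhs R) = 0 ->
  exists2 m, (0 < m)%R & forall s, (0 <= s)%R -> (Dp w s < m)%R ->
    (`|Gp w s| < e)%R.
Proof.
move=> tV e0; rewrite indicE mem_set// => lim0.
have : limf_esup (fun t => (expR (- (r * t)) * V (X t w) * 1)%R%:E) (pinfty_nbhs R) < e%:E.
  by rewrite lim0 lte_fin.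
move=> /ereal_inf_lt[_ [W [M [_ MW]] <-] We].
have T0 : (0 <= `|M| + 1 :> R)%R by rewrite addr_ge0.
have [c] := EVT_min T0 (@cDp w (`|M| + 1)%R); rewrite in_itv/= => /andP[c0 _] cmin.
exists (Dp w c); first by rewrite Dp_gt0// tV ltry.
move=> s s0 Dsc; rewrite ger0_norm//.
have [sM|Ms] := leP s (`|M| + 1)%R.
  have := cmin s; rewrite in_itv/= s0 sM => /(_ isT).
  by rewrite leNgt Dsc.
apply: (@le_lt_trans _ _ (Yp w s)); first by rewrite YpE lerDl.
rewrite -lte_fin; apply: le_lt_trans We; apply: ereal_sup_ubound.
exists s; last by rewrite mulr1.
by apply: MW; apply: le_lt_trans (ler_norm M) _; lra.
Qed.

(** Near-optimal stopping times stop where the value exceeds the payoff by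
    little, hence not much before [tauV]; stopping them at [tau] costs nothing
    by [V_sampling]. *)
Lemma V_martingale_until_tauV x tau : st tau -> (forall w, tau w <= tauV w) ->
  \int[P x]_w disc VE tau w = VE x.
Proof.
move=> stau tau_le; apply/eqP; rewrite eq_le V_supermartingale//=.
have d0 t w : 0 <= disc VE t w by apply: discounted_ge0 => y; exact: VE_ge0.
have dg0 t w : 0 <= disc gE t w by apply: discounted_ge0.
have near_opt n : exists sigma, st sigma /\ VE x - (2^-1 ^+ n)%:E < gain sigma x.
  have n0 : (0 < 2^-1 ^+ n :> R)%R by rewrite exprn_gt0.
  have [_ [sigma ssigma <-]] := ub_ereal_sup_adherent n0 (valueE_fin x).
  by rewrite -/(valueE x) valueEE; exists sigma.
have [sigma sigmaP] := choice near_opt.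
have ss n := (sigmaP n).1.
(* the loss from stopping at sigma n *)
pose loss n := disc (fun y => (V y - g y)%:E) (sigma n).
have Vg0 y : 0 <= (V y - g y)%:E by rewrite lee_fin subr_ge0 V_ge.
have mVg : measurable_fun setT ((fun y => (V y - g y)%:E) : borel -> \bar R).
  apply/measurable_EFinP; apply: continuous_borel_measurable => y.
  by apply: continuousB; [exact: (sa_continuous hV)|exact: (pf_continuous hg)].
have loss0 n w : 0 <= loss n w by exact: discounted_ge0.
have mloss n : measurable_fun setT (loss n) by exact: mdisc.
have lossE n w : disc VE (sigma n) w = disc gE (sigma n) w + loss n w.
  rewrite /loss /discounted; case: (sigma n w) => [t||]; rewrite ?adde0//.
  by rewrite -!EFinM -EFinD -mulrDr subrKC.
have loss_le n : \int[P x]_w loss n w <= (2^-1 ^+ n)%:E.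
  have := V_supermartingale x (ss n).
  under eq_integral do rewrite lossE.
  rewrite ge0_integralD//; [|exact: mdisc].
  have := (sigmaP n).2; rewrite -/(gain (sigma n) x).
  have [gn gnE] : exists gn : R, gain (sigma n) x = gn%:E.
    exists (fine (gain (sigma n) x)); rewrite fineK// ge0_fin_numE; last first.
      by apply: integral_ge0 => w _; exact: dg0.
    apply: le_lt_trans (@gain_le_value _ _ _ _ P X r g _ x (ss n)) _.
    by rewrite valueEE ltry.
  rewrite gnE; case: (\int[P x]_w loss n w) => [l| |]//; rewrite ?leye_eq ?leNye//.
  by rewrite -EFinB -EFinD !lee_fin lte_fin; lra.
have loss_cvg := ae_cvg0_geometric mloss loss0 loss_le.
pose early n := [set w | tau w < sigma n w].
have mearly n : measurable (early n) by apply (sigma_past_lt mX stau (ss n)).1.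
(* tau where it precedes sigma n, with the value as reward, and sigma n elsewhere *)
pose H n w := disc VE (restrict_time (early n) tau) w +
  disc gE (restrict_time (~` early n) (sigma n)) w.
have HE n w : H n w = if w \in early n then disc VE tau w else disc gE (sigma n) w.
  rewrite /H !discounted_restrict in_setC.
  by case: (w \in early n); rewrite ?adde0 ?add0e.
have mp1 n : measurable_fun setT (disc VE (restrict_time (early n) tau)).
  exact: (measurable_disc_restrict r hX (measurable_VE) stau (mearly n)).
have mp2 n : measurable_fun setT (disc gE (restrict_time (~` early n) (sigma n))).
  exact: (measurable_disc_restrict r hX mgE (ss n) (measurableC (mearly n))).
have Hge n : VE x - (2^-1 ^+ n)%:E <= \int[P x]_w H n w.
  apply: (le_trans (ltW (sigmaP n).2)).
  rewrite /gain (integral_disc_restrictC r hX x mgE g0 (ss n) (mearly n)).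
  by rewrite /H ge0_integralD//; apply: leeD => //; exact: V_sampling.
have mVt : measurable_fun setT (disc VE tau) by apply: mdisc => //; exact: measurable_VE.
have S0 w : 0 <= S w := sup_payoff_ge0 X hg w.
have cH : {ae P x, forall w, H n w @[n --> \oo] --> disc VE tau w}.
  have lim := sa_limsup hV x.
  apply: (filterS2 _ _ loss_cvg lim) => w loss_w lim_w.
  have [y yE] : exists y : R, disc VE tau w = y%:E.
    by rewrite /discounted; case: (tau w) => [t||]; eexists; rewrite -?EFinM.
  pose h n := fine (H n w).
  have hE n : H n w = (h n)%:E.
    rewrite /h fineK// HE; case: ifP => _; rewrite ?yE//.
    by rewrite /discounted; case: (sigma n w).
  rewrite yE; under eq_fun do rewrite hE; apply: cvg_EFin; first exact: nearW.
  apply/cvgrPdist_lt => e e0.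
  have [m m0 mP] : exists2 m, (0 < m)%R & forall s, (0 <= s)%R -> s%:E <= tau w ->
      (Dp w s < m)%R -> (`|Gp w s - y| < e)%R.
    move: yE (tau_le w); rewrite /discounted; case tE: (tau w) (stau.1 w) => [t| |]//.
      rewrite lee_fin => t0; rewrite -EFinM => -[<-] tV.
      have [m m0 mP] := payoff_near_value_fin t0 tV e0; exists m => // s s0.
      by rewrite lee_fin => st; apply: mP; rewrite s0.
    move=> _ [<-]; rewrite leye_eq => /eqP tV.
    have [m m0 mP] := payoff_near_value_infty tV e0 lim_w; exists m => // s s0 _ ?.
    by rewrite subr0 mP.
  have : \forall n \near \oo, loss n w < m%:E.
    apply: (loss_w [set z | z < m%:E]); apply: open_nbhs_nbhs; split.
      exact: open_ereal_lt_ereal.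
    by rewrite /= lte_fin.
  apply: filterS => n lossn; rewrite /= /h HE; case: ifPn => [_|wn].
    by rewrite yE /= subrr normr0.
  have {wn} : sigma n w <= tau w.
    by rewrite leNgt; apply: contra wn => wn; exact: mem_set.
  move: lossn; rewrite /loss /discounted; case sE : (sigma n w) ((ss n).1 w) => [s| |]//.
    by rewrite lee_fin -!EFinM lte_fin => s0 Ds st; rewrite /= distrC; exact: mP.
  move=> _ _; rewrite leye_eq => /eqP tE; move: yE; rewrite discounted_never// => -[<-].
  by rewrite /= subrr normr0.
have cint : \int[P x]_w H n w @[n --> \oo] --> \int[P x]_w disc VE tau w.
  apply: (dominated_limit (h := fun w => disc VE tau w + S w)) => //.
  - by move=> n; exact: emeasurable_funD.
  - by apply: emeasurable_funD => //; exact: (measurable_sup_payoff hX hg).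
  - by move=> n w; rewrite adde_ge0.
  - move=> n w; rewrite HE; case: ifP => _; first by rewrite leeDl.
    apply: (@le_trans _ _ (S w)); last by rewrite leeDr.
    by apply: disc_le_sup => //; apply (ss n).1.
  - rewrite ge0_integralD//; last exact: (measurable_sup_payoff hX hg).
    apply: lte_add_pinfty; last exact: S_int.
    by apply: (le_lt_trans (V_supermartingale x stau)); rewrite ltry.
have cV : VE x - (2^-1 ^+ n)%:E @[n --> \oo] --> VE x.
  rewrite -[X in _ --> X]sube0; apply: cvgeB => //; first exact: cvg_cst.
  apply: cvg_EFin; first exact: nearW.
  by apply: cvg_expr; rewrite ger0_norm; lra.
rewrite -(cvg_lim _ cV)// -(cvg_lim _ cint)//; apply: lee_lim => //.
- by apply/cvg_ex; eexists; exact: cV.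
- by apply/cvg_ex; eexists; exact: cint.
- exact: nearW.
Unshelve. all: by end_near. Qed.

End ValueProcess.

(** * The boundaries b and c *)

Lemma inf_attained {R : realType} (A : set R) (m : R) :
  A m -> (forall y, A y -> m <= y) -> inf A = m.
Proof.
move=> Am mA; apply/eqP; rewrite eq_le; apply/andP; split.
  by apply: ge_inf => //; exists m.
by apply: lb_le_inf; [exists m|].
Qed.

Section RunningMinimum.
Context {R : realType}.
Variable beta : R -> R.
Hypothesis cbeta : {within `[0, +oo[, continuous beta}.

Definition running_min t := inf [set beta s | s in `[0, t] ].

Lemma running_min_attained t : 0 <= t ->
  exists c, [/\ 0 <= c, c <= t, running_min t = beta c &
    forall s, 0 <= s -> s <= t -> beta c <= beta s].
Proof.
move=> t0; have sub : `[0, t] `<=` `[0, +oo[.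
  by move=> s /=; rewrite !in_itv/= andbT => /andP[].
have [c] := EVT_min t0 (continuous_subspaceW sub cbeta).
rewrite in_itv/= => /andP[c0 ct] cmin.
have cmin' s : 0 <= s -> s <= t -> beta c <= beta s.
  by move=> s0 st; apply: cmin; rewrite in_itv/= s0.
exists c; split => //; apply: inf_attained.
  by exists c => //; rewrite /= in_itv/= c0.
by move=> y [s /=]; rewrite in_itv/= => /andP[s0 st] <-; exact: cmin'.
Qed.

Lemma running_min_le s t : 0 <= s -> s <= t -> running_min t <= beta s.
Proof.
by move=> s0 st; have [c [_ _ -> cmin]] := running_min_attained (le_trans s0 st); exact: cmin.
Qed.

Lemma running_min_nonincreasing s t : 0 <= s -> s <= t -> running_min t <= running_min s.
Proof.
move=> s0 st; have [c [c0 cs -> _]] := running_min_attained s0.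
by apply: running_min_le => //; exact: le_trans st.
Qed.

Lemma running_min_continuous t e : 0 <= t -> 0 < e -> exists2 h, 0 < h &
  forall s, 0 <= s -> `|s - t| < h -> `|running_min s - running_min t| <= e.
Proof.
move=> t0 e0.
have /subspace_continuousP/(_ t) := cbeta; rewrite /= in_itv/= t0 => /(_ isT).
move=> /cvgrPdist_lt/(_ (e / 2)) H; have e20 : 0 < e / 2 by lra.
have [h /= h0 hP] := H e20; exists h => // s s0 sth.
have near_t q : 0 <= q -> `|q - t| < h -> `|beta t - beta q| < e / 2.
  move=> q0 qt; apply: hP; first by rewrite /= distrC.
  by rewrite /= in_itv/= q0.
have [st|ts] := leP s t.
  have [c [c0 ct cE cmin]] := running_min_attained t0.
  have rs := running_min_nonincreasing s0 st.
  rewrite ger0_norm ?subr_ge0// lerBlDr cE.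
  have [cs|sc] := leP c s; first by have := running_min_le c0 cs; lra.
  have cth : `|c - t| < h by move: sth; rewrite !ler0_norm; lra.
  have := near_t c c0 cth; have := near_t s s0 sth; have := running_min_le s0 (lexx s).
  rewrite !ltr_norml => ? /andP[? ?] /andP[? ?]; lra.
have [c [c0 cs cE cmin]] := running_min_attained s0.
have rt := running_min_nonincreasing t0 (ltW ts).
rewrite ler0_norm ?subr_le0// opprB lerBlDr cE.
have [ct|tc] := leP c t; first by have := running_min_le c0 ct; lra.
have cth : `|c - t| < h by move: sth; rewrite !gtr0_norm; lra.
have := near_t c c0 cth; have := running_min_le t0 (lexx t).
rewrite !ltr_norml => ? /andP[? ?]; lra.
Qed.

End RunningMinimum.

Section Boundaries.
Context {R : realType} {d : nat} {disp : measure_display} {Omega : measurableType disp}.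
Variables (P : 'rV[R]_d -> probability Omega R) (X : R -> Omega -> 'rV[R]_d).
Variables (r : R) (g : 'rV[R]_d -> R).
Hypothesis hX : strong_markov_process P X.
Hypothesis hreg : regular_process P X.
Hypothesis hg : payoff_function r g.
Hypothesis hV : standing_assumption P X r g.

Notation V := (V P X r g).
Notation b := (b P X r g).
Notation c := (c P X r g).
Notation tauV := (tauV P X r g).
Notation disc := (discounted X r).
Notation borel := (borelRV R d).

Let mX t (t0 : 0 <= t) := smp_measurable hX t0.
Let cX w := @smp_continuous _ _ _ _ _ _ hX w.

(** Were the value zero at [y], the payoff would vanish at all rational times,
    hence along the whole path, and the process could not reach the set where
    the payoff is positive. *)
Lemma V_gt0 y : 0 < V y.
Proof.
rewrite lt_neqAle (V_ge0 hX hg hV) andbT; apply/eqP => Vy0.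
have [_ [z _ <-]] := ereal_sup_gt (pf_sup hg); rewrite lte_fin => gz.
pose O := [set z : 'rV[R]_d | 0 < g z].
have oO : open O.
  by apply: (@open_comp _ _ g [set u : R | 0 < u]); [move=> ? _; exact: (pf_continuous hg)|exact: open_gt].
have := hreg y oO; move=> /(_ (ex_intro _ z gz)).
pose N k m := [set w | 0 < g (X (k%:R / m.+1%:R) w)].
have mg t : 0 <= t -> measurable_fun setT (fun w => g (X t w)).
  move=> t0; apply: (@measurableT_comp _ _ _ _ borel _ g).
    by apply: continuous_borel_measurable; exact: (pf_continuous hg).
  exact: mX.
have q0 k m : 0 <= k%:R / m.+1%:R :> R by rewrite divr_ge0.
have mN k m : measurable (N k m).
  rewrite (_ : N k m = (fun w => g (X (k%:R / m.+1%:R) w)) @^-1` `]0, +oo[).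
    by rewrite -[X in measurable X]setTI; apply: mg.
  by apply/seteqP; split => w /=; rewrite in_itv/= andbT.
have N0 k m : P y (N k m) = 0%E.
  pose q : R := k%:R / m.+1%:R.
  have stq : stopping_time P X (fun=> q%:E) := stopping_cst P X (q0 k m).
  have := V_supermartingale hX hg hV y stq; rewrite -Vy0 => I0.
  have dg : (\int[P y]_w disc (fun z => (g z)%:E) (fun=> q%:E) w = 0)%E.
    apply/eqP; rewrite eq_le; apply/andP; split; last first.
      by apply: integral_ge0 => w _; apply: discounted_ge0; exact: (gE_ge0 hg).
    apply: le_trans I0; apply: ge0_le_integral => //.
    - by move=> w _; apply: discounted_ge0; exact: (gE_ge0 hg).
    - by apply: (disc_measurable r hX) => //; exact: (measurable_gE hg).
    - by apply: (disc_measurable r hX) => //; exact: (measurable_VE hV).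
    - by move=> w _; apply: le_discounted => u; rewrite lee_fin (V_ge hX hg hV).
  have : ae_eq (P y) setT (disc (fun z => (g z)%:E) (fun=> q%:E)) (cst 0%E).
    apply/(ae_eq_integral_abs _ measurableT).
      by apply: (disc_measurable r hX) => //; exact: (measurable_gE hg).
    rewrite -dg; apply: eq_integral => w _; rewrite gee0_abs//.
    by apply: discounted_ge0; exact: (gE_ge0 hg).
  move=> [M [mM M0 sub]]; apply: (subset_measure0 _ mM _ M0) => //.
  move=> w Nw; apply: sub => /= /(_ I) /eqP; rewrite /discounted mule_eq0 !eqe.
  by rewrite gt_eqF ?expR_gt0//= gt_eqF.
rewrite (_ : [set w | _] = \bigcup_k \bigcup_m N k m).
  have mU : measurable (\bigcup_k \bigcup_m N k m).
    by apply: bigcup_measurable => k _; exact: bigcup_measurable.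
  have : (P y).-negligible (\bigcup_k \bigcup_m N k m).
    apply: negligible_bigcup => k; apply: negligible_bigcup => m.
    by apply/negligibleP; [exact: mN|exact: N0].
  by move=> /(negligibleP _ mU) /= ->; rewrite ltxx.
apply/seteqP; split => w /=; last first.
  by move=> [k _ [m _ Nw]]; exists (k%:R / m.+1%:R).
move=> [t t0 Ot].
have cg : g (X ((Num.truncn (t * n.+1%:R))%:R / n.+1%:R) w) @[n --> \oo] --> g (X t w).
  apply: continuous_cvg; first exact: (pf_continuous hg).
  by apply: (path_cvg (@cX)) => //; exact: floor_grid_cvg.
have [n _ nP] : \forall n \near \oo, 0 < g (X ((Num.truncn (t * n.+1%:R))%:R / n.+1%:R) w).
  apply: (cg [set u | 0 < u]); apply: open_nbhs_nbhs; split => //; exact: open_gt.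
exists (Num.truncn (t * n.+1%:R)) => //; exists n => //.
exact: (nP n (leqnn n)).
Qed.

Lemma bE y : b y = 1 - g y / V y.
Proof.
have V0 := V_gt0 y; have g0 := pf_ge0 hg y; have gV := V_ge hX hg hV y.
apply: inf_attained => /=.
  rewrite subr_ge0 ler_pdivrMr// mul1r gV/= lerBlDr lerDl divr_ge0//=; last exact: ltW.
  by split => //; rewrite opprB addrC subrK divfK// gt_eqF.
move=> p [_]; rewrite -ler_pdivlMr//; lra.
Qed.

Lemma b_ge0 y : 0 <= b y.
Proof.
by rewrite bE subr_ge0 ler_pdivrMr ?V_gt0// mul1r (V_ge hX hg hV).
Qed.

Lemma gE_b y : g y = (1 - b y) * V y.
Proof. by rewrite bE opprB addrC subrK divfK// gt_eqF// V_gt0. Qed.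

Lemma b_eq0 y : (b y == 0) = (V y == g y).
Proof.
apply/eqP/eqP => H; first by rewrite [RHS]gE_b H subr0 mul1r.
by rewrite bE -H divff ?subrr// gt_eqF// V_gt0.
Qed.

Lemma continuous_b : continuous b.
Proof.
rewrite (_ : b = fun y => 1 - g y / V y); last by apply/funext => y; exact: bE.
move=> y.
have cV : {for y, continuous (fun z => (V z)^-1)}.
  by apply: continuousV; [rewrite gt_eqF// V_gt0|exact: (sa_continuous hV)].
have cgV : {for y, continuous (fun z => g z / V z)}.
  by apply: continuousM => //; exact: (pf_continuous hg).
by apply: (@continuousB R R^o _ (fun=> 1) _ y); [exact: cst_continuous|exact: cgV].
Qed.

Lemma cE y : c y = (V y - g y) / (V y - g y / 2).
Proof.
have V0 := V_gt0 y; have g0 := pf_ge0 hg y; have gV := V_ge hX hg hV y.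
have D0 : 0 < V y - g y / 2 by lra.
apply: inf_attained => /=.
  have -> : (1 - (V y - g y) / (V y - g y / 2)) * V y =
      (1 - (V y - g y) / (V y - g y / 2) / 2) * g y by field; apply: lt0r_neq0; lra.
  have -> /= : 0 <= (V y - g y) / (V y - g y / 2) by rewrite divr_ge0//; lra.
  by rewrite ler_pdivrMr// mul1r; split => //; lra.
by move=> p [_ H]; rewrite ler_pdivrMr//; lra.
Qed.

Lemma lt_cE p y : (p < c y) = ((1 - p / 2) * g y < (1 - p) * V y).
Proof.
have V0 := V_gt0 y; have g0 := pf_ge0 hg y; have gV := V_ge hX hg hV y.
have D0 : 0 < V y - g y / 2 by lra.
by rewrite cE ltr_pdivlMr//; apply/idP/idP => ?; lra.
Qed.

(** A point of Cbar lies strictly below c: if g > 0 then (1 - p/2) g < g, and if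
    g = 0 then V > 0 decides. *)
Lemma regionE p y : 0 < p < 1 ->
  (Cbar P X r g `|` Cprime P X r g) (p, y) <-> p < c y.
Proof.
move=> p01; rewrite lt_cE; have V0 := V_gt0 y; have g0 := pf_ge0 hg y.
have [p0 p1] := andP p01; split.
  move=> [[_ /= H]|[_ /= /andP[]//]].
  have [g1|] := ltP 0 (g y); first by nra.
  by move=> g1; have -> : g y = 0 by [lra]; rewrite mulr0 mulr_gt0// subr_gt0.
move=> H; have [gV|Vg] := leP (g y) ((1 - p) * V y); first by left.
by right; split => //=; apply/andP.
Qed.

End Boundaries.

(** * The strategies in terms of the belief Z *)

Section Strategies.
Context {R : realType} {d : nat} {disp : measure_display} {Omega : measurableType disp}.
Variables (P : 'rV[R]_d -> probability Omega R) (X : R -> Omega -> 'rV[R]_d).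
Variables (r : R) (g : 'rV[R]_d -> R).
Hypothesis hX : strong_markov_process P X.
Hypothesis hreg : regular_process P X.
Hypothesis hg : payoff_function r g.
Hypothesis hV : standing_assumption P X r g.
Variables (p1 p2 : R) (x : 'rV[R]_d).
Hypotheses (p1_gt0 : 0 < p1) (p1_lt1 : p1 < 1) (p12 : p1 <= p2).
Hypothesis px : p1 < c P X r g x.

Notation V := (V P X r g).
Notation b := (b P X r g).
Notation tauV := (tauV P X r g).
Notation borel := (borelRV R d).
Notation F := (filtrationX P X).
Notation FT t := (g_sigma_algebraType (F t)).
Notation G0 := (Gamma_star0 P X r g p1 x).
Notation q := (q1 P X r g p1 x).
Notation Z := (Z P X r g q).
Notation Gamma1 := (Gamma1_star P X r g p1 p2 x).
Notation Gamma2 := (Gamma2_star P X r g p1 x).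

Let cX w := @smp_continuous _ _ _ _ _ _ hX w.

Let H : (1 - p1 / 2) * g x < (1 - p1) * V x.
Proof. by rewrite -(lt_cE hX hreg hg hV). Qed.

Let V0 := V_gt0 hX hreg hg hV x.

Lemma Gamma_star0_ge0 : 0 <= G0.
Proof.
rewrite /Gamma_star0; case: ifP => // _.
by rewrite mulr_ge0 ?divr_ge0 ?(ltW p1_gt0)// le_max lexx.
Qed.

(** Both halves of the equilibrium condition at time 0: no deviation gains
    from tying with the initial mass, and the tie is fair if there is one. *)
Lemma tie_at_0 : g x * (1 - p1 * G0 / 2) <= (1 - p1) * V x /\
  (0 < G0 -> g x * (1 - p1 * G0 / 2) = (1 - p1) * V x).
Proof.
rewrite /Gamma_star0; case: eqVneq => [g0|gn0].
  by rewrite g0 mul0r ltxx; split => //; rewrite mulr_ge0 ?(ltW V0)// subr_ge0 ltW.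
have g0 : 0 < g x by rewrite lt_neqAle eq_sym gn0 (pf_ge0 hg).
case: (leP 0 (1 - (1 - p1) * V x / g x)) => [h|h].
  have -> : g x * (1 - p1 * (2 / p1 * (1 - (1 - p1) * V x / g x)) / 2) = (1 - p1) * V x.
    by field; rewrite gn0 gt_eqF.
  by [].
rewrite mulr0 mulr0 mul0r subr0 mulr1 ltxx; split => //.
by move: h; rewrite subr_lt0 ltr_pdivlMr// mul1r => /ltW.
Qed.

Lemma Gamma_star0_lt1 : G0 < 1.
Proof.
rewrite /Gamma_star0; case: eqVneq => [//|gn0].
have g0 : 0 < g x by rewrite lt_neqAle eq_sym gn0 (pf_ge0 hg).
case: (leP 0 (1 - (1 - p1) * V x / g x)) => _; last by rewrite mulr0.
have a : 1 - p1 / 2 < (1 - p1) * V x / g x by rewrite ltr_pdivlMr.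
rewrite mulrAC ltr_pdivrMr//; lra.
Qed.

Let D_gt0 : 0 < 1 - p1 * G0.
Proof.
by rewrite subr_gt0 mulr_ilt1 ?(ltW p1_gt0)//; [exact: Gamma_star0_ge0|exact: Gamma_star0_lt1].
Qed.

Lemma q1_gt0 : 0 < q.
Proof. by rewrite /q1 divr_gt0// mulr_gt0// subr_gt0 Gamma_star0_lt1. Qed.

Lemma q1_compl : 1 - q = (1 - p1) / (1 - p1 * G0).
Proof. by rewrite /q1; field; exact: lt0r_neq0. Qed.

Lemma q1_lt1 : q < 1.
Proof. by rewrite -subr_gt0 q1_compl divr_gt0// subr_gt0. Qed.

Lemma q1_le_b : q <= b x.
Proof.
rewrite (bE hX hreg hg hV) lerBrDr -lerBrDl q1_compl ler_pdivrMr// mulrAC ler_pdivlMr//.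
have [t1 t2] := tie_at_0; have := Gamma_star0_ge0; rewrite le_eqVlt => /orP[/eqP G00|G00].
  by move: t1; rewrite -G00 mulr0 mul0r subr0 mulr1.
have gG : 0 <= g x * (p1 * G0) by rewrite !mulr_ge0 ?(pf_ge0 hg) ?ltW.
have := t2 G00; lra.
Qed.

Lemma Z_runningE t w : Z t w = Num.min q (running_min (fun s => b (X s w)) t).
Proof. by []. Qed.

Let cbX w : {within `[0, +oo[, continuous (fun s => b (X s w))}.
Proof.
apply/subspace_continuousP => s s0.
have /subspace_continuousP/(_ s s0) cXs := @cX w.
by apply: continuous_cvg cXs; exact: (continuous_b hX hreg hg hV).
Qed.

Lemma Z_ge0 t w : 0 <= Z t w.
Proof.
rewrite Z_runningE le_min (ltW q1_gt0)/=.
have [t0|t0] := leP 0 t.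
  by have [c [_ _ -> _]] := running_min_attained (@cbX w) t0; exact: (b_ge0 hX hreg hg hV).
rewrite /running_min (_ : [set _ | _ in _] = set0) ?inf0//.
apply/seteqP; split => // y [s /=]; rewrite in_itv/= => /andP[s0 st].
by move: (le_trans s0 st); rewrite leNgt t0.
Qed.

Lemma Z_le_q t w : Z t w <= q. Proof. by rewrite ge_min lexx. Qed.

Lemma Z_lt1 t w : Z t w < 1. Proof. exact: le_lt_trans (Z_le_q t w) q1_lt1. Qed.

Lemma Z_le_b t w : 0 <= t -> Z t w <= b (X t w).
Proof.
by move=> t0; rewrite Z_runningE ge_min (running_min_le (@cbX w) t0 (lexx t)) orbT.
Qed.

Lemma Z_nonincreasing s t w : 0 <= s -> s <= t -> Z t w <= Z s w.
Proof.
move=> s0 st; rewrite !Z_runningE le_min !ge_min lexx/=.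
by rewrite (running_min_nonincreasing (@cbX w) s0 st) orbT.
Qed.

Lemma Z_start w : X 0 w = x -> Z 0 w = q.
Proof.
move=> Xx; rewrite Z_runningE min_l//.
have [c [c0 c1 -> _]] := running_min_attained (@cbX w) (lexx 0).
by have -> : c = 0 by [lra]; rewrite Xx; exact: q1_le_b.
Qed.

Lemma Z_continuous w : {within `[0, +oo[, continuous (Z ^~ w)}.
Proof.
apply/subspace_continuousP => t; rewrite /= in_itv/= andbT => t0.
apply/cvgrPdist_le => /= e e0.
have [h h0 hP] := running_min_continuous (@cbX w) t0 e0.
exists h => //= s; rewrite /= => sh; rewrite in_itv/= andbT => s0.
rewrite distrC in sh; apply: le_trans (hP s s0 sh).
rewrite /from_subspace !Z_runningE distrC; set u := running_min _ s; set v := running_min _ t.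
have := ler_norm (u - v); have := ler_norm (v - u); rewrite (distrC v u) => uv vu.
by rewrite ler_norml; case: (leP q u) => ?; case: (leP q v) => ?; apply/andP; split; lra.
Qed.

(** As long as b stays above Z, no mass is added. *)
Lemma Z_locally_constant t w : 0 <= t -> Z t w < b (X t w) ->
  exists2 h, 0 < h & forall s, 0 <= s -> `|t - s| < h -> Z s w = Z t w.
Proof.
move=> t0 Zb.
have e0 : 0 < b (X t w) - Z t w by rewrite subr_gt0.
have /subspace_continuousP/(_ t) := @cbX w; rewrite /= in_itv/= t0 => /(_ isT).
move=> /cvgrPdist_lt/(_ _ e0)[h /= h0 hP]; exists h => // s s0 sth.
have b_gt c : 0 <= c -> `|t - c| < h -> Z t w < b (X c w).
  move=> c0 cth; have := hP c cth; rewrite in_itv/= c0 /from_subspace => /(_ isT).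
  by rewrite ltr_norml => /andP[_]; lra.
have Zle u c : 0 <= c -> c <= u -> Z u w <= b (X c w).
  by move=> c0 cu; rewrite Z_runningE ge_min (running_min_le (@cbX w) c0 cu) orbT.
apply/eqP; rewrite eq_le; have [st|ts] := leP s t.
  rewrite (Z_nonincreasing w s0 st) andbT.
  have [c [c0 ct cE _]] := running_min_attained (@cbX w) t0.
  rewrite [Z t w]Z_runningE le_min Z_le_q cE/=; have [cs|sc] := leP c s; first exact: Zle.
  have cth : `|t - c| < h by move: sth; rewrite !ger0_norm; lra.
  have := b_gt c c0 cth; rewrite [Z t w]Z_runningE gt_min cE ltxx orbF => qb.
  exact: le_trans (Z_le_q s w) (ltW qb).
rewrite (Z_nonincreasing w t0 (ltW ts))/=.
have [c [c0 cs cE _]] := running_min_attained (@cbX w) s0.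
rewrite [Z s w]Z_runningE le_min Z_le_q cE/=; have [ct|tc] := leP c t; first exact: Zle.
by apply/ltW/b_gt => //; move: sth; rewrite !ltr0_norm; lra.
Qed.

(** The running minimum of b reaches 0 when b does, and b vanishes where the
    value equals the payoff. *)
Lemma Z_tauV t w : 0 <= t -> (Z t w <= 0) = (tauV w <= t%:E)%E.
Proof.
move=> t0; apply/idP/idP => [Z0|].
  have [c [c0 ct cE _]] := running_min_attained (@cbX w) t0.
  have b0 : b (X c w) = 0.
    apply/eqP; rewrite eq_le (b_ge0 hX hreg hg hV) andbT.
    by move: Z0; rewrite Z_runningE ge_min cE leNgt q1_gt0.
  apply: (@le_trans _ _ c%:E); last by rewrite lee_fin.
  apply: ereal_inf_lbound; exists c => //; split => //.
  by apply/eqP; rewrite -(b_eq0 hX hreg hg hV) b0.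
move=> tV; rewrite leNgt; apply/negP => Z0.
have /subspace_continuousP/(_ t) := @Z_continuous w; rewrite /= in_itv/= t0 => /(_ isT).
move=> /cvgrPdist_lt/(_ _ Z0)[h /= h0 hP].
suff : ((t + h / 2)%:E <= tauV w)%E.
  by move/le_trans/(_ tV); rewrite lee_fin; lra.
apply: le_ereal_inf_tmp => y [s [s0 Vs]] <-; rewrite lee_fin leNgt; apply/negP => sth.
have bs : b (X s w) = 0 by apply/eqP; rewrite (b_eq0 hX hreg hg hV) Vs.
have Zs : Z s w = 0 by apply/eqP; rewrite eq_le Z_ge0 andbT -bs Z_le_b.
have [st|ts] := leP s t.
  by have := Z_nonincreasing w s0 st; rewrite Zs leNgt Z0.
have := hP s; rewrite /= in_itv/= s0 /from_subspace Zs subr0 => /(_ _ isT) H'.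
have : `|Z t w| < Z t w by apply: H'; rewrite ltr0_norm; lra.
by rewrite ger0_norm ?ltxx// ltW.
Qed.

(** By continuity the running minimum is decided by rational times. *)
Lemma measurable_Z t : 0 <= t -> measurable_fun setT (Z t : FT t -> R).
Proof.
move=> t0; apply: measurable_minr; first exact: measurable_cst.
apply: (@measurability _ _ (FT t) R setT _ _ (RGenInftyO.measurableE R)) => _ [_ [a ->] <-]; rewrite setTI.
pose s_ k m : R := k%:R / m.+1%:R.
have s0 k m : 0 <= s_ k m by rewrite divr_ge0.
rewrite (_ : _ @^-1` _ = \bigcup_k \bigcup_m
    (if s_ k m <= t then [set w | b (X (s_ k m) w) < a] else set0)).
  apply: bigcup_measurable => k _; apply: bigcup_measurable => m _.
  case: ifP => // st.
  rewrite (_ : [set w | _] = (fun w => b (X (s_ k m) w)) @^-1` `]-oo, a[); last first.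
    by apply/seteqP; split => w /=; rewrite in_itv.
  rewrite -[X in measurable X]setTI.
  apply: (@measurableT_comp _ _ _ _ borel _ b) => //.
    by apply: continuous_borel_measurable; exact: (continuous_b hX hreg hg hV).
  exact: measurable_FT_X.
apply/seteqP; split => w /=; rewrite in_itv/=.
  have [c [c0 ct cE _]] := running_min_attained (@cbX w) t0.
  rewrite -/(running_min (fun s => b (X s w)) t) cE => bca.
  have cb : b (X ((Num.truncn (c * n.+1%:R))%:R / n.+1%:R) w) @[n --> \oo] --> b (X c w).
    apply: continuous_cvg; first exact: (continuous_b hX hreg hg hV).
    by apply: (path_cvg (@cX)) => //; exact: floor_grid_cvg.
  have [n _ nP] : \forall n \near \oo, b (X (s_ (Num.truncn (c * n.+1%:R)) n) w) < a.
    by apply: (cb [set u | u < a]); apply: open_nbhs_nbhs; split => //; exact: open_lt.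
  exists (Num.truncn (c * n.+1%:R)) => //; exists n => //.
  rewrite ifT; first exact: (nP n (leqnn n)).
  apply: le_trans ct; rewrite ler_pdivrMr//.
  by have /Num.Theory.truncn_itv/andP[] : 0 <= c * n.+1%:R by rewrite mulr_ge0.
move=> [k _ [m _]]; case: ifP => // st /=; apply: le_lt_trans.
exact: (running_min_le (@cbX w) (s0 k m) st).
Qed.

(** The conditional probability of still facing a competitor at time t is Z_t:
    this identity is Bayes' rule. *)
Lemma Gamma2_compl t w : 1 - p1 * Gamma2 t w = (1 - p1) / (1 - Z t w).
Proof.
have Z1 : 1 - Z t w != 0 by rewrite subr_eq0 eq_sym lt_eqF// Z_lt1.
have qn0 : q != 0 by rewrite gt_eqF// q1_gt0.
rewrite /Gamma2_star /Gamma_px.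
have -> : 1 - p1 * (G0 + (1 - G0) * ((q - Z t w) / (q * (1 - Z t w)))) =
    (1 - p1 * G0) - (p1 * (1 - G0) / q) * (q - Z t w) / (1 - Z t w).
  by field; rewrite ?qn0 ?Z1.
have -> : p1 * (1 - G0) / q = 1 - p1 * G0.
  rewrite [in LHS]/q1 invf_div mulrCA divff ?mulr1//.
  by rewrite mulf_neq0// ?gt_eqF// subr_gt0 Gamma_star0_lt1.
have -> : 1 - p1 = (1 - p1 * G0) * (1 - q).
  by rewrite q1_compl mulrC divfK// gt_eqF.
by field.
Qed.

(** Thus Gamma2 is a decreasing function of Z, from which all its properties follow. *)
Lemma Gamma2E t w : Gamma2 t w = (1 - (1 - p1) / (1 - Z t w)) / p1.
Proof. by rewrite -Gamma2_compl; field; rewrite gt_eqF. Qed.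

Lemma Gamma2_le s t w : (Gamma2 s w <= Gamma2 t w) = (Z t w <= Z s w).
Proof.
rewrite !Gamma2E ler_pM2r ?invr_gt0// lerD2l lerN2 ler_pM2l ?subr_gt0//.
by rewrite lef_pV2 ?posrE ?subr_gt0 ?Z_lt1// lerD2l lerN2.
Qed.

Lemma Gamma2_le1 t w : Gamma2 t w <= 1.
Proof.
rewrite Gamma2E ler_pdivrMr// mul1r lerBlDr -lerBlDl ler_pdivlMr ?subr_gt0 ?Z_lt1//.
by rewrite ler_piMr ?subr_ge0 ?(ltW p1_lt1)// lerBlDr lerDl Z_ge0.
Qed.

Lemma Gamma2_eq1 t w : (1 <= Gamma2 t w) = (Z t w <= 0).
Proof.
rewrite Gamma2E ler_pdivlMr// mul1r lerBrDr -lerBrDl ler_pdivrMr ?subr_gt0 ?Z_lt1//.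
by rewrite ler_pMr ?subr_gt0//; apply/idP/idP => ?; lra.
Qed.

Lemma Gamma2_start w : X 0 w = x -> Gamma2 0 w = G0.
Proof.
move=> /Z_start Zq; rewrite Gamma2E Zq q1_compl.
by field; rewrite !gt_eqF// subr_gt0.
Qed.

Lemma Gamma2_ge0 t w : 0 <= Gamma2 t w.
Proof.
apply: le_trans Gamma_star0_ge0 _; rewrite /Gamma2_star lerDl mulr_ge0//.
  by rewrite subr_ge0 ltW// Gamma_star0_lt1.
rewrite divr_ge0 ?subr_ge0 ?Z_le_q// mulr_ge0 ?(ltW q1_gt0)// subr_ge0 ltW//.
exact: Z_lt1.
Qed.

Lemma Gamma2_nondecreasing s t w : 0 <= s -> s <= t -> Gamma2 s w <= Gamma2 t w.
Proof. by move=> s0 st; rewrite Gamma2_le Z_nonincreasing. Qed.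

Lemma Gamma2_continuous w : {within `[0, +oo[, continuous (Gamma2 ^~ w)}.
Proof.
have -> : Gamma2 ^~ w = fun t => (1 - (1 - p1) / (1 - Z t w)) / p1.
  by apply/funext => t; exact: Gamma2E.
move=> t; apply: cvgMl; apply: cvgB; first exact: cvg_cst.
apply: cvgMr; apply: cvgV; first by rewrite subr_eq0 eq_sym lt_eqF// Z_lt1.
by apply: cvgB; [exact: cvg_cst|exact: Z_continuous].
Qed.

Lemma Gamma2_cvg_right w t : 0 <= t -> Gamma2 u w @[u --> t^'+] --> Gamma2 t w.
Proof.
move=> t0; have /subspace_continuousP/(_ t) := @Gamma2_continuous w.
rewrite /= in_itv/= t0 => /(_ isT) cG A /cG[e /= e0 eA]; exists e => //= s sh ts.
by apply: eA => //; rewrite /= in_itv/= andbT; lra.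
Qed.

Lemma Gamma1E t w : 0 <= t -> Gamma1 t w = if 0 < Z t w then p1 / p2 * Gamma2 t w else 1.
Proof. by move=> t0; rewrite /Gamma1_star ltNge -Z_tauV// -ltNge. Qed.

Let p2_gt0 : 0 < p2. Proof. exact: lt_le_trans p1_gt0 p12. Qed.

Let c0 : 0 <= p1 / p2. Proof. by rewrite divr_ge0// ltW. Qed.
Let c1 : p1 / p2 <= 1. Proof. by rewrite ler_pdivrMr// mul1r. Qed.

Lemma scaled_Gamma2_le1 t w : p1 / p2 * Gamma2 t w <= 1.
Proof. by rewrite mulr_ile1// ?Gamma2_ge0// Gamma2_le1. Qed.

Lemma Gamma1_ge t w : 0 <= t -> p1 / p2 * Gamma2 t w <= Gamma1 t w.
Proof. by move=> t0; rewrite Gamma1E//; case: ifP => // _; exact: scaled_Gamma2_le1. Qed.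

Lemma measurable_Gamma2 t : 0 <= t -> measurable_fun setT (Gamma2 t : FT t -> R).
Proof.
move=> t0; pose f z := (1 - (1 - p1) / (1 - Num.min z q)) / p1.
have q1 := q1_lt1.
apply: (@eq_measurable_fun _ _ (FT t) R setT (f \o Z t)); first by move=> w _; rewrite Gamma2E /f /= min_l// Z_le_q.
apply: (@measurableT_comp _ _ _ (FT t) R R f); last exact: measurable_Z.
apply: nonincreasing_measurable => // u v uv.
have mle : Num.min u q <= Num.min v q by rewrite le_min !ge_min uv lexx orbT.
have mlt z : Num.min z q < 1 by rewrite gt_min q1 orbT.
rewrite /f ler_pM2r ?invr_gt0// lerD2l lerN2 ler_pM2l ?subr_gt0//.
by rewrite lef_pV2 ?posrE ?subr_gt0// lerD2l lerN2.
Qed.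

Lemma Gamma2_generating : generating_process P X Gamma2.
Proof.
split => [t C t0 mC|w t t0|w|w s t s0 st|w t t0].
- by rewrite -FTE -[X in measurable X]setTI; exact: measurable_Gamma2.
- exact: Gamma2_cvg_right.
- exact: Gamma2_ge0.
- exact: Gamma2_nondecreasing.
- exact: Gamma2_le1.
Qed.

(** Right-continuity survives the jump to 1 at tauV because Z is continuous and
    stays at 0 afterwards. *)
Lemma Gamma1_generating : generating_process P X Gamma1.
Proof.
split => [t C t0 mC|w t t0|w|w s t s0 st|w t t0].
- rewrite -FTE -[X in measurable X]setTI.
  have : measurable_fun setT (Gamma1 t : FT t -> R); last exact.
  apply: (@eq_measurable_fun _ _ (FT t) R setT (fun w => if 0 < Z t w then p1 / p2 * Gamma2 t w else 1)).
    by move=> w _; rewrite Gamma1E.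
  apply: measurable_fun_ifT => //.
    by apply: measurable_fun_ltr => //; exact: measurable_Z.
  by apply: measurable_funM => //; exact: measurable_Gamma2.
- rewrite Gamma1E//; case: ifPn => Zt.
    have /subspace_continuousP/(_ t) := @Z_continuous w; rewrite /= in_itv/= t0 => /(_ isT).
    move=> /cvgrPdist_lt/(_ _ Zt)[h /= h0 hP].
    have : p1 / p2 * Gamma2 u w @[u --> t^'+] --> p1 / p2 * Gamma2 t w.
      by apply: cvgMr; exact: Gamma2_cvg_right.
    apply: cvg_trans; apply: near_eq_cvg; exists h => //= s sh ts.
    have s0 : 0 <= s by lra.
    rewrite Gamma1E// ifT//; have := hP s sh; rewrite /= in_itv/= s0 /from_subspace => /(_ isT).
    by rewrite ltr_norml => /andP[_]; lra.
  have Z0 : Z t w <= 0 by rewrite leNgt.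
  apply: (@cvg_trans _ (cst 1 @ t^'+)); last exact: cvg_cst.
  apply: near_eq_cvg; exists 1 => //= s _ ts; have s0 : 0 <= s by lra.
  rewrite Gamma1E// ifF//; apply/negbTE; rewrite -leNgt; apply: le_trans Z0.
  by apply: Z_nonincreasing => //; exact: ltW.
- apply: le_trans (Gamma1_ge w (lexx 0)); rewrite mulr_ge0//; exact: Gamma2_ge0.
- have t0 := le_trans s0 st; rewrite !Gamma1E//; case: ifPn => Zs; case: ifPn => Zt //.
  + by rewrite ler_wpM2l// Gamma2_nondecreasing.
  + exact: scaled_Gamma2_le1.
  + have := Z_nonincreasing w s0 st; lra.
- by rewrite Gamma1E//; case: ifP => // _; exact: scaled_Gamma2_le1.
Qed.

End Strategies.

(** * Independent randomisation *)

Section Independence.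
Local Open Scope ereal_scope.
Context {d0 d1 d2 : measure_display} {T0 : measurableType d0} {T1 : measurableType d1}
  {T2 : measurableType d2} {R : realType}.
Variable Q : probability T0 R.
Variables (xi : T0 -> T1) (zeta : T0 -> T2).
Hypotheses (mxi : measurable_fun setT xi) (mzeta : measurable_fun setT zeta).

Let mpre (E : set (T1 * T2)) : measurable E -> measurable [set w | E (xi w, zeta w)].
Proof.
move=> mE; have := measurable_fun_pair mxi mzeta => /(_ measurableT E mE).
by rewrite setTI.
Qed.

(** The sets on which the product rule holds form a lambda-system, and the
    rectangles generate the product sigma-algebra. *)
Lemma independent_pair (D : set T0) (c : \bar R) : measurable D ->
  (forall A B, measurable A -> measurable B ->
    Q ([set w | A (xi w) /\ B (zeta w)] `&` D) = Q [set w | A (xi w) /\ B (zeta w)] * c) ->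
  forall E : set (T1 * T2), measurable E ->
    Q ([set w | E (xi w, zeta w)] `&` D) = Q [set w | E (xi w, zeta w)] * c.
Proof.
move=> mD rect E; rewrite measurable_prod_measurableType => sE.
have cE : Q D = c.
  have := rect setT setT measurableT measurableT.
  rewrite (_ : [set w | _] = setT) ?setTI; last by apply/seteqP.
  by move=> ->; rewrite [X in X * _](_ : _ = 1) ?mul1e//; exact: probability_setT.
have cfin : c \is a fin_num by rewrite -cE fin_num_measure.
move: E sE; apply: (@dynkin_induction _ (T1 * T2)%type _
    (fun E => Q ([set w | E (xi w, zeta w)] `&` D) = Q [set w | E (xi w, zeta w)] * c)).
- exact: measurable_prod_measurableType.
- move=> _ _ [A mA [B mB <-]] [A' mA' [B' mB' <-]].
  exists (A `&` A'); first exact: measurableI.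
  by exists (B `&` B'); [exact: measurableI|rewrite setXI].
- rewrite setTI cE [X in X * _](_ : _ = 1) ?mul1e//; exact: probability_setT.
- by move=> _ [A mA [B mB <-]]; exact: rect.
- move=> E mE ih; have mE' := mpre mE.
  have -> : [set w | (~` E) (xi w, zeta w)] = ~` [set w | E (xi w, zeta w)] by [].
  have compl : Q (~` [set w | E (xi w, zeta w)] `&` D) = Q D - Q ([set w | E (xi w, zeta w)] `&` D).
    have -> : ~` [set w | E (xi w, zeta w)] `&` D = D `\` [set w | E (xi w, zeta w)].
      by rewrite setIC.
    rewrite measureD//; first by congr (_ - Q _); exact: setIC.
    by rewrite -ge0_fin_numE// fin_num_measure.
  rewrite compl ih cE probability_setC// muleBl ?mul1e// ?fin_num_adde_defl//.
- move=> E_ mE tE ih.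
  have mE' n := mpre (mE n).
  have tE' : trivIset setT (fun n => [set w | E_ n (xi w, zeta w)]).
    by move=> i j _ _ [w [wi wj]]; apply: tE => //; exists (xi w, zeta w).
  have -> : [set w | (\bigcup_k E_ k) (xi w, zeta w)] = \bigcup_k [set w | E_ k (xi w, zeta w)].
    by apply/seteqP; split => w.
  rewrite setI_bigcupl measure_bigcup//; last 2 first.
  - by move=> n _; exact: measurableI.
  - by move=> i j _ _ [w [[wi _] [wj _]]]; apply: tE' => //; exists w.
  rewrite [X in _ = X * _]measure_bigcup// -(fineK cfin) muleC -nneseriesZl//.
  by apply: eq_eseriesr => n _; rewrite /= fineK// muleC; exact: ih.
Qed.

(** The joint law is the product of the laws, to which Fubini's theorem applies. *)
Lemma integrate_out (m2 : probability T2 R) :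
  (forall A B, measurable A -> measurable B ->
    Q [set w | A (xi w) /\ B (zeta w)] = Q [set w | A (xi w)] * m2 B) ->
  forall f : T1 * T2 -> \bar R, measurable_fun setT f -> (forall z, 0 <= f z) ->
  [/\ \int[Q]_w f (xi w, zeta w) = \int[Q]_w \int[m2]_y f (xi w, y),
      \int[Q]_w f (xi w, zeta w) = \int[m2]_y \int[Q]_w f (xi w, y) &
      measurable_fun setT (fun y => \int[Q]_w f (xi w, y))].
Proof.
move=> rect f mf f0.
pose X1 : {mfun T0 >-> T1} := HB.pack xi (isMeasurableFun.Build _ _ _ _ _ mxi).
pose X12 : {mfun T0 >-> (T1 * T2)%type} := HB.pack (fun w => (xi w, zeta w))
  (isMeasurableFun.Build _ _ _ _ _ (measurable_fun_pair mxi mzeta)).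
have joint : \int[Q]_w f (xi w, zeta w) = \int[distribution Q X1 \x m2]_z f z.
  rewrite (_ : \int[Q]_w f (xi w, zeta w) = \int[distribution Q X12]_z f z).
    apply: eq_measure_integral => E mE _; apply/esym.
    by apply: product_measure_unique => // A B mA mB; exact: rect.
  by rewrite ge0_integral_distribution.
have sec y : \int[distribution Q X1]_z f (z, y) = \int[Q]_w f (xi w, y).
  rewrite (ge0_integral_distribution X1 (f := fun x => f (x, y)))//.
  exact: measurable_fun_pair1.
split.
- rewrite joint fubini_tonelli1// ge0_integral_distribution//.
    exact: measurable_fun_fubini_tonelli_F.
  by move=> z; exact: integral_ge0.
- by rewrite joint fubini_tonelli2//; apply: eq_integral => y _; exact: sec.
- have := @measurable_fun_fubini_tonelli_G _ _ _ _ _ (distribution Q X1) f mf f0.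
  by apply: eq_measurable_fun => y _; exact: sec.
Qed.

End Independence.

Section PathSigmaAlgebra.
Local Open Scope ereal_scope.
Context {R : realType} {d : nat} {disp : measure_display} {Omega : measurableType disp}.
Variables (P : 'rV[R]_d -> probability Omega R) (X : R -> Omega -> 'rV[R]_d).
Hypothesis mX : forall t, (0 <= t)%R -> measurable_fun setT (X t : Omega -> borelRV R d).

(** Adapted processes are measurable for the sigma-algebra that this generates,
    at all times at once. *)
Definition path_null_sets := path_events X `[0%R, +oo[ `|` null_sets P.
Notation OmegaX := (g_sigma_algebraType path_null_sets).

Lemma filtration_OmegaX t (A : set Omega) : filtrationX P X t A -> measurable (A : set OmegaX).
Proof.
move=> /(_ (t + 1)%R); rewrite /= in_itv/= andbT ltrDl => /(_ ltr01).
apply: sub_sigma_algebra2 => B [[s [C [s0 mC ->]]]|nB]; last by right.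
left; exists s, C; split => //.
by move: s0; rewrite /= !in_itv/= andbT => /andP[].
Qed.

Lemma measurable_OmegaX (A : set Omega) : measurable (A : set OmegaX) -> measurable A.
Proof.
apply: smallest_sub; first exact: sigma_algebra_measurable.
move=> B [[s [C [s0 mC ->]]]|[]//].
rewrite -[X in measurable X]setTI; apply: mX => //.
by move: s0; rewrite /= in_itv/= andbT.
Qed.

(** Null events do not matter for probabilities, so an event of the augmented
    sigma-algebra can be replaced by one of the path alone. *)
Lemma OmegaX_sigmaX x (A : set Omega) : measurable (A : set OmegaX) ->
  exists2 B, sigmaX X B & forall E, measurable E -> P x (A `&` E) = P x (B `&` E).
Proof.
move=> mA.
suff [B [N [sB mN N0 AB BA]]] : exists B N,
    [/\ sigmaX X B, measurable N, P x N = 0, A `<=` B `|` N & B `<=` A `|` N].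
  have mB : measurable B.
    move: sB; apply: smallest_sub; first exact: sigma_algebra_measurable.
    move=> C [s [C' [s0 mC ->]]].
    rewrite -[X in measurable X]setTI; apply: mX => //.
    by move: s0; rewrite /= in_itv/= andbT.
  exists B => // E mE; have mA' := measurable_OmegaX mA.
  have le C C' : measurable C -> measurable C' -> C `<=` C' `|` N ->
      P x (C `&` E) <= P x (C' `&` E).
    move=> mC mC' CC'; apply: (@le_trans _ _ (P x ((C' `&` E) `|` N))).
      have mCE := measurableI _ _ mC mE.
      have mCN := measurableU _ _ (measurableI _ _ mC' mE) mN.
      apply: (le_measure (P x) (mem_set mCE) (mem_set mCN)).
      by move=> w [/CC'[Cw|Nw] Ew]; [left|right].
    apply: le_trans (measureU2 _ _ _) _ => //; first exact: measurableI.
    by rewrite [X in _ + X](_ : _ = 0) ?adde0.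
  by apply/eqP; rewrite eq_le !le.
pose C := [set A | exists B N,
    [/\ sigmaX X B, measurable N, P x N = 0, A `<=` B `|` N & B `<=` A `|` N]].
suff: <<s path_null_sets >> `<=` C by apply.
apply: smallest_sub; last first.
  move=> D [pD|[mD D0]].
    exists D, set0; split; [exact: sub_sigma_algebra|exact: measurable0|exact: measure0| |];
      by rewrite setU0.
  by exists set0, D; split; [exact: sigma_algebra0|by []|exact: D0|exact: subsetUr|exact: sub0set].
split.
- by exists set0, set0; split; [exact: sigma_algebra0|by []|exact: measure0|exact: sub0set|exact: sub0set].
- move=> D [B [N [sB mN N0 AB BA]]]; exists (~` B), N; split => //.
  + by rewrite -setTD; exact: sigma_algebraCD.
  + move=> w [_ Dw]; have [Bw|] := pselect (B w); last by left.
    by have [] := BA w Bw => // ?; right.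
  + move=> w Bw; have [Dw|Dw] := pselect (D w); last by left.
    by have [] := AB w Dw => // ?; right.
- move=> D_ CD; have [B_ /choice[N_ BN]] := choice CD.
  exists (\bigcup_n B_ n), (\bigcup_n N_ n); split.
  + by apply: sigma_algebra_bigcup => n; have [] := BN n.
  + by apply: bigcup_measurable => n _; have [] := BN n.
  + apply/negligibleP.
      by apply: bigcup_measurable => n _; have [] := BN n.
    apply: negligible_bigcup => n; have [_ mN N0 _ _] := BN n.
    exact/negligibleP.
  + move=> w [n _ Dw]; have [_ _ _ AB _] := BN n.
    by have [|] := AB w Dw => ?; [left|right]; exists n.
  + move=> w [n _ Dw]; have [_ _ _ _ BA] := BN n.
    by have [|] := BA w Dw => ?; [left|right]; exists n.
Qed.

End PathSigmaAlgebra.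

(** * Times generated by a process and a randomisation level *)

Section UniformTails.
Context {R : realType}.
Notation unif := (uniform_prob (@ltr01 R)).

(** The tail function is all that the computation of payoffs needs to know of the
    uniform law. *)
Lemma uniform_tail (a : R) (c : bool) : 0 <= a <= 1 ->
  unif [set` Interval (BSide c a) +oo%O] = (1 - a)%:E.
Proof.
move=> /andP[a0 a1]; rewrite /uniform_prob integral_uniform_pdf.
have -> : [set` Interval (BSide c a) +oo%O] `&` `[0, 1] = [set` Interval (BSide c a) (BRight 1)].
  apply/seteqP; split => u /=; rewrite !in_itv/= andbT.
    by move=> [-> /andP[_ ->]].
  by case: c => /= /andP[au ->]; split => //; rewrite andbT; lra.
rewrite (eq_integral (cst 1%:E)).
  rewrite integral_cst// mul1e [LHS]lebesgue_measure_itv/= lte_fin.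
  by case: (ltP a 1) => [_|a1']; rewrite -?EFinB//; congr EFin; lra.
move=> u /set_mem; rewrite /= in_itv/= /uniform_pdf => au.
rewrite ifT ?subr0 ?invr1//; move: au; case: c => /= /andP[au ->]; rewrite andbT; lra.
Qed.

End UniformTails.

Section GeneratedTimes.
Context {R : realType} {d : nat} {disp : measure_display} {Omega : measurableType disp}.
Variables (P : 'rV[R]_d -> probability Omega R) (X : R -> Omega -> 'rV[R]_d).
Variable Gamma : R -> Omega -> R.
Hypothesis hGamma : generating_process P X Gamma.

Notation gen u w := (generated_time Gamma (fun=> u) w).
Notation OmegaX := (g_sigma_algebraType (path_null_sets P X)).

Lemma gen_ge0 u w : (0 <= gen u w)%E.
Proof. by apply: le_ereal_inf_tmp => _ [t [t0 _] <-]; rewrite lee_fin. Qed.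

Lemma gen_le u w t : 0 <= t -> u < Gamma t w -> (gen u w <= t%:E)%E.
Proof. by move=> t0 uG; apply: ereal_inf_lbound; exists t. Qed.

Lemma gen_lt u w t : (gen u w < t%:E)%E -> exists s, [/\ 0 <= s, s < t & u < Gamma s w].
Proof.
by move=> /ereal_inf_lt[_ [s [s0 us] <-]]; rewrite lte_fin => st; exists s.
Qed.

Lemma Gamma_before_gen u w s : 0 <= s -> (s%:E < gen u w)%E -> Gamma s w <= u.
Proof. by move=> s0; rewrite leNgt; apply: contraTN => us; rewrite -leNgt gen_le. Qed.

(** Right-continuity of [Gamma] is what makes the level reached at the
    generated time. *)
Lemma gen_le_Gamma u w t : 0 <= t -> (gen u w <= t%:E)%E -> u <= Gamma t w.
Proof.
move=> t0 gt; rewrite leNgt; apply/negP => Gu.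
have e0 : 0 < u - Gamma t w by rewrite subr_gt0.
have /cvgrPdist_lt/(_ _ e0)[h /= h0 hP] := @gp_right_continuous _ _ _ _ _ _ _ hGamma w t t0.
have : (gen u w < (t + h)%:E)%E by apply: le_lt_trans gt _; rewrite lte_fin; lra.
move=> /gen_lt[s [s0 sth us]].
have [st|ts] := leP s t; first by have := gp_nondecreasing hGamma w s0 st; lra.
have := hP s; rewrite /= ltr0_norm; last lra.
by move=> /(_ _ ts); rewrite ltr_norml => H; have /andP[] := H ltac:(lra); lra.
Qed.

(* Nonnegative rationals, enough to see a right-continuous monotone process. *)
Let s_ (k m : nat) : R := k%:R / m.+1%:R.

Let s_ge0 k m : 0 <= s_ k m. Proof. by rewrite divr_ge0. Qed.

(** Joint measurability of the generated time in path and level comes from this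
    countable description. *)
Lemma gen_lt_rational u w a :
  (gen u w < a%:E)%E <-> exists k m, s_ k m < a /\ u < Gamma (s_ k m) w.
Proof.
split => [/gen_lt[t [t0 ta ut]]|[k [m [sa us]]]]; last first.
  by apply: le_lt_trans (gen_le (s_ge0 k m) us) _; rewrite lte_fin.
have [m am] : exists m, m.+1%:R^-1 < a - t by apply: small_invSn; rewrite subr_gt0.
have m0 : 0 < m.+1%:R :> R by [].
have /Num.Theory.truncn_itv/andP[k1 k2] : 0 <= t * m.+1%:R by rewrite mulr_ge0.
exists (Num.truncn (t * m.+1%:R)).+1, m; split.
  rewrite /s_ -natr1 mulrDl mul1r; apply: (@le_lt_trans _ _ (t + m.+1%:R^-1)); last by rewrite -ltrBrDl.
  by rewrite lerD2r ler_pdivrMr.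
apply: (lt_le_trans ut); apply: (gp_nondecreasing hGamma) => //.
by rewrite /s_ ler_pdivlMr// ltW.
Qed.

(** For a fixed level the generated time is a hitting time of an open set, so
    only strict inequalities with deterministic times are decided by the past;
    right-continuity of the filtration turns them into weak ones. *)
Lemma stopping_gen u : stopping_time P X (fun w => gen u w).
Proof.
split => [w|t t0]; first exact: gen_ge0.
apply: filtration_right => e e0.
have lt_F a : a <= t + e -> filtrationX P X (t + e) [set w | (gen u w < a%:E)%E].
  move=> ate; rewrite (_ : [set w | _] = \bigcup_k \bigcup_m
      (if s_ k m < a then [set w | u < Gamma (s_ k m) w] else set0)).
    rewrite -FTE; apply: bigcup_measurable => k _; apply: bigcup_measurable => m _.
    case: ifP => // sa; rewrite FTE.
    apply: (@filtration_mono _ _ _ _ _ _ (s_ k m)); first lra.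
    rewrite (_ : [set w | _] = Gamma (s_ k m) @^-1` `]u, +oo[).
      exact: (gp_adapted hGamma).
    by apply/seteqP; split => w /=; rewrite in_itv/= andbT.
  apply/seteqP; split => w /=.
    by move=> /gen_lt_rational[k [m [sa us]]]; exists k => //; exists m => //; rewrite sa.
  move=> [k _ [m _]]; case: ifP => // sa /= us; apply/gen_lt_rational; by exists k, m.
rewrite (_ : [set w | _] = \bigcap_n [set w | (gen u w < (t + e / n.+1%:R)%:E)%E]).
  rewrite -FTE; apply: bigcapT_measurable => n; rewrite FTE; apply: lt_F.
  by rewrite lerD2l ler_pdivrMr// ler_peMr ?ler1n// ltW.
apply/seteqP; split => w /=.
  by move=> gt n _ /=; apply: le_lt_trans gt _; rewrite lte_fin ltrDl divr_gt0.
move=> gn; apply/lee_addgt0Pr => h h0.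
have [n nh] : exists n, n.+1%:R^-1 < h / e by apply: small_invSn; rewrite divr_gt0.
apply: le_trans (ltW (gn n I)) _; rewrite -EFinD lee_fin lerD2l.
by rewrite mulrC -ler_pdivlMr// ltW.
Qed.

Lemma measurable_gen : measurable_fun setT
  ((fun z => gen z.2 z.1) : (OmegaX * R)%type -> \bar R).
Proof.
apply: (@measurability _ _ (OmegaX * R)%type (\bar R) _ _ _ (ErealGenInftyO.measurableE R)).
move=> _ [_ [a ->] <-]; rewrite setTI.
rewrite (_ : _ @^-1` _ = \bigcup_k \bigcup_m
    (if s_ k m < a then [set z : OmegaX * R | z.2 < Gamma (s_ k m) z.1] else set0)).
  apply: bigcup_measurable => k _; apply: bigcup_measurable => m _; case: ifP => // _.
  have mG : measurable_fun setT (Gamma (s_ k m) : OmegaX -> R).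
    move=> _ C mC; rewrite setTI; apply: filtration_OmegaX.
    by apply: (gp_adapted hGamma) => //.
  have : measurable_fun setT (fun z : OmegaX * R => z.2 < Gamma (s_ k m) z.1).
    apply: measurable_fun_ltr; first exact: measurable_snd.
    by apply: (measurableT_comp mG); exact: measurable_fst.
  move=> /(_ measurableT [set true]); rewrite setTI; exact.
apply/seteqP; split => -[w u] /=; rewrite in_itv/=.
  by move=> /gen_lt_rational[k [m [sa us]]]; exists k => //; exists m => //; rewrite sa.
by move=> [k _ [m _]]; case: ifP => // sa /= us; apply/gen_lt_rational; exists k, m.
Qed.

Lemma measurable_gen_level w : measurable_fun setT (fun u => gen u w).
Proof.
exact: (@measurable_fun_pair2 _ _ _ OmegaX R (\bar R) _ w measurable_gen).
Qed.

Lemma measurable_gen_gt w (t : R) : measurable [set u | (t%:E < gen u w)%E].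
Proof.
rewrite -[X in measurable X]setTI.
by apply: emeasurable_fun_o_infty => //; exact: measurable_gen_level.
Qed.

Lemma measurable_gen_ge w (t : R) : measurable [set u | (t%:E <= gen u w)%E].
Proof.
rewrite -[X in measurable X]setTI.
by apply: emeasurable_fun_c_infty => //; exact: measurable_gen_level.
Qed.

(* The law of the randomisation variable, through its tail function. *)
Variable law : probability R R.
Hypothesis law_tail : forall (a : R) (c : bool), 0 <= a <= 1 ->
  law [set` Interval (BSide c a) +oo%O] = (1 - a)%:E.

Let le_law (A B : set R) : measurable A -> measurable B -> A `<=` B ->
  (law A <= law B)%E.
Proof. by move=> mA mB; exact: (le_measure law (mem_set mA) (mem_set mB)). Qed.

Let Gamma01 t w : 0 <= t -> 0 <= Gamma t w <= 1.
Proof.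
move=> t0; rewrite (gp_le1 hGamma w t0) andbT.
apply: le_trans (gp_jump0 hGamma w) _; exact: (gp_nondecreasing hGamma).
Qed.

Lemma mass_gt w t : 0 <= t -> law [set u | (t%:E < gen u w)%E] = (1 - Gamma t w)%:E.
Proof.
move=> t0; have G01 := Gamma01 w t0.
apply/eqP; rewrite eq_le; apply/andP; split.
  rewrite -(law_tail true G01); apply: le_law => //; first exact: measurable_gen_gt.
  move=> u /=; rewrite in_itv/= andbT leNgt => tg; apply: contraTN tg => uG.
  by rewrite -leNgt gen_le.
rewrite -(law_tail false G01); apply: le_law => //; first exact: measurable_gen_gt.
move=> u /=; rewrite in_itv/= andbT ltNge => uG; rewrite ltNge; apply: contra uG.
exact: gen_le_Gamma.
Qed.

(** The mass of the opponent at or after t lies between 1 - Gamma_{t-} and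
    1 - Gamma_t; left limits are avoided by comparing with earlier times. *)
Lemma mass_ge_upper w s t : 0 <= s -> s < t ->
  (law [set u | (t%:E <= gen u w)%E] <= (1 - Gamma s w)%:E)%E.
Proof.
move=> s0 st; rewrite -(mass_gt w s0); apply: le_law.
- exact: measurable_gen_ge.
- exact: measurable_gen_gt.
- by move=> u /=; apply: lt_le_trans; rewrite lte_fin.
Qed.

Lemma mass_ge_lower w t : 0 <= t ->
  ((1 - Gamma t w)%:E <= law [set u | (t%:E <= gen u w)%E])%E.
Proof.
move=> t0; rewrite -(mass_gt w t0); apply: le_law.
- exact: measurable_gen_gt.
- exact: measurable_gen_ge.
- by move=> u /=; exact: ltW.
Qed.

Lemma mass_ge0 w : law [set u | (0%:E <= gen u w)%E] = 1%E.
Proof.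
rewrite (_ : [set u | _] = setT); first exact: probability_setT.
by apply/seteqP; split => // u _ /=; exact: gen_ge0.
Qed.

End GeneratedTimes.

(** * Payoffs of randomised strategies *)

Section OnePlayer.
Local Open Scope ereal_scope.
Context {R : realType} {d : nat} {disp : measure_display} {Omega : measurableType disp}.
Variables (P : 'rV[R]_d -> probability Omega R) (X : R -> Omega -> 'rV[R]_d).
Variables (r : R) (g : 'rV[R]_d -> R).
Hypothesis hX : strong_markov_process P X.
Hypothesis hg : payoff_function r g.
Variables (x : 'rV[R]_d) (p : R) (theta : Omega -> bool) (U U' : Omega -> R).
Variable law : probability R R.
Hypothesis law_tail : forall (a : R) (c : bool), (0 <= a <= 1)%R ->
  law [set` Interval (BSide c a) +oo%O] = (1 - a)%:E.
Hypothesis p01 : (0 <= p <= 1)%R.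
Hypotheses (mtheta : measurable_fun setT theta) (mU : measurable_fun setT U)
  (mU' : measurable_fun setT U').
Hypothesis indep : forall (A : set Omega) (D : set bool) (C C' : set R),
  sigmaX X A -> measurable C -> measurable C' ->
  P x (A `&` (theta @^-1` D `&` (U @^-1` C `&` U' @^-1` C'))) =
  P x A * (bernoulli_prob p D * (law C * law C')).

Notation OmegaX := (g_sigma_algebraType (path_null_sets P X)).
Notation disc := (discounted X r).
Notation gE := (fun y : 'rV[R]_d => (g y)%:E).
Notation gen Gamma u w := (generated_time Gamma (fun=> u) w).

Let mX t (t0 : (0 <= t)%R) := smp_measurable hX t0.
Let cX w := @smp_continuous _ _ _ _ _ _ hX w.

Let mid : measurable_fun setT (fun w : Omega => w : OmegaX).
Proof. by move=> _ A mA; rewrite setTI; exact: (measurable_OmegaX mX mA). Qed.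

Let lawT : law setT = 1. Proof. exact: probability_setT. Qed.

Let bernT : bernoulli_prob p setT = 1. Proof. exact: probability_setT. Qed.

Let indepX (A : set Omega) D C C' : measurable (A : set OmegaX) ->
  measurable C -> measurable C' ->
  P x (A `&` (theta @^-1` D `&` (U @^-1` C `&` U' @^-1` C'))) =
  P x A * (bernoulli_prob p D * (law C * law C')).
Proof.
move=> mA mC mC'; have [B sB PAB] := OmegaX_sigmaX mX x mA.
have mpre (f : Omega -> R) C0 : measurable_fun setT f -> measurable C0 -> measurable (f @^-1` C0).
  by move=> mf mC0; rewrite -[X in measurable X]setTI; exact: mf.
rewrite PAB; last first.
  apply: measurableI; first by rewrite -[X in measurable X]setTI; exact: mtheta.
  by apply: measurableI; exact: mpre.
by rewrite indep// -[A]setIT -[B]setIT PAB.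
Qed.

Let mpair1 : measurable_fun setT (fun w : Omega => ((w : OmegaX), U w)).
Proof. exact: (measurable_fun_pair mid mU). Qed.

Let mpair2 : measurable_fun setT (fun w : Omega => (((w : OmegaX), U w), U' w)).
Proof. exact: (measurable_fun_pair mpair1 mU'). Qed.

Let indep_U A C : measurable (A : set OmegaX) -> measurable C ->
  P x [set w | A w /\ C (U w)] = P x [set w | A w] * law C.
Proof.
move=> mA mC; have := @indepX A setT C setT mA mC measurableT.
by rewrite !preimage_setT setTI setIT lawT bernT mul1e mule1.
Qed.

Let indep_pair (E : set (OmegaX * R)) D C' : measurable E -> measurable C' ->
  P x ([set w | E (w, U w)] `&` (theta @^-1` D `&` U' @^-1` C')) =
  P x [set w | E (w, U w)] * (bernoulli_prob p D * law C').
Proof.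
move=> mE mC'; apply: (independent_pair mid mU) => //.
  apply: measurableI; first by rewrite -[X in measurable X]setTI; exact: mtheta.
  by rewrite -[X in measurable X]setTI; exact: mU'.
move=> A C mA mC; rewrite indep_U//.
rewrite -muleA [law C * _]muleCA -indepX//; congr (P x _).
by apply/seteqP; split => w /=; tauto.
Qed.

Let indep_U' (E : set (OmegaX * R)) C' : measurable E -> measurable C' ->
  P x [set w | E (w, U w) /\ C' (U' w)] = P x [set w | E (w, U w)] * law C'.
Proof.
move=> mE mC'; have := @indep_pair E setT C' mE mC'.
by rewrite preimage_setT setTI bernT mul1e.
Qed.

Let indep_theta (E : set (OmegaX * R * R)) D : measurable E ->
  P x [set w | E ((w, U w), U' w) /\ D (theta w)] =
  P x [set w | E ((w, U w), U' w)] * bernoulli_prob p D.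
Proof.
move=> mE; apply: (independent_pair (xi := fun w : Omega => (w : OmegaX, U w)) mpair1 mU' _ _ mE).
  by rewrite -[X in measurable X]setTI; exact: mtheta.
move=> E' C' mE' mC'; rewrite indep_U'// -muleA [law C' * _]muleC -indep_pair//.
by congr (P x _); apply/seteqP; split => w /=; tauto.
Qed.

Definition share (t rho : \bar R) : R :=
  if t < rho then 1%R else if t == rho then 2^-1%R else 0%R.

Lemma share_ge0 t rho : (0 <= share t rho)%R.
Proof. by rewrite /share; case: ifP => // _; case: ifP. Qed.

Lemma discounted_rewardE tau rho w :
  (discounted_reward X r g tau rho w)%:E = disc gE tau w * (share (tau w) (rho w))%:E.
Proof.
rewrite /discounted_reward /discounted /share; case: (tau w) => [t||]; rewrite ?mul0e//.
rewrite -!EFinM; congr EFin.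
case: (ltgtP t%:E (rho w)) => H /=; ring.
Qed.

Variables Gamma Gamma' : R -> Omega -> R.
Hypotheses (hGamma : generating_process P X Gamma)
  (hGamma' : generating_process P X Gamma').

Lemma mean_share_theta t rho :
  \int[bernoulli_prob p]_b (share t (if b then rho else +oo%E))%:E =
  (p * share t rho + (1 - p) * share t +oo)%:E.
Proof.
rewrite integral_bernoulli_prob//; last by move=> b; rewrite lee_fin share_ge0.
Qed.

Lemma measurable_share_level w t :
  measurable_fun setT (fun u' => share t (gen Gamma' u' w)).
Proof.
have mg := measurable_gen_level hGamma' w.
apply: measurable_fun_ifT; first by apply: measurable_fun_lte => //; exact: measurable_cst.
  exact: measurable_cst.
apply: measurable_fun_ifT; first by apply: measurable_fun_eqe => //; exact: measurable_cst.
  exact: measurable_cst.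
exact: measurable_cst.
Qed.

(** The competitor is present with probability [p] and then uses an independent
    level; both are averaged out along the path [w]. *)
Definition mean_share w (t : \bar R) :=
  \int[law]_u' \int[bernoulli_prob p]_b
    (share t (if b then gen Gamma' u' w else +oo%E))%:E.

Let T := ((OmegaX * R) * R * bool)%type.

Let tauT (z : T) := gen Gamma z.1.1.2 z.1.1.1.
Let rhoT (z : T) := if z.2 then gen Gamma' z.1.2 z.1.1.1 else +oo.
Let F (z : T) := discounted (fun t (z : T) => X t z.1.1.1) r gE tauT z *
  (share (tauT z) (rhoT z))%:E.

Let mF : measurable_fun setT F.
Proof.
have m1 : measurable_fun setT (fun z : T => z.1.1) by exact: measurableT_comp.
have m2 : measurable_fun setT (fun z : T => (z.1.1.1, z.1.2)).
  by apply: measurable_fun_pair; exact: measurableT_comp.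
have mtau : measurable_fun setT tauT.
  by apply: (measurableT_comp (measurable_gen hGamma)).
have mrho : measurable_fun setT rhoT.
  apply: measurable_fun_ifT; first exact: measurable_snd.
    exact: (measurableT_comp (measurable_gen hGamma') m2).
  exact: measurable_cst.
apply: emeasurable_funM.
  apply: measurable_discounted => //.
  - move=> t t0.
    have mXt : measurable_fun setT (X t : OmegaX -> borelRV R d).
      move=> _ B mB; rewrite setTI; apply: sub_sigma_algebra; left.
      by exists t, B; split => //; rewrite /= in_itv/= t0.
    by apply: (measurableT_comp mXt); exact: measurableT_comp.
  - exact: (measurable_gE hg).
  - by move=> z; exact: gen_ge0.
apply/measurable_EFinP; rewrite /share.
apply: measurable_fun_ifT; first exact: measurable_fun_lte.
  exact: measurable_cst.
apply: measurable_fun_ifT; first exact: measurable_fun_eqe.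
  exact: measurable_cst.
exact: measurable_cst.
Qed.

Let F0 z : 0 <= F z.
Proof.
rewrite mule_ge0 ?lee_fin ?share_ge0//; apply: discounted_ge0; exact: (gE_ge0 hg).
Qed.

(** The conditional expectation of the reward given the path and the own level. *)
Definition conditional_reward w u :=
  disc gE (fun w => gen Gamma u w) w * mean_share w (gen Gamma u w).

Lemma conditional_reward_ge0 w u : 0 <= conditional_reward w u.
Proof.
rewrite mule_ge0//; first by apply: discounted_ge0; exact: (gE_ge0 hg).
by apply: integral_ge0 => u' _; apply: integral_ge0 => b _; rewrite lee_fin share_ge0.
Qed.

Let F1 (z : (OmegaX * R) * R) := \int[bernoulli_prob p]_b F (z, b).
Let F2 (z : OmegaX * R) := \int[law]_u F1 (z, u).

Let F10 z : 0 <= F1 z. Proof. exact: integral_ge0. Qed.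

Let F20 z : 0 <= F2 z. Proof. exact: integral_ge0. Qed.

Let mF1 : measurable_fun setT F1.
Proof. exact: (@measurable_fun_fubini_tonelli_F _ _ _ _ _ (bernoulli_prob p) F mF F0). Qed.

Let mF2 : measurable_fun setT F2.
Proof. exact: (@measurable_fun_fubini_tonelli_F _ _ _ _ _ law F1 mF1 F10). Qed.

Let F2E z : F2 z = conditional_reward z.1 z.2.
Proof.
case: z => w u; rewrite /F2 /F1 /conditional_reward /mean_share /F /tauT /rhoT /=.
set c := discounted _ _ _ _ _.
have -> : c = disc gE (fun w => gen Gamma u w) w by [].
rewrite -stopped_payoffE.
have c0 : (0 <= stopped_payoff X r g (fun w => gen Gamma u w) w)%R.
  by rewrite -lee_fin stopped_payoffE; apply: discounted_ge0; exact: (gE_ge0 hg).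
rewrite -ge0_integralZl_EFin//; first last.
- under eq_fun do rewrite mean_share_theta.
  apply/measurable_EFinP; apply: measurable_funD => //.
  by apply: measurable_funM => //; exact: measurable_share_level.
- by move=> u' _; apply: integral_ge0 => b _; rewrite lee_fin share_ge0.
apply: eq_integral => u' _; rewrite -ge0_integralZl_EFin//; last first.
  by move=> b _; rewrite lee_fin share_ge0.
by apply: eq_integral => b _; rewrite stopped_payoffE.
Qed.

Lemma measurable_conditional_reward u :
  measurable_fun setT (fun w => conditional_reward w u).
Proof.
apply: (eq_measurable_fun (fun w : Omega => F2 (w, u))) => [w _|]; first exact: F2E.
exact: (measurableT_comp (measurable_fun_pair1 u mF2) mid).
Qed.

(** Fubini: the presence of the competitor, his level and the own level are
    integrated out one after the other. *)
Lemma reward_randomised :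
  'E_(P x)[discounted_reward X r g (generated_time Gamma U) (hat theta (generated_time Gamma' U'))] =
  \int[law]_u \int[P x]_w conditional_reward w u /\
  measurable_fun setT (fun u => \int[P x]_w conditional_reward w u).
Proof.
have [_ eF2 mG] := integrate_out mid mU (m2 := law) indep_U mF2 F20.
have FE u : \int[P x]_w F2 (w, u) = \int[P x]_w conditional_reward w u.
  by apply: eq_integral => w _; exact: F2E.
split; last by apply: eq_measurable_fun mG => u _; exact: FE.
rewrite unlock; transitivity (\int[P x]_w F (((w, U w), U' w), theta w)).
  by apply: eq_integral => w _; rewrite discounted_rewardE.
have [-> _ _] := integrate_out mpair2 mtheta (m2 := bernoulli_prob p)
  (fun E D mE _ => indep_theta D mE) mF F0.
have [-> _ _] := integrate_out mpair1 mU' (m2 := law) indep_U' mF1 F10.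
by rewrite [LHS]eF2; apply: eq_integral => u _; exact: FE.
Qed.

(** The share is 1 without competitor; otherwise it is the average of the
    indicators that the opponent stops after t, strictly or not. *)
Lemma mean_shareE w (t : R) : (0 <= t)%R ->
  mean_share w t%:E = ((1 - p) + p / 2 * (1 - Gamma' t w) +
    p / 2 * fine (law [set u' | (t%:E <= gen Gamma' u' w)%E]))%:E.
Proof.
move=> t0; rewrite /mean_share; have /andP[p0 p1] := p01.
pose A := [set u' | t%:E < gen Gamma' u' w]; pose B := [set u' | t%:E <= gen Gamma' u' w].
have mA : measurable A := measurable_gen_gt hGamma' w t.
have mB : measurable B := measurable_gen_ge hGamma' w t.
transitivity (\int[law]_u' ((1 - p)%:E + (p / 2)%:E * (\1_A u')%:E + (p / 2)%:E * (\1_B u')%:E)).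
  apply: eq_integral => u' _; rewrite mean_share_theta -!EFinM -!EFinD; congr EFin.
  rewrite /share ltry !indicE /A /B.
  have -> : (u' \in [set u' | t%:E < gen Gamma' u' w]) = (t%:E < gen Gamma' u' w).
    by apply/idP/idP => [/set_mem//|]; exact: mem_set.
  have -> : (u' \in [set u' | t%:E <= gen Gamma' u' w]) = (t%:E <= gen Gamma' u' w).
    by apply/idP/idP => [/set_mem//|]; exact: mem_set.
  by case: (ltgtP t%:E (gen Gamma' u' w)) => _ /=; field.
have p20 : (0 <= p / 2)%R by rewrite divr_ge0.
have mi C : measurable C -> measurable_fun setT (fun u' : R => (p / 2)%:E * (\1_C u')%:E).
  by move=> mC; apply: measurable_funeM; apply/measurable_EFinP; exact: measurable_indic.
have i0 C (u' : R) : 0 <= (p / 2)%:E * (\1_C u')%:E by rewrite mule_ge0 ?lee_fin.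
have q0 : 0 <= (1 - p)%:E by rewrite lee_fin subr_ge0.
have iE C : measurable C -> \int[law]_u' ((p / 2)%:E * (\1_C u')%:E) = (p / 2)%:E * law C.
  move=> mC; rewrite ge0_integralZl_EFin//.
    by rewrite integral_indic// setIT.
  by apply/measurable_EFinP; exact: measurable_indic.
rewrite ge0_integralD//; first last.
- exact: mi.
- by apply: emeasurable_funD => //; exact: mi.
- by move=> u' _; rewrite adde_ge0.
rewrite ge0_integralD//; last exact: mi.
rewrite !iE// integral_cst// [X in (1 - p)%:E * X](_ : _ = 1); last exact: lawT.
rewrite mule1 [law A](mass_gt hGamma' law_tail w t0).
by rewrite -[law B]fineK ?fin_num_measure.
Qed.

End OnePlayer.

(** * Fair shares *)

Section FairShares.
Context {R : realType} {d : nat} {disp : measure_display} {Omega : measurableType disp}.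
Variables (P : 'rV[R]_d -> probability Omega R) (X : R -> Omega -> 'rV[R]_d).
Variables (r : R) (g : 'rV[R]_d -> R).
Hypothesis hX : strong_markov_process P X.
Hypothesis hreg : regular_process P X.
Hypothesis hg : payoff_function r g.
Hypothesis hV : standing_assumption P X r g.
Variables (p1 : R) (x : 'rV[R]_d).
Hypotheses (p1_gt0 : 0 < p1) (p1_lt1 : p1 < 1).
Hypothesis px : p1 < c P X r g x.
Variable law : probability R R.
Hypothesis law_tail : forall (a : R) (c : bool), 0 <= a <= 1 ->
  law [set` Interval (BSide c a) +oo%O] = (1 - a)%:E.

Notation V := (V P X r g).
Notation b := (b P X r g).
Notation tauV := (tauV P X r g).
Notation G0 := (Gamma_star0 P X r g p1 x).
Notation Z := (Z P X r g (q1 P X r g p1 x)).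
Notation Gamma2 := (Gamma2_star P X r g p1 x).
Notation gen Gamma u w := (generated_time Gamma (fun=> u) w).

(** Left-continuity: Gamma2 has no mass at a positive time. *)
Lemma Gamma2_le_left t w a : 0 < t ->
  (forall s, 0 <= s -> s < t -> Gamma2 s w <= a) -> Gamma2 t w <= a.
Proof.
move=> t0 H; rewrite leNgt; apply/negP => at_.
have /subspace_continuousP/(_ t) := @Gamma2_continuous _ _ _ _ _ _ _ _ hX hreg hg hV p1 x p1_gt0 p1_lt1 px w.
rewrite /= in_itv/= (ltW t0) => /(_ isT).
have e0 : 0 < Gamma2 t w - a by rewrite subr_gt0.
move=> /cvgrPdist_lt/(_ _ e0)[h /= h0 hP].
pose s := Num.max (t / 2) (t - h / 2).
have s0 : 0 <= s by rewrite le_max divr_ge0// ltW.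
have stt : s < t by rewrite gt_max; apply/andP; split; lra.
have sth : t - s < h.
  have : t - h / 2 <= s by rewrite le_max lexx orbT.
  lra.
have := hP s; rewrite /= in_itv/= s0 /from_subspace => /(_ _ isT).
rewrite ger0_norm; last lra.
by move=> /(_ sth); rewrite ltr_norml => /andP[_]; have := H s s0 stt; lra.
Qed.

(** Where the strategies put mass: at time 0 if there is an initial jump, and
    later when the belief moves with b. *)
Definition tight t w := if t == 0 then 0 < G0 else Z t w == b (X t w).

Section Opponent.
Variable p : R.
Hypothesis p01 : 0 <= p <= 1.
Variable Gamma' : R -> Omega -> R.
Hypothesis hGamma' : generating_process P X Gamma'.

Let m t w := fine (law [set u | (t%:E <= gen Gamma' u w)%E]).

Let m0 w : m 0 w = 1. Proof. by rewrite /m mass_ge0. Qed.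

Let mle t w s : 0 <= s -> s < t -> m t w <= 1 - Gamma' s w.
Proof.
move=> s0 st; rewrite -lee_fin fineK ?fin_num_measure//; last exact: (measurable_gen_ge hGamma').
exact: (mass_ge_upper hGamma' law_tail).
Qed.

Let mge t w : 0 <= t -> 1 - Gamma' t w <= m t w.
Proof.
move=> t0; rewrite -lee_fin fineK ?fin_num_measure//; last exact: (measurable_gen_ge hGamma').
exact: (mass_ge_lower hGamma' law_tail).
Qed.

Let g0 y : 0 <= g y := pf_ge0 hg y.

(** Against an opponent who stops at least as fast as Gamma2 prescribes, stopping
    at t leaves the share (1 - p1) / (1 - Z_t) or less; since g = (1 - b) V and
    Z <= b this is worth at most (1 - p1) V. *)
Lemma share_upper t w : X 0 w = x -> 0 <= t ->
  (forall s, 0 <= s -> p1 * Gamma2 s w <= p * Gamma' s w) ->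
  ((g (X t w))%:E * mean_share p law Gamma' w t%:E <= ((1 - p1) * V (X t w))%:E)%E.
Proof.
move=> Xx t0 G2; rewrite (mean_shareE law_tail p01 hGamma')// -EFinM lee_fin.
have /andP[p0 _] := p01; rewrite -/(m t w).
have [t0'|] := eqVneq t 0; last first.
  move=> tn0; have t_gt0 : 0 < t by rewrite lt_neqAle eq_sym tn0.
  have pm : p1 * Gamma2 t w <= p - p * m t w.
    rewrite mulrC -ler_pdivlMr//; apply: Gamma2_le_left => // s s0 st.
    rewrite ler_pdivlMr// mulrC (le_trans (G2 s s0))//.
    by have := ler_wpM2l p0 (mle w s0 st); lra.
  have share : 1 - p + p / 2 * (1 - Gamma' t w) + p / 2 * m t w <= 1 - p1 * Gamma2 t w.
    by have := G2 t t0; lra.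
  apply: le_trans (ler_wpM2l (g0 _) share) _.
  rewrite (Gamma2_compl hX hreg hg hV p1_gt0 p1_lt1 px) (gE_b hX hreg hg hV).
  have Zb := Z_le_b hX hreg hg hV p1 x w t0.
  have Z1 := Z_lt1 hX hreg hg hV p1_gt0 p1_lt1 px t w.
  have V0 := V_ge0 hX hg hV (X t w).
  rewrite mulrCA ler_wpM2l ?subr_ge0 ?(ltW p1_lt1)//.
  rewrite mulrAC -[leRHS]mul1r ler_wpM2r// ler_pdivrMr ?subr_gt0// mul1r; lra.
rewrite t0' m0 Xx; have := G2 0 (lexx 0).
rewrite (Gamma2_start hX hreg hg hV p1_gt0 p1_lt1 px Xx) => G2'.
have [tie _] := tie_at_0 hX hreg hg hV x p1_gt0 p1_lt1.
apply: le_trans tie; rewrite ler_wpM2l//; lra.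
Qed.

(** If the opponent has stopped exactly as fast as Gamma2 up to t, the estimate
    of [share_upper] is sharp where Z = b. *)
Lemma share_tight t w : X 0 w = x -> 0 <= t ->
  (forall s, 0 <= s -> p1 * Gamma2 s w <= p * Gamma' s w) ->
  p1 * Gamma2 t w = p * Gamma' t w -> tight t w ->
  ((g (X t w))%:E * mean_share p law Gamma' w t%:E = ((1 - p1) * V (X t w))%:E)%E.
Proof.
move=> Xx t0 G2 G2t; rewrite /tight => tgt; apply/eqP.
rewrite eq_le share_upper//= (mean_shareE law_tail p01 hGamma')// -EFinM lee_fin.
have /andP[p0 _] := p01; rewrite -/(m t w); move: tgt; case: eqVneq => [t0' G00|tn0 /eqP Zb].
  rewrite t0' in G2t *; rewrite m0 Xx; move: G2t.
  rewrite (Gamma2_start hX hreg hg hV p1_gt0 p1_lt1 px Xx) => G2'.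
  have [_ /(_ G00) <-] := tie_at_0 hX hreg hg hV x p1_gt0 p1_lt1.
  by rewrite ler_wpM2l//; lra.
have share : 1 - p1 * Gamma2 t w <= 1 - p + p / 2 * (1 - Gamma' t w) + p / 2 * m t w.
  by have := ler_wpM2l p0 (mge w t0); lra.
apply: le_trans (ler_wpM2l (g0 _) share).
rewrite (Gamma2_compl hX hreg hg hV p1_gt0 p1_lt1 px) (gE_b hX hreg hg hV) -Zb.
have Z1 := Z_lt1 hX hreg hg hV p1_gt0 p1_lt1 px t w.
have -> : (1 - Z t w) * V (X t w) * ((1 - p1) / (1 - Z t w)) = (1 - p1) * V (X t w).
  by field; rewrite gt_eqF// subr_gt0.
by [].
Qed.

End Opponent.

(* A strategy that is a function of the belief: it adds no mass while the belief
   is constant and is complete once the belief is 0. *)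
Section OwnTime.
Variable Gamma : R -> Omega -> R.
Hypothesis hGamma : generating_process P X Gamma.
Hypothesis GammaZ : forall s t w, 0 <= s -> 0 <= t -> Z s w = Z t w -> Gamma s w = Gamma t w.
Hypothesis Gamma0 : forall w, X 0 w = x -> 0 < Gamma 0 w -> 0 < G0.
Hypothesis Gamma_full : forall t w, 0 <= t -> Z t w <= 0 -> 1 <= Gamma t w.

Lemma gen_le_tauV u w : u < 1 -> (gen Gamma u w <= tauV w)%E.
Proof.
move=> u1; case E : (tauV w) => [t||]; last 2 first.
- by rewrite leey.
- have : (0 <= tauV w)%E by apply: le_ereal_inf_tmp => _ [t [t0 _] <-]; rewrite lee_fin.
  by rewrite E.
have t0 : 0 <= t.
  have : (0 <= tauV w)%E by apply: le_ereal_inf_tmp => _ [s [s0 _] <-]; rewrite lee_fin.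
  by rewrite E lee_fin.
apply: gen_le => //; apply: lt_le_trans u1 _; apply: Gamma_full => //.
by rewrite (Z_tauV hX hreg hg hV p1_gt0 p1_lt1 px w t0) E.
Qed.

(** A strategy that only moves with the belief generates times at which the belief
    moves. *)
Lemma gen_tight u w t : X 0 w = x -> 0 < u -> gen Gamma u w = t%:E -> tight t w.
Proof.
move=> Xx u0 gt; have t0 : 0 <= t by rewrite -lee_fin -gt gen_ge0.
rewrite /tight; case: eqVneq => [t0'|tn0].
  apply: (Gamma0 Xx); apply: lt_le_trans u0 _.
  by apply: (gen_le_Gamma hGamma) => //; rewrite gt t0'.
have t_gt0 : 0 < t by rewrite lt_neqAle eq_sym tn0.
rewrite eq_le (Z_le_b hX hreg hg hV p1 x w t0)/= leNgt; apply/negP => Zb.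
have [h h0 hP] := Z_locally_constant hX hreg hg hV t0 Zb.
have : (gen Gamma u w < (t + h)%:E)%E by rewrite gt lte_fin; lra.
move=> /gen_lt[s [s0 sth us]].
have ts : t <= s by rewrite -lee_fin -gt; exact: gen_le.
pose s' := Num.max (t / 2) (t - h / 2).
have s'0 : 0 <= s' by rewrite le_max divr_ge0// ltW.
have s't : s' < t by rewrite gt_max; apply/andP; split; lra.
have s'th : t - h / 2 <= s' by rewrite le_max lexx orbT.
have : (gen Gamma u w <= s'%:E)%E.
  apply: gen_le => //; rewrite (GammaZ (t := s))//.
  rewrite (hP s')//; first by rewrite (hP s)// ler0_norm; lra.
  by rewrite ger0_norm; lra.
by rewrite gt lee_fin leNgt s't.
Qed.

End OwnTime.

End FairShares.

(** * Payoffs against the equilibrium strategies *)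

Section Payoffs.
Local Open Scope ereal_scope.
Context {R : realType} {d : nat} {disp : measure_display} {Omega : measurableType disp}.
Variables (P : 'rV[R]_d -> probability Omega R) (X : R -> Omega -> 'rV[R]_d).
Variables (r : R) (g : 'rV[R]_d -> R).
Hypothesis hX : strong_markov_process P X.
Hypothesis hreg : regular_process P X.
Hypothesis hg : payoff_function r g.
Hypothesis hV : standing_assumption P X r g.
Variables (p1 : R) (x : 'rV[R]_d).
Hypotheses (p1_gt0 : (0 < p1)%R) (p1_lt1 : (p1 < 1)%R).
Hypothesis px : (p1 < c P X r g x)%R.
Variable law : probability R R.
Hypothesis law_tail : forall (a : R) (c : bool), (0 <= a <= 1)%R ->
  law [set` Interval (BSide c a) +oo%O] = (1 - a)%:E.

Notation V := (V P X r g).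
Notation tauV := (tauV P X r g).
Notation Gamma2 := (Gamma2_star P X r g p1 x).
Notation gen Gamma u w := (generated_time Gamma (fun=> u) w).
Notation disc := (discounted X r).
Notation VE := (fun y : 'rV[R]_d => (V y)%:E).
Notation tight := (tight P X r g p1 x).

Variables (p : R) (theta : Omega -> bool) (U U' : Omega -> R).
Hypothesis p01 : (0 <= p <= 1)%R.
Hypotheses (mtheta : measurable_fun setT theta) (mU : measurable_fun setT U)
  (mU' : measurable_fun setT U').
Hypothesis indep : forall (A : set Omega) (D : set bool) (C C' : set R),
  sigmaX X A -> measurable C -> measurable C' ->
  P x (A `&` (theta @^-1` D `&` (U @^-1` C `&` U' @^-1` C'))) =
  P x A * (bernoulli_prob p D * (law C * law C')).

Variables Gamma Gamma' : R -> Omega -> R.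
Hypotheses (hGamma : generating_process P X Gamma)
  (hGamma' : generating_process P X Gamma').
Hypothesis opponent_faster : forall s w, (0 <= s)%R -> (p1 * Gamma2 s w <= p * Gamma' s w)%R.

Notation reward := ('E_(P x)[discounted_reward X r g (generated_time Gamma U)
  (hat theta (generated_time Gamma' U'))]).
Notation cond := (conditional_reward X r g p law Gamma Gamma').

Let q0 : (0 <= 1 - p1)%R. Proof. by rewrite subr_ge0 ltW. Qed.

Let disc0 u w : 0 <= disc VE (fun w => gen Gamma u w) w.
Proof. by apply: discounted_ge0; exact: (VE_ge0 hX hg hV). Qed.

Let mdisc u : measurable_fun setT (disc VE (fun w => gen Gamma u w)).
Proof. exact: (disc_measurable r hX (measurable_VE hV) (stopping_gen hGamma u)). Qed.

Let discZ u : \int[P x]_w ((1 - p1)%:E * disc VE (fun w => gen Gamma u w) w) =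
  (1 - p1)%:E * \int[P x]_w disc VE (fun w => gen Gamma u w) w.
Proof. by rewrite ge0_integralZl_EFin. Qed.

(** The share bound puts the reward below (1 - p1) times the value process, which
    is a supermartingale. *)
Lemma conditional_reward_le u :
  \int[P x]_w cond w u <= ((1 - p1) * V x)%:E.
Proof.
apply: (@le_trans _ _ (\int[P x]_w ((1 - p1)%:E * disc VE (fun w => gen Gamma u w) w))).
  apply: ae_ge0_le_integral => //.
  - by move=> w _; exact: (conditional_reward_ge0 X hg).
  - exact: (measurable_conditional_reward hX hg law p01 hGamma hGamma').
  - by move=> w _; rewrite mule_ge0// lee_fin.
  - exact: measurable_funeM.
  apply: filterS (ae_start hX x) => w Xx _.
  rewrite /conditional_reward /discounted; have := gen_ge0 Gamma u w.
  case: (gen Gamma u w) => [t||]; rewrite ?mul0e ?mule0// lee_fin => t0.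
  rewrite -muleA [leRHS]muleCA lee_pmul2l// ?lte_fin ?expR_gt0//.
  rewrite -EFinM.
  exact: (share_upper hX hreg hg hV p1_gt0 p1_lt1 px law_tail p01 hGamma' Xx t0
    (fun s => opponent_faster w)).
rewrite discZ EFinM lee_wpmul2l ?lee_fin//.
exact: (V_supermartingale hX hg hV x (stopping_gen hGamma u)).
Qed.

Lemma payoff_le : reward <= ((1 - p1) * V x)%:E.
Proof.
have [-> mc] := reward_randomised hX hg p01 mtheta mU mU' indep hGamma hGamma'.
have law1 : law setT = 1 by exact: probability_setT.
have VE0 : 0 <= ((1 - p1) * V x)%:E by rewrite lee_fin mulr_ge0// (V_ge0 hX hg hV).
rewrite -[leRHS]mule1 -law1 -integral_cst//; apply: ge0_le_integral => //.
- by move=> u _; apply: integral_ge0 => w _; exact: (conditional_reward_ge0 X hg).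
- by move=> u _; exact: conditional_reward_le.
Qed.

Hypothesis gen_le_tauV : forall u w, (u < 1)%R -> gen Gamma u w <= tauV w.
Hypothesis gen_match : forall u w t, X 0%R w = x -> (0 < u < 1)%R -> gen Gamma u w = t%:E ->
  tight t w /\ (p1 * Gamma2 t w = p * Gamma' t w)%R.

(** The share bound is attained at the generated time, which precedes tauV, and
    until then the value process is a martingale. *)
Lemma conditional_rewardE u : (0 < u < 1)%R -> \int[P x]_w cond w u = ((1 - p1) * V x)%:E.
Proof.
move=> u01; have /andP[u0 u1] := u01.
transitivity (\int[P x]_w ((1 - p1)%:E * disc VE (fun w => gen Gamma u w) w)).
  apply: ae_eq_integral => //.
  - exact: (measurable_conditional_reward hX hg law p01 hGamma hGamma').
  - exact: measurable_funeM.
  apply: filterS (ae_start hX x) => w Xx _.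
  rewrite /conditional_reward /discounted; have := gen_ge0 Gamma u w.
  have := @gen_match u w.
  case: (gen Gamma u w) => [t||] gm; rewrite ?mul0e ?mule0// lee_fin => t0.
  have [tt G2t] := gm t Xx u01 erefl.
  rewrite -muleA [RHS]muleCA -EFinM.
  by rewrite (share_tight hX hreg hg hV p1_gt0 p1_lt1 px law_tail p01 hGamma' Xx t0
    (fun s => opponent_faster w)).
rewrite discZ (V_martingale_until_tauV hX hg hV x (stopping_gen hGamma u))//.
by move=> w; exact: gen_le_tauV.
Qed.

Lemma payoffE : reward = ((1 - p1) * V x)%:E.
Proof.
have [-> mc] := reward_randomised hX hg p01 mtheta mU mU' indep hGamma hGamma'.
have law1 : law setT = 1 by exact: probability_setT.
rewrite -[RHS]mule1 -law1 -integral_cst//; apply: ae_eq_integral => //.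
(* the levels outside ]0, 1[ have no mass *)
exists (~` `]0%R, 1%R[); split; first exact: measurableC.
  have e0 : (0 <= (0 : R) <= 1)%R by rewrite lexx ler01.
  have e1 : (0 <= (1 : R) <= 1)%R by rewrite lexx ler01.
  have tail0 := law_tail false e0; have tail1 := law_tail true e1.
  rewrite subrr in tail1; rewrite subr0 in tail0.
  apply/eqP; rewrite eq_le measure_ge0 andbT.
  have sub : (~` `]0%R, 1%R[ : set R) `<=` ~` `]0%R, +oo[ `|` `[1%R, +oo[.
    move=> u /=; rewrite !in_itv/= !andbT => /negP; rewrite negb_and -!leNgt.
    by move=> /orP[u0|u1]; [left; apply/negP; rewrite -leNgt|right].
  have mI (i : interval R) : measurable [set` i] by exact: measurable_itv.
  have mC : measurable (~` `]0%R, +oo[ : set R) by exact: measurableC.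
  have mC1 : measurable (~` `]0%R, 1%R[ : set R) by exact: measurableC.
  have mU1 := measurableU _ _ mC (mI `[1%R, +oo[).
  apply: le_trans (le_measure law (mem_set mC1) (mem_set mU1) sub) _.
  have U0 := @measureU0 _ _ _ law _ _ mC (mI `[1%R, +oo[) tail1.
  apply: (@le_trans _ _ (law (~` `]0%R, +oo[))); first by rewrite -U0.
  have -> : law (~` `]0%R, +oo[) = 1 - law [set` `]0%R, +oo[].
    exact: (@probability_setC _ _ _ law _ (mI `]0%R, +oo[)).
  by rewrite tail0 subee.
move=> u /= H; rewrite in_itv/= => u01; apply: H => _; exact: conditional_rewardE.
Qed.

End Payoffs.

Section Equilibrium.
Context {R : realType} {d : nat} {disp : measure_display} {Omega : measurableType disp}.
Variables (P : 'rV[R]_d -> probability Omega R) (X : R -> Omega -> 'rV[R]_d).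
Variables (r : R) (g : 'rV[R]_d -> R).
Hypothesis hX : strong_markov_process P X.
Hypothesis hreg : regular_process P X.
Hypothesis hg : payoff_function r g.
Hypothesis hV : standing_assumption P X r g.
Variables (p1 p2 : R) (x : 'rV[R]_d).
Hypotheses (p1_gt0 : 0 < p1) (p1_lt1 : p1 < 1) (p12 : p1 <= p2).
Hypothesis px : p1 < c P X r g x.

Notation G0 := (Gamma_star0 P X r g p1 x).
Notation q := (q1 P X r g p1 x).
Notation Z := (Z P X r g q).
Notation tauV := (tauV P X r g).
Notation Gamma1 := (Gamma1_star P X r g p1 p2 x).
Notation Gamma2 := (Gamma2_star P X r g p1 x).
Notation gen Gamma u w := (generated_time Gamma (fun=> u) w).
Notation tight := (tight P X r g p1 x).

Let hGamma1 := Gamma1_generating hX hreg hg hV p1_gt0 p1_lt1 p12 px.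
Let hGamma2 := Gamma2_generating hX hreg hg hV p1_gt0 p1_lt1 px.

Let p2_gt0 : 0 < p2. Proof. exact: lt_le_trans p1_gt0 p12. Qed.

Let Gamma2_Z s t w : 0 <= s -> 0 <= t -> Z s w = Z t w -> Gamma2 s w = Gamma2 t w.
Proof.
by move=> _ _ Zst; rewrite !(Gamma2E hX hreg hg hV p1_gt0 p1_lt1 px) Zst.
Qed.

Let Gamma1_Z s t w : 0 <= s -> 0 <= t -> Z s w = Z t w -> Gamma1 s w = Gamma1 t w.
Proof.
move=> s0 t0 Zst; rewrite !(Gamma1E hX hreg hg hV p2 p1_gt0 p1_lt1 px)// Zst.
by rewrite (Gamma2_Z s0 t0 Zst).
Qed.

Let Z_start_gt0 w : X 0 w = x -> 0 < Z 0 w.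
Proof.
move=> Xx; rewrite (Z_start hX hreg hg hV p1_gt0 p1_lt1 px Xx).
exact: (q1_gt0 hX hreg hg hV p1_gt0 p1_lt1 px).
Qed.

Let Gamma2_0 w : X 0 w = x -> 0 < Gamma2 0 w -> 0 < G0.
Proof. by move=> Xx; rewrite (Gamma2_start hX hreg hg hV p1_gt0 p1_lt1 px Xx). Qed.

Let Gamma1_0 w : X 0 w = x -> 0 < Gamma1 0 w -> 0 < G0.
Proof.
move=> Xx; rewrite (Gamma1E hX hreg hg hV p2 p1_gt0 p1_lt1 px)// Z_start_gt0// => G1.
by apply: (Gamma2_0 Xx); move: G1; rewrite pmulr_rgt0// divr_gt0.
Qed.

Let Gamma2_full t w : 0 <= t -> Z t w <= 0 -> 1 <= Gamma2 t w.
Proof. by move=> _; rewrite (Gamma2_eq1 hX hreg hg hV p1_gt0 p1_lt1 px). Qed.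

Let Gamma1_full t w : 0 <= t -> Z t w <= 0 -> 1 <= Gamma1 t w.
Proof.
move=> t0; rewrite (Gamma1E hX hreg hg hV p2 p1_gt0 p1_lt1 px)//.
by rewrite leNgt => /negbTE ->.
Qed.

Lemma gen_Gamma1_le_tauV u w : u < 1 -> (gen Gamma1 u w <= tauV w)%E.
Proof. exact: (gen_le_tauV hX hreg hg hV p1_gt0 p1_lt1 px Gamma1_full). Qed.

Lemma gen_Gamma2_le_tauV u w : u < 1 -> (gen Gamma2 u w <= tauV w)%E.
Proof. exact: (gen_le_tauV hX hreg hg hV p1_gt0 p1_lt1 px Gamma2_full). Qed.

Lemma gen_Gamma1_tight u w t : X 0 w = x -> 0 < u -> gen Gamma1 u w = t%:E -> tight t w.
Proof. exact: (gen_tight hX hreg hg hV hGamma1 Gamma1_Z Gamma1_0). Qed.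

Lemma gen_Gamma2_tight u w t : X 0 w = x -> 0 < u -> gen Gamma2 u w = t%:E -> tight t w.
Proof. exact: (gen_tight hX hreg hg hV hGamma2 Gamma2_Z Gamma2_0). Qed.

Lemma Gamma1_faster s w : 0 <= s -> p1 * Gamma2 s w <= p2 * Gamma1 s w.
Proof.
move=> s0; have := Gamma1_ge hX hreg hg hV p1_gt0 p1_lt1 p12 px w s0.
by rewrite mulrAC ler_pdivrMr// [_ * p2]mulrC.
Qed.

(** The two rates agree while Z > 0. At the time of a level below 1 Gamma2 is
    below 1, hence Z is positive: Player 2 stops before Player 1 jumps to 1. *)
Lemma gen_Gamma2_match u w t : X 0 w = x -> u < 1 -> gen Gamma2 u w = t%:E ->
  p1 * Gamma2 t w = p2 * Gamma1 t w.
Proof.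
move=> Xx u1 gt; have t0 : 0 <= t by rewrite -lee_fin -gt gen_ge0.
rewrite (Gamma1E hX hreg hg hV p2 p1_gt0 p1_lt1 px)//.
suff -> : 0 < Z t w by rewrite mulrA [p2 * _]mulrC divfK// gt_eqF.
have [->|tn0] := eqVneq t 0; first exact: Z_start_gt0.
have t_gt0 : 0 < t by rewrite lt_neqAle eq_sym tn0.
rewrite ltNge -(Gamma2_eq1 hX hreg hg hV p1_gt0 p1_lt1 px) -ltNge.
apply: le_lt_trans u1; apply: (Gamma2_le_left hX hreg hg hV p1_gt0 p1_lt1 px t_gt0).
by move=> s s0 st; apply: Gamma_before_gen => //; rewrite gt lte_fin.
Qed.

End Equilibrium.

(** * The equilibrium *)

Section UniformLaw.
Context {R : realType} {disp : measure_display} {Omega : measurableType disp}.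

(** The law of U as a measure on the Borel sets of R, with which product measures
    are formed. *)
Lemma exists_uniform_law (Q : probability Omega R) (U : Omega -> R) :
  measurable_fun setT U ->
  (forall C : set R, measurable C -> Q (U @^-1` C) = uniform_prob (@ltr01 R) C) ->
  exists law : probability R R,
    (forall C : set R, measurable C -> law C = uniform_prob (@ltr01 R) C) /\
    (forall (a : R) (c : bool), 0 <= a <= 1 ->
      law [set` Interval (BSide c a) +oo%O] = (1 - a)%:E).
Proof.
move=> mU lawU.
pose Um : {mfun Omega >-> R} := HB.pack U (isMeasurableFun.Build _ _ _ _ _ mU).
exists (distribution Q Um); split => [C mC|a c a01]; first exact: lawU.
by rewrite -(uniform_tail c a01); apply: lawU; exact: measurable_itv.
Qed.

End UniformLaw.

Theorem theorem5p1 (R : realType) (d : nat) (disp : measure_display)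
    (Omega : measurableType disp)
    (P : 'rV[R]_d -> probability Omega R) (X : R -> Omega -> 'rV[R]_d)
    (theta1 theta2 : Omega -> bool) (U1 U2 : Omega -> R)
    (r : R) (g : 'rV[R]_d -> R) (p1 p2 : R) (x : 'rV[R]_d)
    (hX : strong_markov_process P X)
    (hreg : regular_process P X)
    (hind : independent_randomisation P X theta1 theta2 U1 U2 p1 p2)
    (hg : payoff_function r g)
    (hV : standing_assumption P X r g)
    (hp1 : 0 < p1) (hp12 : p1 <= p2) (hp2 : p2 <= 1) (hp1lt1 : p1 < 1) :
  ((Cbar P X r g `|` Cprime P X r g) (p1, x) <-> p1 < c P X r g x) /\
  ((Cbar P X r g `|` Cprime P X r g) (p1, x) ->
   let Gamma1 := Gamma1_star P X r g p1 p2 x in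
   let Gamma2 := Gamma2_star P X r g p1 x in
   let tau' := generated_time Gamma1 U1 in
   let gamma' := generated_time Gamma2 U2 in
   [/\ generating_process P X Gamma1,
       generating_process P X Gamma2,
       nash_equilibrium P X r g theta1 theta2 U1 U2 x tau' gamma',
       J1 P X r g theta1 tau' gamma' x = ((1 - p1) * V P X r g x)%:E &
       J2 P X r g theta2 tau' gamma' x = ((1 - p1) * V P X r g x)%:E]).
Proof.
have p1_01 : 0 < p1 < 1 by rewrite hp1.
have regE := regionE hX hreg hg hV x p1_01.
split => // /regE px Gamma1 Gamma2 tau' gamma'.
have mU1 := ir_U1_measurable hind; have mU2 := ir_U2_measurable hind.
have [law [lawE law_tail]] := exists_uniform_law mU1 (ir_U1_law hind x).
have p1_c : 0 <= p1 <= 1 by rewrite !ltW.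
have p2_c : 0 <= p2 <= 1 by rewrite hp2 andbT (le_trans (ltW hp1)).
have P1 : P x setT = 1%E by exact: probability_setT.
have ind1 (A : set Omega) (D : set bool) (C C' : set R) :
    sigmaX X A -> measurable C -> measurable C' ->
    P x (A `&` (theta1 @^-1` D `&` (U1 @^-1` C `&` U2 @^-1` C'))) =
    (P x A * (bernoulli_prob p1 D * (law C * law C')))%E.
  move=> sA mC mC'; rewrite !lawE// -(ir_theta1_law hind x).
  rewrite -(ir_U1_law hind x mC) -(ir_U2_law hind x mC').
  have := ir_independent hind x D setT sA mC mC'.
  by rewrite preimage_setT setIT -!setIA P1 mule1 -!muleA.
have ind2 (A : set Omega) (D : set bool) (C C' : set R) :
    sigmaX X A -> measurable C -> measurable C' ->
    P x (A `&` (theta2 @^-1` D `&` (U2 @^-1` C `&` U1 @^-1` C'))) =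
    (P x A * (bernoulli_prob p2 D * (law C * law C')))%E.
  move=> sA mC mC'; rewrite !lawE// -(ir_theta2_law hind x).
  rewrite -(ir_U2_law hind x mC) -(ir_U1_law hind x mC').
  rewrite [U2 @^-1` _ `&` _]setIC [X in (_ * (_ * X))%E]muleC.
  have := ir_independent hind x setT D sA mC' mC.
  by rewrite preimage_setT setIT -!setIA P1 mule1 -!muleA.
have g1 : generating_process P X Gamma1 := Gamma1_generating hX hreg hg hV hp1 hp1lt1 hp12 px.
have g2 : generating_process P X Gamma2 := Gamma2_generating hX hreg hg hV hp1 hp1lt1 px.
have mt1 := ir_theta1_measurable hind; have mt2 := ir_theta2_measurable hind.
have fast2 s w (s0 : 0 <= s) : p1 * Gamma2 s w <= p1 * Gamma2 s w by [].
have fast1 s w (s0 : 0 <= s) : p1 * Gamma2 s w <= p2 * Gamma1 s w.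
  exact: (Gamma1_faster hX hreg hg hV hp1 hp1lt1 hp12 px).
have J1E : J1 P X r g theta1 tau' gamma' x = ((1 - p1) * V P X r g x)%:E.
  apply: (payoffE hX hreg hg hV hp1 hp1lt1 px law_tail p1_c mt1 mU1 mU2 ind1 g1 g2 fast2).
    by move=> u w; exact: (gen_Gamma1_le_tauV hX hreg hg hV p2 hp1 hp1lt1 px).
  move=> u w t Xx /andP[u0 _] gt; split => //.
  exact: (gen_Gamma1_tight hX hreg hg hV hp1 hp1lt1 hp12 px Xx u0 gt).
have J2E : J2 P X r g theta2 tau' gamma' x = ((1 - p1) * V P X r g x)%:E.
  apply: (payoffE hX hreg hg hV hp1 hp1lt1 px law_tail p2_c mt2 mU2 mU1 ind2 g2 g1 fast1).
    by move=> u w; exact: (gen_Gamma2_le_tauV hX hreg hg hV hp1 hp1lt1 px).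
  move=> u w t Xx /andP[u0 u1] gt; split.
    exact: (gen_Gamma2_tight hX hreg hg hV hp1 hp1lt1 px Xx u0 gt).
  exact: (gen_Gamma2_match hX hreg hg hV hp1 hp1lt1 hp12 px Xx u1 gt).
split => //; split.
- by exists Gamma1.
- by exists Gamma2.
- move=> _ [Gamma hGamma <-]; rewrite J1E.
  exact: (payoff_le hX hreg hg hV hp1 hp1lt1 px law_tail p1_c mt1 mU1 mU2 ind1 hGamma g2 fast2).
- move=> _ [Gamma hGamma <-]; rewrite J2E.
  exact: (payoff_le hX hreg hg hV hp1 hp1lt1 px law_tail p2_c mt2 mU2 mU1 ind2 hGamma g1 fast1).
Qed.
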